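(* Suppose that the true function $f_0$ is in $H^\gamma(\mathbb{H}_1)$ for some $\gamma>0$ and that the problem is mildly ill-posed with regularity $\alpha\ge0$, i.e. there are constants $C_1,C_2>0$ such that $C_1(1+k^2)^{-\alpha/2}\le|\rho_k|\le C_2(1+k^2)^{-\alpha/2}$ as $k\to\infty$. Let $\Pi$ be the sieve prior with truncation-level probability mass function $h$, coefficient density $q$ and scales $\{\tau_k\}$. Suppose $B_1e^{-b_1m}\le h(m)\le B_2e^{-b_2m}$ for all $m\in\mathbb{N}$, for some constants $B_1,B_2,b_1,b_2>0$, and that $q$ satisfies $q(x)\ge De^{-d|x|^w}$ for all $x\in\mathbb{R}$ (or $\mathbb{C}$) and some constants $D,d>0$ and $w\ge1$. Suppose moreover that the scale parameters satisfy $$B_3(1+k^2)^{-\gamma_0/2}(\log k)^{-1/w}\le\tau_k\le B_4(1+k^2)^{(\alpha+1)/2}\qquad(k\ge2)$$ for some $B_3,B_4>0$ and $\gamma_0\le\gamma$. Then for a sufficiently large constant $C>0$, $$\Pi\left(f\in\mathbb{H}_1:\|f-f_0\|_1>C\,\frac{(\log n)^{\eta}}{n^{\gamma/(2\alpha+2\gamma+1)}}\ \Big|\ Y\right)\to0$$ in $\mathbb{P}_{f_0}$-probability as $n\to\infty$, where $\eta=\frac{(2\alpha+1)(\alpha+\gamma)}{2\alpha+2\gamma+1}$.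
   Context: $\mathbb{H}_1,\mathbb{H}_2$ are separable Hilbert spaces with inner products $\langle\cdot,\cdot\rangle_i$ and norms $\|\cdot\|_i$, $i=1,2$. $A:\mathbb{H}_1\to\mathbb{H}_2$ is a known, injective, continuous linear operator with adjoint $A^*$. It is assumed throughout that there is an orthonormal basis $\{e_k\}_{k\ge 1}$ of $\mathbb{H}_1$ consisting of eigenvectors of $A^*A$, with $A^*Ae_k=\rho_k^2 e_k$ ($A$ need not be compact), and $\{g_k\}$ is the conjugate orthonormal system in $\mathbb{H}_2$ (an orthonormal basis of the range of $A$) defined by $Ae_k=\rho_k g_k$. Write $f_k=\langle f,e_k\rangle_1$. Model: for each $n\ge1$ one observes $Y=Y^{(n)}=Af+n^{-1/2}Z$, where $Z$ is Gaussian white noise on $\mathbb{H}_2$, interpreted as the Gaussian process $Y=(Y_h:h\in\mathbb{H}_2)$, $Y_h=\langle Af,h\rangle_2+n^{-1/2}Z_h$, where $(Z_h)$ is a mean-zero Gaussian process with $\mathbb{E}Z_hZ_{h'}=\langle h,h'\rangle_2$. Its law is denoted $\mathbb{P}_f$. Equivalently, one observes the independent variables $Y_k:=Y_{g_k}\sim N(\rho_kf_k,n^{-1})$, $k\ge1$. The data $Y$ are generated from $\mathbb{P}_{f_0}$. Posterior: for a prior $\Pi$ on a $\sigma$-algebra $\mathcal{B}$, with support $\mathcal{P}$, the posterior is (written for real scalars) $\Pi(B\mid Y)=\int_B e^{n\sum_k\rho_kf_kY_k-\frac n2\|Af\|_2^2}d\Pi(f)\big/\int_{\mathcal{P}} e^{n\sum_k\rho_kf_kY_k-\frac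 n2\|Af\|_2^2}d\Pi(f)$, $B\in\mathcal{B}$. Sobolev scale: for $s\ge0$, $H^s(\mathbb{H}_1)=\{f\in\mathbb{H}_1:\|f\|_{H^s}^2:=\sum_{k\ge1}|f_k|^2(1+k^2)^s<\infty\}$. Sieve prior: $\Pi$ is the law of $f=\sum_{k=1}^M f_ke_k$, where $M$ is an $\mathbb{N}$-valued random variable with probability mass function $h$, and, given $M$, the $f_k$ are independent (real or complex as required) random variables with densities $\tau_k^{-1}q(\tau_k^{-1}\cdot)$, for a fixed density $q$ on $\mathbb{R}$ (or $\mathbb{C}$) and a fixed sequence $\{\tau_k\}$ of positive scale parameters. That is, $\Pi=\sum_{m\ge1}h(m)\Pi_m$ with $\Pi_m(x_1,\dots,x_m)=\prod_{k=1}^m\tau_k^{-1}q(x_k/\tau_k)$. *)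

(* Defs.v *)
From HB Require Import structures.
From mathcomp Require Import all_boot all_order all_algebra.
From mathcomp Require Import all_classical all_reals all_analysis.
From mathcomp Require Import complex.

Set Implicit Arguments.
Unset Strict Implicit.
Unset Printing Implicit Defensive.

Import Order.TTheory GRing.Theory Num.Theory.
Import numFieldNormedType.Exports.

Local Open Scope classical_set_scope.
Local Open Scope ring_scope.

(* Common interface to the two scalar fields K = R and K = C = R[i].
   [sbasis] is a basis of K over R, and [scoord], [sofcoord], [sleb] describe K as
   the measurable space R or R * R carrying Lebesgue measure (the library has
   no measurable structure on R[i]). *)
Record scalars (R : realType) := Scalars {
  scalar :> numFieldType;
  sconj : scalar -> scalar;
  sre : scalar -> R;
  sofR : R -> scalar;
  sbasis : seq scalar;
  sdisp : measure_display;
  scoord : measurableType sdisp;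
  sofcoord : scoord -> scalar;
  sleb : {measure set scoord -> \bar R} }.

Definition real_scalars (R : realType) : scalars R :=
  @Scalars R R idfun idfun idfun [:: 1] _ (measurableTypeR R) idfun
    (@lebesgue_measure R).

Definition complex_scalars (R : realType) : scalars R :=
  @Scalars R (complex R : numFieldType) (@conjc R) (@complex.Re R)
    (fun x => Complex x 0) [:: 1; Complex 0 1] _
    (measurableTypeR R * measurableTypeR R)%type
    (fun p => Complex p.1 p.2)
    ((@lebesgue_measure R) \x (@lebesgue_measure R))%E.

Definition sabs (R : realType) (K : scalars R) (x : K) : R := sre `|x|.

(* The norm of a normed K-module is K-valued in the library; this is the same
   norm as a real number. *)
Definition rnorm (R : realType) (K : scalars R) (V : normedModType K) (v : V)
  : R := sre `|v|.

(* Inner products are linear in their first argument. *)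
Definition hilbert_norm (R : realType) (K : scalars R) (H : normedModType K)
    (ip : {dot H for @sconj R K}) : Prop :=
  forall x : H, `|x| ^+ 2 = ip x x.

Definition separable (T : topologicalType) : Prop :=
  exists2 D : set T, countable D & dense D.

(* Sequences indexed by k >= 1 are represented from 0: e k stands for e_{k+1},
   and likewise for g, rho and tau. *)
Definition orthonormal_system (R : realType) (K : scalars R)
    (H : normedModType K) (ip : {dot H for @sconj R K}) (e : nat -> H) : Prop :=
  forall j k, ip (e j) (e k) = (j == k)%:R.

Definition orthonormal_basis (R : realType) (K : scalars R)
    (H : normedModType K) (ip : {dot H for @sconj R K}) (e : nat -> H) : Prop :=
  orthonormal_system ip e /\
  forall f : H, series (fun k => ip f (e k) *: e k) @ \oo --> f.

Definition is_adjoint (R : realType) (K : scalars R) (H1 H2 : normedModType K)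
    (ip1 : {dot H1 for @sconj R K}) (ip2 : {dot H2 for @sconj R K})
    (A : H1 -> H2) (Astar : H2 -> H1) : Prop :=
  forall f h, ip2 (A f) h = ip1 f (Astar h).

(* 1 + k^2 at the index k.+1 *)
Definition weight (R : realType) (k : nat) : R := 1 + k.+1%:R ^+ 2.

Definition sobolev (R : realType) (K : scalars R) (H : normedModType K)
    (ip : {dot H for @sconj R K}) (e : nat -> H) (s : R) : set H :=
  [set f | (\sum_(0 <= k <oo)
     (sabs (ip f (e k)) ^+ 2 * weight R k `^ s)%:E < +oo)%E].

Definition mildly_ill_posed (R : realType) (alpha : R) (rho : nat -> R) : Prop :=
  exists C1 C2 : R, [/\ 0 < C1, 0 < C2 &
    \forall k \near \oo,
      C1 * weight R k `^ (- alpha / 2) <= `|rho k|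
        <= C2 * weight R k `^ (- alpha / 2)].

(* Degenerate Gaussians are included; [normal_prob m 0] is not a Dirac mass. *)
Definition gaussian_law (R : realType) d (T : measurableType d)
    (P : probability T R) (X : T -> R) : Prop :=
  exists m s : R, forall B : set (measurableTypeR R), measurable B ->
    P (X @^-1` B) = if s == 0 then \d_m B else normal_prob m s B.

Definition gaussian_process (R : realType) d (T : measurableType d)
    (P : probability T R) (I : Type) (Z : I -> T -> R) : Prop :=
  (forall i, measurable_fun setT (Z i)) /\
  forall (m : nat) (i : 'I_m -> I) (a : 'I_m -> R),
    gaussian_law P (fun w => \sum_(j < m) a j * Z (i j) w).

(* For complex scalars, H is regarded as a real Hilbert space with inner
   product Re <h, h'>; the real process indexed by H then carries both
   the real part (Z_h) and the imaginary part (Z_{ih}) of the complex noise. *)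
Definition white_noise (R : realType) (K : scalars R) (H : normedModType K)
    (ip : {dot H for @sconj R K}) d (T : measurableType d)
    (P : probability T R) (Z : H -> T -> R) : Prop :=
  [/\ gaussian_process P Z,
      forall h, ('E_P[Z h] = 0)%E &
      forall h h', ('E_P[(fun w => Z h w * Z h' w)%R] = (sre (ip h h'))%:E)%E].

Definition observation (R : realType) (K : scalars R) (H1 H2 : normedModType K)
    (ip2 : {dot H2 for @sconj R K}) (A : H1 -> H2) (f : H1) (n : nat)
    (T : Type) (Z : H2 -> T -> R) (w : T) : H2 -> R :=
  fun h => sre (ip2 (A f) h) + n%:R `^ (- 2^-1) * Z h w.

(* Y_k = Y_{g_k} for real scalars, and Y_k = Y_{g_k} + i Y_{i g_k}, which is
   <Af, g_k> plus noise, for complex scalars. *)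
Definition data_coord (R : realType) (K : scalars R) (H : normedModType K)
    (g : nat -> H) (Y : H -> R) (k : nat) : K :=
  \sum_(u <- sbasis K) sofR K (Y (u *: g k)) * u.

(* For complex scalars the product f_k Y_k becomes Re (f_k * conj Y_k). *)
Definition log_likelihood (R : realType) (K : scalars R)
    (H1 H2 : normedModType K) (ip1 : {dot H1 for @sconj R K}) (A : H1 -> H2)
    (e : nat -> H1) (g : nat -> H2) (rho : nat -> R)
    (n : nat) (Y : H2 -> R) (f : H1) : R :=
  n%:R * limn (series (fun k =>
            rho k * sre (ip1 f (e k) * sconj (data_coord g Y k))))
  - n%:R / 2 * rnorm (A f) ^+ 2.

Definition borel (T : ptopologicalType) := g_sigma_algebraType (@open T).

Definition support (R : realType) (T : ptopologicalType)
    (Pi : probability (borel T) R) : set T :=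
  [set x | forall U : set T, open U -> U x -> (0 < Pi U)%E].

Definition posterior (R : realType) (K : scalars R) (H1 H2 : normedModType K)
    (ip1 : {dot H1 for @sconj R K}) (A : H1 -> H2)
    (e : nat -> H1) (g : nat -> H2) (rho : nat -> R)
    (Pi : probability (borel H1) R) (n : nat) (Y : H2 -> R) (B : set H1) : R :=
  let lik f := (expR (log_likelihood ip1 A e g rho n Y f))%:E in
  fine (\int[Pi]_(f in B) lik f)%E / fine (\int[Pi]_(f in support Pi) lik f)%E.

(* probability mass function on {1, 2, ...}; h 0 is irrelevant *)
Definition is_pmf (R : realType) (h : nat -> R) : Prop :=
  (forall m, (1 <= m)%N -> 0 <= h m) /\
  (\sum_(1 <= m <oo) (h m)%:E = 1)%E.

Definition is_density (R : realType) (K : scalars R) (q : K -> R) : Prop :=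
  [/\ measurable_fun setT (q \o @sofcoord R K),
      forall x, 0 <= q x &
      (\int[sleb K]_x (q (sofcoord x))%:E = 1)%E].

(* The density of t * xi when xi has density q; the Jacobian is t^-1 on R
   and t^-2 on C. *)
Definition scaled_density (R : realType) (K : scalars R) (q : K -> R) (t : R)
    (x : K) : R :=
  t^-1 ^+ size (sbasis K) * q (sofR K t^-1 * x).

(* Pi is the law of f = \sum_(k < M) X_k e_k, where M has mass function h and,
   given M = m, the coefficients X_0, ..., X_{m-1} are independent with the
   scaled densities; the joint law is given on measurable rectangles. *)
Definition sieve_prior (R : realType) (K : scalars R) (H : normedModType K)
    (e : nat -> H) (h : nat -> R) (q : K -> R) (tau : nat -> R)
    (Pi : probability (borel H) R) : Prop :=
  exists (d : measure_display) (T : measurableType d) (P : probability T R)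
    (M : T -> nat) (X : nat -> T -> scoord K),
  [/\ measurable_fun setT M,
      forall k, measurable_fun setT (X k),
      forall m, (1 <= m)%N -> P (M @^-1` [set m]) = (h m)%:E,
      forall m (B : nat -> set (scoord K)), (1 <= m)%N ->
        (forall k, measurable (B k)) ->
        P [set w | M w = m /\ forall k, (k < m)%N -> B k (X k w)] =
        (h m * \prod_(k < m)
           \int[sleb K]_(x in B k) scaled_density q (tau k) (sofcoord x))%:E &
      forall S : set (borel H), measurable S ->
        Pi S = P ((fun w => \sum_(k < M w) sofcoord (X k w) *: e k) @^-1` S)].

Definition cvg_in_probability0 (R : realType) (d : nat -> measure_display)
    (T : forall n, measurableType (d n)) (P : forall n, probability (T n) R)
    (X : forall n, T n -> R) : Prop :=
  forall eps : R, 0 < eps ->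
    (fun n => P n [set w | eps <= `|X n w|]) @ \oo --> 0%E.

(* Main.v *)
From HB Require Import structures.
From mathcomp Require Import all_boot all_order all_algebra.
From mathcomp Require Import all_classical all_reals all_analysis.
From mathcomp Require Import lebesgue_measure measurable_realfun.
From mathcomp Require Import complex.
From mathcomp Require Import ring lra.
Require Import Defs.

(** Write F_m for the span of the first m basis vectors, P_m for the projection on
    it, N = 2 alpha + 2 gamma + 1, and x = (n / ln n)^(1/N).  The dimension J of order x
    balances n |A f0 - A P_J f0|^2, of order n x^(-2 (alpha + gamma)), against
    v = J ln n.  The argument compares three exponents, all of order v.

    Prior mass.  The coefficients of f0 decay at least as fast as the scales tau_k up
    to logarithms, so a box of radius 1/n around the first J coefficients of f0 has
    prior mass at least exp(-C v) ([prior_ball]).  Beyond dimension K = Lc v the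
    prior has mass at most a multiple of exp(-b2 Lc v) ([prior_span_tail]).

    Likelihood.  On F_K the log-likelihood ratio against f0 is exactly a linear form
    in the noise minus n |A f - A f0|^2 / 2 ([log_ratio]), and as A* A is diagonal the
    bias separates from A (f - P_K f0) ([image_residual_orthogonal]).  The linear form
    involves the noise coordinates of F_K, whose energy is at most twice its
    expectation, of order K, with probability tending to 1 ([noise_chi_square]), and
    one further Gaussian variable.  Hence, with T^2 = n |A (f - P_K f0)|^2, the ratio is
    at most C v - T^2 / 4, and at least -C' v when T^2 is of order v
    ([bad_event_upper], [bad_event_lower]).

    Outside F_K the likelihood ratio has expectation 1 for each f, so by Tonelli the
    numerator there is of the order of the prior mass of the complement of F_K.

    Separation.  If f in F_K is at distance C rate from f0, inverting A on F_K shows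
    that T^2 is at least a multiple of C^2 v ([separation]): the logarithm in K, raised
    to the power alpha, explains the exponent eta.

    So the posterior mass of the alternatives is small ([posterior_small]) as soon as
    b2 Lc exceeds the exponent lost in the denominator, which contains the energy of
    K = Lc v noise coordinates.  This is not circular: the weight lam in
    [bad_event_lower] makes the dependence of that loss on Lc as small as b2 Lc / 2.
    The constant C is chosen last.  Throughout, complex scalars are treated as pairs
    of real coordinates. *)

Set Implicit Arguments.
Unset Strict Implicit.
Unset Printing Implicit Defensive.

Import Order.TTheory GRing.Theory Num.Theory.
Import numFieldNormedType.Exports.

Local Open Scope classical_set_scope.
Local Open Scope ring_scope.

(** * Exponential inequalities for moments *)

Section cosh_bounds.
Variable R : realType.

Let cterm (y : R) k : R := exp_coeff y k + exp_coeff (- y) k.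

Let cterm_cvg y : series (cterm y) @ \oo --> expR y + expR (- y).
Proof.
have -> : series (cterm y) = series (exp_coeff y) \+ series (exp_coeff (- y)).
  by apply/funext => n; rewrite /series /= big_split.
have h (z : R) : series (exp_coeff z) @ \oo --> expR z by have := is_cvg_series_exp_coeff z; rewrite /expR.
exact: (cvgD (h y) (h (- y))).
Qed.

Let ctermE y k : cterm y k = (1 + (-1) ^+ k) * y ^+ k / k`!%:R.
Proof.
rewrite /cterm /exp_coeff /= (exprNn y). ring.
Qed.

Let cterm_ge0 y k : 0 <= cterm y k.
Proof.
rewrite ctermE -signr_odd; have [ok|ek] := boolP (odd k).
  by rewrite expr1 subrr !mul0r.
rewrite expr0 mulr_ge0 ?invr_ge0 // mulr_ge0 //.
by rewrite exprn_even_ge0.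
Qed.

Let cterm_shift y k : cterm y k.+4 <= y ^+ 4 / 12 * cterm y k.
Proof.
rewrite !ctermE.
have y4 : 0 <= y ^+ 4 by rewrite exprn_even_ge0.
have := cterm_ge0 y k; rewrite ctermE; set a := _ * y ^+ k => a0.
have {}a0 : 0 <= a.
  by move: a0; rewrite pmulr_lge0 // invr_gt0 ltr0n fact_gt0.
have -> : (1 + (-1) ^+ k.+4) * y ^+ k.+4 = y ^+ 4 * a.
  by rewrite /a -addn4 !exprD; ring.
have -> : y ^+ 4 / 12 * (a / k`!%:R) = y ^+ 4 * a * (12 * k`!%:R)^-1.
  by rewrite invfM; ring.
apply: ler_wpM2l; first exact: mulr_ge0.
rewrite lef_pV2 ?posrE ?mulr_gt0 ?ltr0n ?fact_gt0 //.
rewrite -natrM ler_nat !factS !mulnA leq_mul2r; apply/orP; right.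
by rewrite (leq_trans _ (leq_mul (leq_mul (leq_mul (_ : 4 <= _) (_ : 3 <= _)) (_ : 2 <= _)) (_ : 1 <= _)))%N.
Qed.

Let ctermS4 y n : series (cterm y) (4 + n)%N
   = 2 + y ^+ 2 + \sum_(0 <= k < n) cterm y k.+4.
Proof.
rewrite /series /= (big_cat_nat (n := 4)) //=.
congr (_ + _).
  rewrite !big_nat_recr //= big_geq // !ctermE !factS fact0.
  by rewrite !exprS !expr0; field.
by rewrite -{1}(add0n 4%N) big_addn addnC addnK; apply: eq_bigr => i _; rewrite addn4.
Qed.

(** The bounds [cosh_ge] and [cosh_le] read the second and fourth moments off a
    moment generating function.  In the power series of e^y + e^-y the odd terms
    cancel and the even ones are nonnegative, so truncation bounds from below. *)
Lemma cosh_ge (y : R) : 2 + y ^+ 2 + y ^+ 4 / 12 <= expR y + expR (- y).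
Proof.
have nd : nondecreasing_seq (series (cterm y)).
  by apply/nondecreasing_seqP => n; rewrite /series /= big_nat_recr //= lerDl.
have := nondecreasing_cvgn_le nd (cvgP _ (@cterm_cvg y)) (4 + 1)%N.
rewrite (cvg_lim (@Rhausdorff R) (@cterm_cvg y)); apply: le_trans.
rewrite ctermS4 big_nat1 ctermE lerD2l !factS fact0.
rewrite le_eqVlt; apply/orP; left; apply/eqP.
by rewrite !exprS !expr0; field.
Qed.

(** The terms of order at least 4 are dominated by shifting the series: the term
    of index k + 4 is at most y^4 / 12 times the term of index k. *)
Lemma cosh_le (y : R) :
  expR y + expR (- y) <= 2 + y ^+ 2 + y ^+ 4 / 12 * (expR y + expR (- y)).
Proof.
have nd : nondecreasing_seq (series (cterm y)).
  by apply/nondecreasing_seqP => n; rewrite /series /= big_nat_recr //= lerDl.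
have le n := nondecreasing_cvgn_le nd (cvgP _ (@cterm_cvg y)) n.
rewrite (cvg_lim (@Rhausdorff R) (@cterm_cvg y)) in le.
rewrite -{1}(cvg_lim (@Rhausdorff R) (@cterm_cvg y)).
apply: limr_le; first exact: (cvgP _ (@cterm_cvg y)).
near=> n; apply: (le_trans (nd n (4 + n)%N _)); first by rewrite leq_addl.
rewrite ctermS4 lerD2l.
have y4 : 0 <= y ^+ 4 / 12 by rewrite mulr_ge0 // exprn_even_ge0.
apply: (le_trans _ (ler_wpM2l y4 (le n))).
by rewrite /series /= mulr_sumr; apply: ler_sum => i _; exact: cterm_shift.
Unshelve. all: by end_near. Qed.

End cosh_bounds.

(** * Nonnegative integrals and the moment generating function *)

Section density.
Context d (T : measurableType d) (R : realType).
Variables (mu nu : {measure set T -> \bar R}) (p : T -> R).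
Hypotheses (mp : measurable_fun setT p) (p0 : forall x, 0 <= p x).
Hypothesis nuE : forall A, measurable A -> nu A = (\int[mu]_(x in A) (p x)%:E)%E.

Import HBNNSimple.

(** Approximation by simple functions.  It turns an expectation under a normal
    law into a Lebesgue integral against the normal density. *)
Lemma integral_density (f : T -> \bar R) : measurable_fun setT f ->
  (forall x, 0 <= f x)%E ->
  (\int[nu]_x f x = \int[mu]_x (f x * (p x)%:E))%E.
Proof.
move=> mf f0.
have mEp : measurable_fun setT (fun x => (p x)%:E) by exact/measurable_EFinP.
pose h := nnsfun_approx measurableT mf.
have cvh x : EFin \o h^~ x @ \oo --> f x by exact: cvg_nnsfun_approx.
have -> : (\int[nu]_x f x = lim (\int[nu]_x (EFin \o h n) x @[n --> \oo]))%E.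
  rewrite -monotone_convergence//=.
  - by apply: eq_integral => x _; apply/esym/cvg_lim => //; exact: cvh.
  - by move=> n; exact/measurable_EFinP/measurable_funTS.
  - by move=> n x _; rewrite lee_fin.
  - by move=> x _ a b ab; rewrite lee_fin; exact/lefP/nd_nnsfun_approx.
have -> : (\int[mu]_x (f x * (p x)%:E) =
    lim (\int[mu]_x ((EFin \o h n) x * (p x)%:E) @[n --> \oo]))%E.
  rewrite -monotone_convergence//=.
  - apply: eq_integral => x _; apply/esym/cvg_lim => //.
    by apply: cvgeZr => //; exact: cvh.
  - move=> n; apply: emeasurable_funM => //.
    exact/measurable_EFinP/measurable_funTS.
  - by move=> n x _; rewrite mule_ge0 ?lee_fin.
  - move=> x _ a b ab; rewrite lee_wpmul2r ?lee_fin//.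
    exact/lefP/nd_nnsfun_approx.
congr (limn _); apply/funext => n.
transitivity (\int[nu]_x
   (\sum_(y \in range (h n)) (y * \1_(h n @^-1` [set y]) x)%:E))%E.
  by apply: eq_integral => t _; rewrite /= fimfunE -fsumEFin.
have indich r : measurable_fun setT (fun x => (r * \1_(h n @^-1` [set r]) x)%:E).
  by apply/measurable_EFinP; exact: measurable_funM.
rewrite ge0_integral_fsum//; last by move=> y x _; exact: nnfun_muleindic_ge0.
transitivity (\int[mu]_x (\sum_(y \in range (h n))
    ((y * \1_(h n @^-1` [set y]) x)%:E * (p x)%:E)))%E; last first.
  apply: eq_integral => x _.
  rewrite -ge0_mule_fsuml => [|y]; last exact: nnfun_muleindic_ge0.
  by rewrite fsumEFin // -(fimfunE _ x).
rewrite ge0_integral_fsum//; last 2 first.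
  - by move=> y; apply: emeasurable_funM.
  - by move=> y x _; apply: mule_ge0; [exact: nnfun_muleindic_ge0|rewrite lee_fin p0].
apply: eq_fsbigr => r rhn.
under eq_integral do rewrite EFinM.
rewrite integralZl_indic_nnsfun => //.
under [RHS]eq_integral do rewrite EFinM -muleA.
have r0 : 0 <= r by move: rhn; rewrite inE /= => -[x _ <-].
rewrite ge0_integralZl//; last 2 first.
- apply: emeasurable_funM => //; exact/measurable_EFinP.
- by move=> x _; rewrite mule_ge0 ?lee_fin.
congr (_ * _)%E; rewrite integral_indic // setIT nuE //.
rewrite integral_mkcond /=; apply: eq_integral => x _.
by rewrite patchE indicE; case: ifPn => _; rewrite ?mul1e ?mul0e.
Qed.
End density.

Section integral_real.
Context d (T : measurableType d) (R : realType) (mu : {measure set T -> \bar R}).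
Implicit Types f g : T -> R.

Lemma integral_realD f g :
  measurable_fun setT f -> measurable_fun setT g ->
  (forall x, 0 <= f x) -> (forall x, 0 <= g x) ->
  (\int[mu]_x (f x + g x)%:E = \int[mu]_x (f x)%:E + \int[mu]_x (g x)%:E)%E.
Proof.
move=> mf mg f0 g0; under eq_integral do rewrite EFinD.
by rewrite ge0_integralD //; [move=> *; rewrite lee_fin| exact/measurable_EFinP
  | move=> *; rewrite lee_fin| exact/measurable_EFinP].
Qed.

Lemma integral_realZ (k : R) f : measurable_fun setT f ->
  (forall x, 0 <= f x) -> 0 <= k ->
  (\int[mu]_x (k * f x)%:E = k%:E * \int[mu]_x (f x)%:E)%E.
Proof.
move=> mf f0 k0; under eq_integral do rewrite EFinM.
by rewrite ge0_integralZl //; [exact/measurable_EFinP | move=> *; rewrite lee_fin].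
Qed.

Lemma integral_real_le f g :
  measurable_fun setT f -> measurable_fun setT g ->
  (forall x, 0 <= f x) -> (forall x, f x <= g x) ->
  (\int[mu]_x (f x)%:E <= \int[mu]_x (g x)%:E)%E.
Proof.
move=> mf mg f0 fg; apply: ge0_le_integral => //; try by move=> *; rewrite lee_fin.
- exact/measurable_EFinP.
- exact/measurable_EFinP.
Qed.

Lemma integral_real_sum (I : Type) (s : seq I) (f : I -> T -> R) :
  (forall i, measurable_fun setT (f i)) -> (forall i x, 0 <= f i x) ->
  (\int[mu]_x (\sum_(i <- s) f i x)%:E = \sum_(i <- s) \int[mu]_x (f i x)%:E)%E.
Proof.
move=> mf f0; rewrite -ge0_integral_sum //.
- by apply: eq_integral => x _; rewrite sumEFin.
- by move=> i; exact/measurable_EFinP.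
- by move=> i x _; rewrite lee_fin.
Qed.

End integral_real.

Lemma prob_integral_cst (R : realType) d (T : measurableType d)
  (P : probability T R) (r : R) : (\int[P]_w r%:E = r%:E)%E.
Proof. by have := expectation_cst P r; rewrite unlock. Qed.

Section gaussian_moments.
Context (R : realType) d (T : measurableType d) (P : probability T R).

(** [gaussian_law] with its parameters exposed; that a centred law has m = 0 and
    variance s^2 is the content of [gaussian_mean0] and [gaussian_var]. *)
Definition gaussian_with (X : T -> R) (m s : R) :=
  forall B : set (measurableTypeR R), measurable B ->
    P (X @^-1` B) = if s == 0 then \d_m B else normal_prob m s B.

Lemma gaussian_integral (X : T -> R) m s (f : R -> \bar R) :
  measurable_fun setT X -> gaussian_with X m s ->
  measurable_fun setT f -> (forall x, 0 <= f x)%E ->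
  (\int[P]_w f (X w) = if (s == 0)%R then f m
    else \int[lebesgue_measure]_x (f x * (normal_pdf m s x)%:E))%E.
Proof.
move=> mX gX mf f0.
pose mixX := isMeasurableFun.Build _ _ T (measurableTypeR R) X mX.
pose X' : {mfun T >-> measurableTypeR R} := HB.pack X mixX.
transitivity (\int[pushforward P X']_x f x)%E.
  by rewrite ge0_integral_pushforward // => x _; exact: f0.
have [s0|s0] := eqVneq s 0.
  transitivity (\int[@dirac _ (measurableTypeR R) m R]_x f x)%E.
    apply: (eq_measure_integral (@dirac _ (measurableTypeR R) m R)) => A mA _.
  by rewrite [LHS]gX // s0 eqxx.
  by rewrite integral_dirac // diracE in_setT mul1e.
transitivity (\int[normal_prob m s]_x f x)%E.
  by apply: eq_measure_integral => A mA _; rewrite [LHS]gX // (negbTE s0).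
apply: integral_density => //.
- exact: measurable_normal_pdf.
- by move=> x; exact: normal_pdf_ge0.
Qed.

(** Completing the square: tilting the normal density by e^(tx) gives a multiple
    of the normal density centred at m + t s^2. *)
Lemma gaussian_mgf (X : T -> R) m s t :
  measurable_fun setT X -> gaussian_with X m s ->
  (\int[P]_w (expR (t * X w))%:E = (expR (t * m + t ^+ 2 * s ^+ 2 / 2))%:E)%E.
Proof.
move=> mX gX.
rewrite (gaussian_integral mX gX (f := fun x => (expR (t * x))%:E)); last 2 first.
- apply/measurable_EFinP; apply: measurableT_comp => //; exact: measurable_funM.
- by move=> x; rewrite lee_fin expR_ge0.
have [->|s0] := eqVneq s 0; first by rewrite expr0n /= mulr0 mul0r addr0.
transitivity (\int[lebesgue_measure]_x ((expR (t * m + t ^+ 2 * s ^+ 2 / 2))%:E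
   * (normal_pdf (m + t * s ^+ 2) s x)%:E))%E; last first.
  rewrite ge0_integralZl //; first by rewrite integral_normal_pdf mule1.
  - by apply/measurable_EFinP; exact: measurable_normal_pdf.
  - by move=> x _; rewrite lee_fin normal_pdf_ge0.
apply: eq_integral => x _; rewrite -!EFinM !normal_pdfE // /normal_fun; congr EFin.
rewrite mulrCA [RHS]mulrCA -!expRD; congr (_ * expR _).
by rewrite -mulr_natr; field; rewrite s0.
Qed.

End gaussian_moments.

(** * Mean and variance of a Gaussian law *)

Section real_limits.
Variable R : realType.

(** Replaces a limit t -> 0 in the moment comparisons below, and so avoids
    differentiating under the integral sign. *)
Lemma le_of_small_quadratic (a b c : R) :
  (forall t : R, 0 < t <= 1 -> a <= b + c * t ^+ 2) -> a <= b.
Proof.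
move=> h; rewrite leNgt; apply/negP => ba.
have [c0|c0] := leP c 0.
  have := h 1; rewrite ltr01 lexx expr1n mulr1 => /(_ isT); lra.
(* If a > b, this t makes c t^2 at most half of the gap. *)
pose t := Num.min 1 ((a - b) / (2 * c)).
have e0 : 0 < (a - b) / (2 * c) by rewrite divr_gt0 // ?subr_gt0 // mulr_gt0.
have t0 : 0 < t by rewrite lt_min ltr01.
have t1 : t <= 1 by rewrite ge_min lexx.
have := h t; rewrite t0 t1 => /(_ isT).
have : c * t ^+ 2 <= (a - b) / 2.
  have -> : (a - b) / 2 = c * ((a - b) / (2 * c)) by field; rewrite gt_eqF.
  rewrite ler_pM2l // (le_trans (y := t)) //; last by rewrite /t ge_min lexx orbT.
  by rewrite expr2 ler_piMl // ltW.
lra.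
Qed.

Lemma expR_le_geo (u : R) : u < 1 -> expR u <= (1 - u)^-1.
Proof.
move=> u1; rewrite -[expR u]invrK -expRN lef_pV2 ?posrE ?expR_gt0 ?subr_gt0 //.
exact: expR_ge1Dx.
Qed.

Let exp_shift (u : R) k : 0 <= u ->
  exp_coeff u k.+3 <= u ^+ 3 * exp_coeff u k.
Proof.
move=> u0; rewrite /exp_coeff /= !exprS mulrCA !mulrA expr0 mulr1.
apply: ler_wpM2l; first by rewrite !mulr_ge0 ?exprn_ge0.
rewrite lef_pV2 ?posrE ?ltr0n ?fact_gt0 // ler_nat.
by apply: leq_fact; rewrite -addn3 leq_addr.
Qed.

(** With u = t^2 / 2 the cubic remainder is of order t^6, negligible against the
    t^4 that carries the fourth moment. *)
Lemma expR_le_taylor2 (u : R) : 0 <= u ->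
  expR u <= 1 + u + u ^+ 2 / 2 + u ^+ 3 * expR u.
Proof.
move=> u0.
have cv : series (exp_coeff u) @ \oo --> expR u.
  by have := is_cvg_series_exp_coeff u; rewrite /expR.
have nd : nondecreasing_seq (series (exp_coeff u)).
  apply/nondecreasing_seqP => n; rewrite /series /= big_nat_recr //= lerDl.
  by rewrite /exp_coeff /= mulr_ge0 ?exprn_ge0 // invr_ge0.
have le n := nondecreasing_cvgn_le nd (cvgP _ cv) n.
rewrite (cvg_lim (@Rhausdorff R) cv) in le.
rewrite -{1}(cvg_lim (@Rhausdorff R) cv).
apply: limr_le; first exact: (cvgP _ cv).
near=> n; apply: (le_trans (nd n (3 + n)%N _)); first by rewrite leq_addl.
rewrite /series /= (big_cat_nat (n := 3)) //=.
have -> : \sum_(0 <= i < 3) exp_coeff u i = 1 + u + u ^+ 2 / 2.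
  rewrite !big_nat_recr //= big_geq // /exp_coeff /= !factS fact0.
  by rewrite !exprS !expr0; field.
rewrite lerD2l; apply: (le_trans _ (ler_wpM2l (exprn_ge0 3 u0) (le n))).
rewrite -{1}(add0n 3%N) big_addn addnC addnK /series /= mulr_sumr.
by apply: ler_sum => i _; rewrite addn3; exact: exp_shift.
Unshelve. all: by end_near. Qed.

End real_limits.

Section centered_gaussian.
Context (R : realType) d (T : measurableType d) (P : probability T R).
Variables (X : T -> R) (mX : measurable_fun setT X).

Let mexp t : measurable_fun setT (fun w => expR (t * X w)).
Proof. by apply: measurableT_comp => //; exact: measurable_funM. Qed.

Let mEexp t : measurable_fun setT (fun w => (expR (t * X w))%:E).
Proof. exact/measurable_EFinP. Qed.

Let mexpN t : measurable_fun setT (fun w => expR (- (t * X w))).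
Proof. by apply: measurableT_comp => //; apply: measurableT_comp => //; exact: measurable_funM. Qed.

Let mX2 : measurable_fun setT (fun w => X w * X w).
Proof. exact: measurable_funM. Qed.

Local Ltac meas := repeat (lazymatch goal with
  | |- measurable_fun _ X => exact: mX
  | |- measurable_fun _ (fun x => expR (- _)) => exact: mexpN
  | |- measurable_fun _ (fun x => expR _) => exact: mexp
  | |- measurable_fun _ _ => first [ exact: measurable_cst
    | apply: measurable_funD | apply: measurable_funM ]
  end).
Local Ltac pos := repeat (cbv beta; lazymatch goal with
  | |- forall _, _ => move=> ?
  | |- is_true (0 <= _)%R =>
    first [ exact: expR_ge0 | exact: sqr_ge0 | by rewrite exprn_even_ge0
    | by rewrite -expr2 sqr_ge0 | apply: addr_ge0 | apply: mulr_ge0 | done] end).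

Section with_parameters.
Variables (m s v : R).
Hypothesis gX : gaussian_with P X m s.
Hypothesis EX : ('E_P[X] = 0)%E.
Hypothesis EX2 : ('E_P[(fun w => X w * X w)%R] = v%:E)%E.

Let iexp t : P.-integrable setT (fun w => (expR (t * X w))%:E).
Proof.
apply/integrableP; split => //.
under eq_integral do rewrite gee0_abs ?lee_fin ?expR_ge0 //.
by rewrite (gaussian_mgf t mX gX) ltry.
Qed.

(** The absolute value of x is at most e^x + e^-x. *)
Lemma gaussian_integrable : P.-integrable setT (EFin \o X).
Proof.
apply: (@le_integrable _ _ _ P setT measurableT _
  (fun w => (expR (1 * X w))%:E + (expR ((-1) * X w))%:E)%E).
- exact/measurable_EFinP.
- move=> w _ /=; rewrite lee_fin (@ger0_norm _ (_ + _)) ?addr_ge0 ?expR_ge0 //.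
  rewrite mul1r mulN1r ler_norml.
  have := expR_ge1Dx (X w); have := expR_ge1Dx (- X w).
  have := expR_gt0 (X w); have := expR_gt0 (- X w).
  by move=> *; apply/andP; split; lra.
- by apply: integrableD => //; exact: iexp.
Qed.

(** Integrating 1 + tX <= e^(tX) gives 0 <= t m + t^2 s^2 / 2 for t of both signs,
    which forces the linear term to vanish. *)
Lemma gaussian_mean0 : m = 0.
Proof.
have le t : 0 <= t * m + t ^+ 2 * s ^+ 2 / 2.
  have : (\int[P]_w (1%:E + t%:E * (X w)%:E) <= \int[P]_w (expR (t * X w))%:E)%E.
    apply: le_integral => //.
    - apply: integrableD => //; first exact: finite_measure_integrable_cst.
      by apply: integrableZl => //; exact: gaussian_integrable.
    - by move=> w _; rewrite -EFinM -EFinD lee_fin expR_ge1Dx.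
  rewrite (gaussian_mgf t mX gX) integralD //; last 2 first.
  - exact: finite_measure_integrable_cst.
  - by apply: integrableZl => //; exact: gaussian_integrable.
  rewrite integralZl //; last exact: gaussian_integrable.
  rewrite prob_integral_cst.
  move: EX; rewrite unlock => ->; rewrite mule0 adde0 lee_fin => h.
  by rewrite leNgt -expR_lt1 -leNgt.
apply/eqP; rewrite -sqrf_eq0; apply/eqP/le_anti; rewrite sqr_ge0 andbT.
set a := s ^+ 2 in le; have a0 : 0 <= a by exact: sqr_ge0.
(* This t makes the bound a negative multiple of m^2. *)
have := le (- m / (a + 1)).
have -> : - m / (a + 1) * m + (- m / (a + 1)) ^+ 2 * a / 2 =
   - m ^+ 2 * (a + 2) / (2 * (a + 1) ^+ 2).
  by field; rewrite gt_eqF // ltr_wpDl.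
rewrite pmulr_lge0 ?invr_gt0 ?mulr_gt0 ?exprn_gt0 ?ltr_wpDl //.
by rewrite pmulr_lge0 ?ltr_wpDl // oppr_ge0.
Qed.

Let mgf0 t : (\int[P]_w (expR (t * X w))%:E = (expR (t ^+ 2 * s ^+ 2 / 2))%:E)%E.
Proof. by rewrite (gaussian_mgf t mX gX) gaussian_mean0 mulr0 add0r. Qed.

Let cosh_int t : (\int[P]_w (expR (t * X w) + expR (- (t * X w)))%:E =
  (2 * expR (t ^+ 2 * s ^+ 2 / 2))%:E)%E.
Proof.
rewrite integral_realD; [|by meas|by meas|by pos|by pos].
under [X in (_ + X)%E]eq_integral do rewrite -mulNr.
by rewrite !mgf0 sqrrN -EFinD mulr2n mulrDl mul1r.
Qed.

(** Integrating 2 + t^2 X^2 <= e^(tX) + e^(-tX) gives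
    2 + t^2 v <= 2 e^(t^2 s^2 / 2); divide by t^2 and let t tend to 0. *)
Lemma gaussian_var_le : v <= s ^+ 2.
Proof.
apply: (@le_of_small_quadratic _ _ _ (v * s ^+ 2 / 2)) => t0 /andP[t00 t01].
(* A smaller k <= t0 keeps the exponent below 1, as the geometric bound requires. *)
have [k /andP[k0 kt] kE] : exists2 k : R, 0 < k <= t0 & k ^+ 2 * s ^+ 2 / 2 < 1.
  pose k := t0 / (s ^+ 2 + 1); have a0 := sqr_ge0 s.
  have p0 : 0 < s ^+ 2 + 1 by rewrite ltr_wpDl.
  have k0 : 0 < k by rewrite divr_gt0.
  have kt : k <= t0 by rewrite ler_pdivrMr // mulrDr mulr1 lerDr mulr_ge0 // ltW.
  exists k; first by rewrite k0.
  have k1 : k <= 1 by exact: le_trans kt _.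
  have : k * s ^+ 2 <= 1.
    rewrite /k mulrAC ler_pdivrMr // mul1r (le_trans (ler_piMl _ t01)) ?lerDl //.
  by rewrite expr2 -(mulrA k k); nra.
have v0 : 0 <= v.
  rewrite -lee_fin -EX2 unlock; apply: integral_ge0 => w _.
  by rewrite lee_fin -expr2 sqr_ge0.
have : (\int[P]_w (2 + k ^+ 2 * (X w * X w))%:E <=
        \int[P]_w (expR (k * X w) + expR (- (k * X w)))%:E)%E.
  apply: (@integral_real_le _ _ _ P (fun w => 2 + k ^+ 2 * (X w * X w))
    (fun w => expR (k * X w) + expR (- (k * X w)))); [by meas|by meas|by pos|] => w.
  apply: le_trans (cosh_ge _); rewrite exprMn -expr2 lerDl mulr_ge0 //.
  by rewrite exprn_even_ge0.
rewrite cosh_int integral_realD; [|by meas|by meas|by pos|by pos].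
rewrite integral_realZ; [|by meas|by pos|by pos].
rewrite prob_integral_cst.
move: EX2; rewrite unlock => ->; rewrite -EFinM -EFinD lee_fin => h.
have {}h := le_trans h (ler_wpM2l (ltW (ltr0Sn _ 1)) (expR_le_geo kE)).
set a := s ^+ 2 in h kE *; have a0 : 0 <= a by exact: sqr_ge0.
have u1 : 0 < 1 - k ^+ 2 * a / 2 by lra.
rewrite ler_pdivlMr // in h.
have k2 : 0 < k ^+ 2 by rewrite exprn_gt0.
have : v <= a + v * a / 2 * k ^+ 2.
  rewrite -(ler_pM2l k2); nra.
move=> h'; apply: (le_trans h'); rewrite lerD2l.
apply: ler_wpM2l; first by rewrite mulr_ge0 // mulr_ge0.
by rewrite ler_pXn2r // nnegrE ltW.
Qed.

(** The converse comparison, from [cosh_le]: the fourth-order term is integrable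
    uniformly in t, so it costs only O(t^2) after division by t^2. *)
Lemma gaussian_var_ge : s ^+ 2 <= v.
Proof.
(* The expectation of 4 + 2 (e^(2X) + e^(-2X)), which dominates the remainder. *)
pose C : R := 2 * (2 + 2 * expR (2 * s ^+ 2)).
apply: (@le_of_small_quadratic _ _ _ C) => t /andP[t0 t1].
have : (\int[P]_w (expR (t * X w) + expR (- (t * X w)))%:E <=
  \int[P]_w ((2 + t ^+ 2 * (X w * X w)) +
    t ^+ 4 * (4 + 2 * (expR (2 * X w) + expR (- (2 * X w)))))%:E)%E.
  apply: (@integral_real_le _ _ _ P
    (fun w => expR (t * X w) + expR (- (t * X w)))
    (fun w => (2 + t ^+ 2 * (X w * X w)) +
    t ^+ 4 * (4 + 2 * (expR (2 * X w) + expR (- (2 * X w)))))); [by meas|by meas|by pos|] => w.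
    apply: (le_trans (cosh_le _)); rewrite exprMn -expr2 lerD2l.
    have -> : (t * X w) ^+ 4 / 12 * (expR (t * X w) + expR (- (t * X w))) =
        t ^+ 4 * (X w ^+ 4 / 12 * (expR (t * X w) + expR (- (t * X w)))).
      by rewrite exprMn; ring.
    apply: ler_wpM2l; first exact: exprn_ge0 (ltW t0).
    have c0 := cosh_ge (X w); have q0 : 0 <= X w ^+ 2 by exact: sqr_ge0.
    set c := expR (X w) + expR (- X w) in c0.
    have e1 := expR_gt0 (X w); have e2 := expR_gt0 (- X w).
    (* For t <= 1 the factor e^(tX) + e^(-tX) is at most twice its value at t = 1. *)
    have c1 : expR (t * X w) + expR (- (t * X w)) <= 2 * c.
      have ab y : `|y| <= `|X w| -> expR y <= c.
        move=> yX; apply: (@le_trans _ _ (expR `|X w|)).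
          by rewrite ler_expR (le_trans (ler_norm _)).
        by case: (ger0P (X w)) => _; rewrite /c ?lerDl ?lerDr ltW.
      have tX : `|t * X w| <= `|X w| by rewrite normrM (gtr0_norm t0) ler_piMl.
      by have := ab _ tX; have := ab (- (t * X w)); rewrite normrN => /(_ tX); lra.
    have c2 : X w ^+ 4 / 12 <= c by lra.
    have y4 : 0 <= X w ^+ 4 / 12 by rewrite mulr_ge0 // exprn_even_ge0.
    have e0 : 0 <= expR (t * X w) + expR (- (t * X w)) by rewrite addr_ge0 // expR_ge0.
    apply: (le_trans (ler_pM y4 e0 c2 c1)).
    rewrite /c le_eqVlt; apply/orP; left; apply/eqP.
    have -> : expR (2 * X w) = expR (X w) * expR (X w) by rewrite -expRD mulr2n mulrDl mul1r.
    have -> : expR (- (2 * X w)) = expR (- X w) * expR (- X w).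
      by rewrite -expRD; congr expR; ring.
    have := expRxMexpNx_1 (X w) => ee; ring: ee.
rewrite cosh_int integral_realD; [|by meas|by meas|by pos|by pos].
rewrite integral_realD; [|by meas|by meas|by pos|by pos].
rewrite integral_realZ; [|by meas|by pos|by pos].
rewrite integral_realZ; [|by meas|by pos|by pos].
rewrite prob_integral_cst integral_realD; [|by meas|by meas|by pos|by pos].
rewrite integral_realZ; [|by meas|by pos|by pos].
rewrite cosh_int prob_integral_cst.
move: EX2; rewrite unlock => ->; rewrite -!(EFinM, EFinD) lee_fin => h.
have {}h := le_trans (ler_wpM2l (ltW (ltr0Sn _ 1)) (expR_ge1Dx _)) h.
have t2 : 0 < t ^+ 2 by rewrite exprn_gt0.
rewrite -(ler_pM2l t2) /C.
have e2 : 2 ^+ 2 * s ^+ 2 / 2 = 2 * s ^+ 2 by field.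
rewrite e2 in h; set E := expR _ in h *.
have -> : t ^+ 2 * (v + 2 * (2 + 2 * E) * t ^+ 2) = t ^+ 2 * v + t ^+ 4 * (4 + 2 * (2 * E)).
  by ring.
lra.
Qed.

Lemma gaussian_var : s ^+ 2 = v.
Proof. by apply/le_anti; rewrite gaussian_var_le gaussian_var_ge. Qed.

End with_parameters.
End centered_gaussian.

(** * Fourth moments and a chi-square tail bound *)

Section markov_ereal.
Context d (T : measurableType d) (R : realType) (mu : {measure set T -> \bar R}).
Local Open Scope ereal_scope.

Lemma markov_ereal (f : T -> \bar R) (a : R) : measurable_fun setT f ->
  (forall w, 0 <= f w) -> (0 < a)%R ->
  mu [set w | a%:E <= f w] <= (a^-1)%:E * \int[mu]_w f w.
Proof.
move=> mf f0 a0.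
have mA : measurable [set w | a%:E <= f w].
  by rewrite -[X in measurable X]setTI; exact: emeasurable_fun_c_infty.
rewrite -[X in X <= _]mul1e -(mulVf (lt0r_neq0 a0)) EFinM -muleA.
apply: lee_wpmul2l; first by rewrite lee_fin invr_ge0 ltW.
set A := [set w | a%:E <= f w] in mA *.
have -> : mu A = \int[mu]_w (\1_A w)%:E.
  by rewrite integral_indic // setIT.
rewrite -ge0_integralZl //; [|by apply/measurable_EFinP; exact: measurable_indic|by rewrite lee_fin ltW].
apply: ge0_le_integral => //.
- by move=> x _; rewrite mule_ge0 ?lee_fin // ltW.
- by apply: emeasurable_funM => //; apply/measurable_EFinP; exact: measurable_indic.
- move=> x _; rewrite indicE; case: (boolP (x \in _)) => [|_]; last by rewrite mule0.
  by rewrite inE /= mule1.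
Qed.

End markov_ereal.

Section markov.
Context (R : realType) d (T : measurableType d) (P : probability T R).

Lemma markov_real (f : T -> R) (a : R) : measurable_fun setT f ->
  (forall w, 0 <= f w) -> 0 < a ->
  (P [set w | (a <= f w)%R] <= a^-1%:E * \int[P]_w (f w)%:E)%E.
Proof.
move=> mf f0 a0; apply: (@markov_ereal _ _ _ P (fun w => (f w)%:E)) => //.
exact/measurable_EFinP.
Qed.

End markov.

(** Left as an integral: the argument uses that it is the same number for every
    standard Gaussian variable and that it is at most 3, never its value. *)
Definition normal_kurtosis (R : realType) : \bar R :=
  (\int[lebesgue_measure]_x ((x ^+ 4)%:E * (normal_pdf (0 : R) 1 x)%:E))%E.

Section gaussian_fourth.
Context (R : realType) d (T : measurableType d) (P : probability T R).
Variables (X : T -> R) (mX : measurable_fun setT X).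
Hypotheses (gX : gaussian_law P X) (EX : ('E_P[X] = 0)%E).

Lemma centered_gaussian_mgf (v t : R) :
  ('E_P[(fun w => X w * X w)%R] = v%:E)%E ->
  (\int[P]_w (expR (t * X w))%:E = (expR (t ^+ 2 * v / 2))%:E)%E.
Proof.
move=> EX2; have [m [s gXs]] := gX.
rewrite (gaussian_mgf t mX gXs) (gaussian_mean0 mX gXs EX) mulr0 add0r.
by rewrite (gaussian_var mX gXs EX EX2).
Qed.

Hypothesis EX2 : ('E_P[(fun w => X w * X w)%R] = 1%:E)%E.

Lemma standard_gaussian_fourth : (\int[P]_w (X w ^+ 4)%:E = normal_kurtosis R)%E.
Proof.
have [m [s gXs]] := gX.
have s1 : s ^+ 2 = 1 := gaussian_var mX gXs EX EX2.
have s0 : s != 0 by apply/eqP => s0; move: s1; rewrite s0 expr0n /= => /eqP; rewrite eq_sym oner_eq0.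
rewrite (gaussian_integral mX gXs (f := fun x => (x ^+ 4)%:E)); last 2 first.
- by apply/measurable_EFinP; exact: measurable_funX.
- by move=> x; rewrite lee_fin exprn_even_ge0.
rewrite (negbTE s0) (gaussian_mean0 mX gXs EX) /normal_kurtosis.
apply: eq_integral => x _; congr (_ * EFin _)%E.
by rewrite /normal_pdf (negbTE s0) oner_eq0 /normal_peak /normal_fun s1 expr1n.
Qed.

(** Integrating [cosh_ge] at tX bounds 2 + t^2 + t^4 E X^4 / 12 by 2 e^(t^2 / 2).
    The terms of order below t^4 agree, and those of order t^4 give the bound. *)
Lemma standard_gaussian_fourth_le : (\int[P]_w (X w ^+ 4)%:E <= 3%:E)%E.
Proof.
have mX4 : measurable_fun setT (fun w => X w ^+ 4) by exact: measurable_funX.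
have mXX : measurable_fun setT (fun w => X w * X w) by exact: measurable_funM.
have mE t : measurable_fun setT (fun w => expR (t * X w)).
  by apply: measurableT_comp => //; exact: measurable_funM.
have X40 w : 0 <= X w ^+ 4 by rewrite exprn_even_ge0.
have X20 w : 0 <= X w * X w by rewrite -expr2 sqr_ge0.
set I4 := (\int[P]_w (X w ^+ 4)%:E)%E.
have I40 : (0 <= I4)%E by apply: integral_ge0 => w _; rewrite lee_fin.
have key t : ((2 + t ^+ 2)%:E + (t ^+ 4 / 12)%:E * I4 <= (2 * expR (t ^+ 2 / 2))%:E)%E.
  have t40 : 0 <= t ^+ 4 / 12 by rewrite mulr_ge0 // exprn_even_ge0.
  have : (\int[P]_w ((2 + t ^+ 2 * (X w * X w)) + t ^+ 4 / 12 * X w ^+ 4)%:E <=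
          \int[P]_w (expR (t * X w) + expR ((- t) * X w))%:E)%E.
    apply: (@integral_real_le _ _ _ P
       (fun w => (2 + t ^+ 2 * (X w * X w)) + t ^+ 4 / 12 * X w ^+ 4)
       (fun w => expR (t * X w) + expR ((- t) * X w))).
    - apply: measurable_funD; last exact: measurable_funM.
      by apply: measurable_funD => //; exact: measurable_funM.
    - exact: measurable_funD.
    - move=> w; apply: addr_ge0; last exact: mulr_ge0.
      by apply: addr_ge0 => //; apply: mulr_ge0 => //; exact: sqr_ge0.
    - move=> w; apply: (le_trans _ (le_trans (cosh_ge (t * X w)) _)).
        rewrite le_eqVlt; apply/orP; left; apply/eqP; ring.
      by rewrite mulNr.
  rewrite integral_realD //; last 4 first.
  - by apply: measurable_funD => //; exact: measurable_funM.
  - exact: measurable_funM.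
  - by move=> w; apply: addr_ge0 => //; apply: mulr_ge0 => //; exact: sqr_ge0.
  - by move=> w; exact: mulr_ge0.
  rewrite integral_realD //; last 2 first.
  - exact: measurable_funM.
  - by move=> w; apply: mulr_ge0 => //; exact: sqr_ge0.
  rewrite prob_integral_cst !integral_realZ ?sqr_ge0 //.
  rewrite integral_realD //; [|by move=> ?; rewrite expR_ge0 ..].
  rewrite !(centered_gaussian_mgf _ EX2) sqrrN mulr1 -EFinD.
  move: EX2; rewrite unlock => ->; rewrite mule1 -EFinD.
  by rewrite mulr2n mulrDl mul1r.
have I4fin : I4 \is a fin_num.
  rewrite ge0_fin_numE //.
  have := key 1; move: (I4) I40; case => [r _ _|_|//]; first by rewrite ltry.
  by rewrite gt0_muley ?lte_fin ?expr1n ?mulr_gt0 // addey // leye_eq.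
rewrite -(fineK I4fin) lee_fin; set k := fine I4.
apply: (@le_of_small_quadratic _ _ _ 6) => t /andP[t0 t1].
have := key t; rewrite -(fineK I4fin) -/k -EFinM -EFinD lee_fin => h.
set u := t ^+ 2 / 2 in h.
have t21 : t ^+ 2 <= 1 by rewrite exprn_ile1 // ltW.
have u0 : 0 <= u by rewrite mulr_ge0 ?sqr_ge0.
have u1 : u <= 2^-1 by rewrite /u; lra.
have e2 : expR u <= 2.
  apply: (le_trans (expR_le_geo (le_lt_trans u1 _))); first by rewrite invf_lt1 // ltr1n.
  by rewrite invf_ple ?posrE //; lra.
have := expR_le_taylor2 u0.
have u3 : u ^+ 3 * expR u <= u ^+ 3 * 2 by rewrite ler_wpM2l // exprn_ge0.
move=> h'.
have t4 : 0 < t ^+ 4 by rewrite exprn_gt0.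
rewrite -(ler_pM2l t4).
have -> : t ^+ 4 * (3 + 6 * t ^+ 2) = 12 * (u ^+ 2 + 4 * u ^+ 3) by rewrite /u; field.
have uE : t ^+ 2 = 2 * u by rewrite /u; field.
rewrite uE in h.
have : t ^+ 4 / 12 * k <= u ^+ 2 + 4 * u ^+ 3 by lra.
lra.
Qed.

End gaussian_fourth.

Section chi_square.
Context (R : realType) d (T : measurableType d) (P : probability T R).
Variables (I : finType) (z : I -> T -> R) (kappa : R).
Hypothesis (mz : forall i, measurable_fun setT (z i)).
Hypothesis z2 : forall i, (\int[P]_w (z i w ^+ 2)%:E = 1)%E.
Hypothesis z4 : forall i, (\int[P]_w (z i w ^+ 4)%:E = kappa%:E)%E.
Hypothesis zD : forall i j, i != j ->
  (\int[P]_w ((z i w + z j w) ^+ 4)%:E = (4 * kappa)%:E)%E.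
Hypothesis zB : forall i j, i != j ->
  (\int[P]_w ((z i w - z j w) ^+ 4)%:E = (4 * kappa)%:E)%E.
Hypothesis kappa3 : kappa <= 3.

(** Polarization: (a+b)^4 + (a-b)^4 = 2 a^4 + 2 b^4 + 12 a^2 b^2.  The mixed moment
    thus follows from the laws of single linear combinations, which is the form
    in which Gaussian processes are given. *)
Lemma mixed_moment i j : i != j ->
  (\int[P]_w (z i w ^+ 2 * z j w ^+ 2)%:E = (kappa / 3)%:E)%E.
Proof.
move=> ij; set I22 := (\int[P]_w _)%E.
have p4 (x : R) : 0 <= x ^+ 4 by rewrite exprn_even_ge0.
have m4 k : measurable_fun setT (fun w => z k w ^+ 4) by exact: measurable_funX.
have m22 : measurable_fun setT (fun w => z i w ^+ 2 * z j w ^+ 2).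
  by apply: measurable_funM; exact: measurable_funX.
have p22 w : 0 <= z i w ^+ 2 * z j w ^+ 2 by rewrite mulr_ge0 ?sqr_ge0.
have mD : measurable_fun setT (fun w => (z i w + z j w) ^+ 4).
  by apply: measurable_funX; exact: measurable_funD.
have mB : measurable_fun setT (fun w => (z i w - z j w) ^+ 4).
  by apply: measurable_funX; exact: measurable_funB.
have I220 : (0 <= I22)%E by apply: integral_ge0 => w _; rewrite lee_fin.
have : (\int[P]_w ((z i w + z j w) ^+ 4 + (z i w - z j w) ^+ 4)%:E =
   \int[P]_w ((2 * z i w ^+ 4 + 2 * z j w ^+ 4) + 12 * (z i w ^+ 2 * z j w ^+ 2))%:E)%E.
  by apply: eq_integral => w _; congr EFin; ring.
rewrite integral_realD // zD // zB // integral_realD //; last 4 first.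
- by apply: measurable_funD; exact: measurable_funM.
- exact: measurable_funM.
- by move=> w; apply: addr_ge0; exact: mulr_ge0.
- by move=> w; exact: mulr_ge0.
rewrite integral_realD //; last 4 first.
- exact: measurable_funM.
- exact: measurable_funM.
- by move=> w; exact: mulr_ge0.
- by move=> w; exact: mulr_ge0.
rewrite !integral_realZ // !z4 -/I22.
case: I22 I220 => [r _|_|//]; last by rewrite gt0_muley ?lte_fin // -!EFinM -!EFinD addey.
by rewrite -!EFinM -!EFinD => -[h]; congr EFin; lra.
Qed.

Let N : R := #|I|%:R.
Let Q w := \sum_i z i w ^+ 2.

Let mQ : measurable_fun setT Q.
Proof. by apply: measurable_sum => i; exact: measurable_funX. Qed.

Let Q0 w : 0 <= Q w. Proof. by apply: sumr_ge0 => i _; exact: sqr_ge0. Qed.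

Let EQ : (\int[P]_w (Q w)%:E = N%:E)%E.
Proof.
rewrite integral_real_sum; last 2 first.
- by move=> i; exact: measurable_funX.
- by move=> i w; exact: sqr_ge0.
under eq_bigr do rewrite z2.
by rewrite sumEFin sumr_const.
Qed.

Let EQ2 : (\int[P]_w (Q w ^+ 2)%:E <= (N ^+ 2 + 2 * N)%:E)%E.
Proof.
have -> : (\int[P]_w (Q w ^+ 2)%:E =
  \int[P]_w (\sum_i \sum_j (z i w ^+ 2 * z j w ^+ 2))%:E)%E.
  apply: eq_integral => w _; congr EFin; rewrite expr2 /Q mulr_suml.
  by apply: eq_bigr => i _; rewrite mulr_sumr.
have m22 i j : measurable_fun setT (fun w => z i w ^+ 2 * z j w ^+ 2).
  by apply: measurable_funM; exact: measurable_funX.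
have p22 i j w : 0 <= z i w ^+ 2 * z j w ^+ 2 by rewrite mulr_ge0 ?sqr_ge0.
rewrite integral_real_sum; last 2 first.
- by move=> i; apply: measurable_sum.
- by move=> i w; apply: sumr_ge0.
under eq_bigr do rewrite integral_real_sum //.
rewrite (eq_bigr (fun i => (kappa + (N - 1) * (kappa / 3))%:E)); last first.
  move=> i _; rewrite (bigD1 i) //=.
  rewrite (eq_bigr (fun=> (kappa / 3)%:E)); last first.
    by move=> j ji; rewrite mixed_moment // eq_sym.
  rewrite sumEFin sumr_const EFinD; congr (_ + EFin _)%E.
    rewrite -(z4 i); apply: eq_integral => w _; congr EFin; ring.
  rewrite -[_ *+ #|_|]mulr_natl; congr (_ * _).
  have -> : N = #|predC1 i|.+1%:R.
    by rewrite cardC1 prednK //; apply/card_gt0P; exists i.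
  by rewrite -natr1 addrK.
rewrite sumEFin sumr_const -[_ *+ #|_|]mulr_natl -/N lee_fin.
have N0 : 0 <= N by rewrite ler0n.
have [N1|N1] := ltP N 1.
  have -> : N = 0.
    by move: N1; rewrite /N (ltr_nat R _ 1); case: #|I|.
  by rewrite mul0r expr0n /= mulr0 addr0.
have : N * (kappa + (N - 1) * (kappa / 3)) <= N * (3 + (N - 1) * (3 / 3)).
  apply: ler_wpM2l => //; apply: lerD => //.
  by apply: ler_wpM2l; [rewrite subr_ge0|rewrite ler_pM2r ?invr_gt0].
by lra.
Qed.

(** Chebyshev: the sum has mean N and, by [mixed_moment], variance at most 2 N. *)
Lemma chi_square_tail :
  (0 < #|I|)%N -> (P [set w | (2 * N <= \sum_i z i w ^+ 2)%R] <= (2 / N)%:E)%E.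
Proof.
move=> I0; have N0 : 0 < N by rewrite ltr0n.
have mQN : measurable_fun setT (fun w => (Q w - N) ^+ 2).
  by apply: measurable_funX; exact: measurable_funB.
have mQ2 : measurable_fun setT (fun w => Q w ^+ 2) by exact: measurable_funX.
have EQN : (\int[P]_w ((Q w - N) ^+ 2)%:E <= (2 * N)%:E)%E.
  have : (\int[P]_w ((Q w - N) ^+ 2 + 2 * N * Q w)%:E =
     \int[P]_w (Q w ^+ 2 + N ^+ 2)%:E)%E.
    by apply: eq_integral => w _; congr EFin; ring.
  rewrite integral_realD //; last 3 first.
  - exact: measurable_funM.
  - by move=> w; exact: sqr_ge0.
  - by move=> w; rewrite !mulr_ge0 // ltW.
  rewrite integral_realZ //; last by rewrite mulr_ge0 // ltW.
  rewrite EQ integral_realD //; last 2 first.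
  - by move=> w; exact: sqr_ge0.
  - by move=> w; exact: sqr_ge0.
  rewrite prob_integral_cst => h.
  have : (\int[P]_w ((Q w - N) ^+ 2)%:E + (2 * N)%:E * N%:E <=
    (N ^+ 2 + 2 * N)%:E + (N ^+ 2)%:E)%E by rewrite h; exact: leeD2r EQ2.
  rewrite -EFinM -EFinD -leeBrDr // -EFinB => /le_trans; apply.
  by rewrite lee_fin; lra.
apply: (@le_trans _ _ (P [set w | N ^+ 2 <= (Q w - N) ^+ 2])).
  apply: le_measure; rewrite ?inE.
  - by rewrite -[X in measurable X]setTI; exact: measurable_fun_le.
  - by rewrite -[X in measurable X]setTI; exact: measurable_fun_le.
  - move=> w /=; rewrite -/(Q w) => h.
    have h' : N <= Q w - N by lra.
    by rewrite ler_pXn2r ?nnegrE // ?(le_trans (ltW N0)) // ltW.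
have N20 : 0 < N ^+ 2 by rewrite exprn_gt0.
apply: (le_trans (@markov_real _ _ _ P _ (N ^+ 2) mQN (fun w => sqr_ge0 _) N20)).
apply: (@le_trans _ _ ((N ^+ 2)^-1%:E * (2 * N)%:E)%E).
  by apply: lee_wpmul2l => //; rewrite lee_fin invr_ge0 sqr_ge0.
by rewrite -EFinM lee_fin le_eqVlt; apply/orP; left; apply/eqP; field; rewrite gt_eqF.
Qed.

End chi_square.

(** * Real and complex scalars, and the real inner product *)

Section scalar_facts.
Variables (R : realType) (K : scalars R).
Hypothesis HK : K = real_scalars R \/ K = complex_scalars R.
Implicit Types (x y : K) (a b : R).

Ltac both := case: HK => ->; rewrite /=.

Lemma sreD x y : sre (x + y) = sre x + sre y.
Proof. by move: x y; both => // -[? ?] [? ?]. Qed.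

Lemma sre0 : sre (0 : K) = 0.
Proof. by both. Qed.

Lemma sreZ a x : sre (sofR K a * x) = a * sre x.
Proof. by move: x; both => // -[u v] /=; rewrite mul0r subr0. Qed.

Lemma sre_conj x : sre (sconj x) = sre x.
Proof. by move: x; both => // -[u v] /=. Qed.

Lemma sofRD a b : sofR K (a + b) = sofR K a + sofR K b.
Proof. by both => //; apply/eqP; rewrite eq_complex /= addr0 !eqxx. Qed.

Lemma sofRM a b : sofR K (a * b) = sofR K a * sofR K b.
Proof.
by both => //; apply/eqP; rewrite eq_complex /= !mulr0 !mul0r subr0 addr0 !eqxx.
Qed.

Lemma sofR0 : sofR K 0 = 0.
Proof. by both. Qed.

Lemma sofR1 : sofR K 1 = 1.
Proof. by both. Qed.

Lemma sofRN a : sofR K (- a) = - sofR K a.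
Proof. by apply/eqP; rewrite -addr_eq0 -sofRD addNr sofR0. Qed.

Lemma sre_sofR a : sre (sofR K a) = a.
Proof. by both. Qed.

Lemma sofR_eq0 a : (sofR K a == 0) = (a == 0).
Proof. by apply/eqP/eqP => [h|->]; rewrite ?sofR0 // -(sre_sofR a) h sre0. Qed.

Lemma sofR_gt0 a : 0 < a -> 0 < sofR K a.
Proof. by both => // a0; rewrite ltcE /= eqxx. Qed.

Lemma sconjD x y : sconj (x + y) = sconj x + sconj y.
Proof. by move: x y; both => // -[u v] [u' v'] /=; rewrite /conjc /= opprD. Qed.

Lemma sconj0 : sconj (0 : K) = 0.
Proof. by both => //; rewrite /conjc /= oppr0. Qed.

Lemma sconjM x y : sconj (x * y) = sconj x * sconj y.
Proof.
by move: x y; both => // -[u v] [u' v'] /=; rewrite /conjc /=; congr Complex; ring.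
Qed.

Lemma sconj_sofR a : sconj (sofR K a) = sofR K a.
Proof. by both => //; rewrite /conjc oppr0. Qed.

Lemma normE x : `|x| = sofR K (sabs x).
Proof.
by move: x; rewrite /sabs; both.
Qed.

Lemma sabs_ge0 x : 0 <= sabs x.
Proof.
move: x; rewrite /sabs; both => [x|[u v]]; first exact: normr_ge0.
by rewrite /= sqrtr_ge0.
Qed.

Lemma sre_le x y : x <= y -> sre x <= sre y.
Proof. by move: x y; both => // -[u v] [u' v']; rewrite lecE /= => /andP[]. Qed.

Definition sb (j : 'I_(size (sbasis K))) : K := nth 0 (sbasis K) j.

(** Every computation with scalars goes through real coordinates in the basis
    [sb], which treats the real and the complex case together. *)
Lemma sabs_sqr x : sabs x ^+ 2 = \sum_j sre (x * sconj (sb j)) ^+ 2.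
Proof.
rewrite -(big_mkord xpredT (fun j => sre (x * sconj (nth 0 (sbasis K) j)) ^+ 2)).
move: x; rewrite /sabs; both => [x|[u v]].
  by rewrite big_nat1 /= mulr1 real_normK // num_real.
rewrite /= sqr_sqrtr ?addr_ge0 ?sqr_ge0 //.
rewrite !big_nat_recl //= big_geq //= addr0; congr (_ ^+ 2 + _ ^+ 2); ring.
Qed.

Lemma sb_expand x : x = \sum_j sofR K (sre (x * sconj (sb j))) * sb j.
Proof.
rewrite -(big_mkord xpredT (fun j => sofR K (sre (x * sconj (nth 0 (sbasis K) j))) *
   nth 0 (sbasis K) j)).
move: x; both => [x|[u v]]; first by rewrite big_nat1 /= !mulr1.
rewrite !big_nat_recl //= big_geq //= addr0.
by apply/eqP; rewrite eq_complex /=; apply/andP; split; apply/eqP; ring.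
Qed.

Lemma sb_orthonormal i j : sre (sb i * sconj (sb j)) = (i == j)%:R.
Proof.
rewrite /sb; move: i j; both => [i j|].
  by rewrite !ord1 /= mulr1.
move=> [[|[|//]] ?] [[|[|//]] ?]; rewrite -val_eqE /=; ring.
Qed.

Lemma sum_sbasis (V : nmodType) (F : K -> V) :
  \sum_(u <- sbasis K) F u = \sum_j F (sb j).
Proof. by rewrite (big_nth 0) big_mkord. Qed.

Lemma sdim_gt0 : (0 < size (sbasis K))%N.
Proof. by both. Qed.

End scalar_facts.

Section hilbert_facts.
Variables (R : realType) (K : scalars R).
Hypothesis HK : K = real_scalars R \/ K = complex_scalars R.
Variables (H : normedModType K) (ip : {dot H for @sconj R K}).
Hypothesis Hip : hilbert_norm ip.
Implicit Types (x y z : H) (a : R).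

(** The real Hilbert space underlying H; it has the norm of H, and the noise is
    an isometry for it in both scalar cases. *)
Definition rip x y : R := sre (ip x y).

Lemma ipC x y : ip x y = sconj (ip y x).
Proof. by rewrite (@hermitian_subproof _ _ _ _ ip) expr0 mul1r. Qed.

Lemma ipDl x y z : ip (x + y) z = ip x z + ip y z.
Proof. exact: linearDl. Qed.

Lemma ipZl (c : K) x y : ip (c *: x) y = c * ip x y.
Proof. exact: linearZl_LR. Qed.

Lemma ipZr (c : K) x y : ip x (c *: y) = sconj c * ip x y.
Proof. exact: linearZr_LR. Qed.

Lemma ripC x y : rip x y = rip y x.
Proof. by rewrite /rip ipC sre_conj. Qed.

Lemma ripDl x y z : rip (x + y) z = rip x z + rip y z.
Proof. by rewrite /rip ipDl sreD. Qed.

Lemma ripDr x y z : rip x (y + z) = rip x y + rip x z.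
Proof. by rewrite ripC ripDl !(ripC _ x). Qed.

Lemma ripZl a x y : rip (sofR K a *: x) y = a * rip x y.
Proof. by rewrite /rip ipZl sreZ. Qed.

Lemma ripZr a x y : rip x (sofR K a *: y) = a * rip x y.
Proof. by rewrite ripC ripZl ripC. Qed.

Lemma ripNl x y : rip (- x) y = - rip x y.
Proof. by rewrite -scaleN1r -(sofR1 HK) -sofRN // ripZl mulN1r. Qed.

Lemma ripNr x y : rip x (- y) = - rip x y.
Proof. by rewrite ripC ripNl ripC. Qed.

Lemma ripBl x y z : rip (x - y) z = rip x z - rip y z.
Proof. by rewrite ripDl ripNl. Qed.

Lemma ripBr x y z : rip x (y - z) = rip x y - rip x z.
Proof. by rewrite ripDr ripNr. Qed.

Lemma rip0l y : rip 0 y = 0.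
Proof. by rewrite -(subrr y) ripBl subrr. Qed.

Lemma rip_suml I (s : seq I) (F : I -> H) y :
  rip (\sum_(i <- s) F i) y = \sum_(i <- s) rip (F i) y.
Proof.
elim: s => [|i s IH]; first by rewrite !big_nil rip0l.
by rewrite !big_cons ripDl IH.
Qed.

Lemma rip_sumr I (s : seq I) (F : I -> H) y :
  rip y (\sum_(i <- s) F i) = \sum_(i <- s) rip y (F i).
Proof. by rewrite ripC rip_suml; apply: eq_bigr => i _; rewrite ripC. Qed.

Lemma rnorm_sqr x : rnorm x ^+ 2 = rip x x.
Proof.
rewrite /rip -Hip; have : `|x| = sofR K (rnorm x).
  by rewrite -[LHS]normr_id normE // /sabs normr_id.
by move=> ->; rewrite !expr2 -sofRM // sre_sofR.
Qed.

Lemma rnorm_ge0 x : 0 <= rnorm x.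
Proof. by rewrite -(sre0 HK); apply: sre_le => //; exact: normr_ge0. Qed.

Lemma rnormD x y : rnorm (x + y) <= rnorm x + rnorm y.
Proof. by rewrite /rnorm -sreD //; apply: sre_le => //; exact: ler_normD. Qed.

Lemma rnormN x : rnorm (- x) = rnorm x.
Proof. by rewrite /rnorm normrN. Qed.

Lemma rnormB x y : rnorm (x - y) <= rnorm x + rnorm y.
Proof. by rewrite -(rnormN y); exact: rnormD. Qed.

Lemma rnorm_sumsq I (s : seq I) (c : I -> R) (h : I -> H) :
  rnorm (\sum_(i <- s) sofR K (c i) *: h i) ^+ 2 =
  \sum_(i <- s) \sum_(j <- s) c i * c j * rip (h i) (h j).
Proof.
rewrite rnorm_sqr rip_suml; apply: eq_bigr => i _.
by rewrite rip_sumr; apply: eq_bigr => j _; rewrite ripZl ripZr mulrA.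
Qed.

Lemma rnorm_orthonormal_sum (I : finType) (c : I -> R) (h : I -> H) :
  (forall i j, rip (h i) (h j) = (i == j)%:R) ->
  rnorm (\sum_i sofR K (c i) *: h i) ^+ 2 = \sum_i c i ^+ 2.
Proof.
move=> hh; rewrite rnorm_sumsq; apply: eq_bigr => i _.
rewrite (bigD1 i) //= hh eqxx mulr1 big1 ?addr0 // => j ji.
by rewrite hh eq_sym (negbTE ji) mulr0.
Qed.

Lemma rnorm_continuous : continuous (@rnorm R K H).
Proof.
move=> x; apply/cvgrPdist_le => e e0.
have se0 : 0 < sofR K e.
  exact: sofR_gt0.
have cv : \forall y \near x, `|x - y| <= sofR K e.
  by apply: (@cvgr_dist_le _ _ _ (nbhs x) _ id x) => //; exact: cvg_id.
near=> y.
have xy : rnorm (x - y) <= e.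
  rewrite -(sre_sofR HK e); apply: sre_le => //; near: y.
have h1 : rnorm x <= rnorm (x - y) + rnorm y by rewrite -{1}(subrK y x) rnormD.
have h2 : rnorm y <= rnorm (y - x) + rnorm x by rewrite -{1}(subrK x y) rnormD.
have h3 : rnorm (y - x) = rnorm (x - y) by rewrite -rnormN opprB.
by rewrite ler_norml; apply/andP; split; lra.
Unshelve. all: by end_near. Qed.

End hilbert_facts.

(** * The diagonal operator on the sieves *)

Section diagonal_operator.
Variables (R : realType) (K : scalars R).
Hypothesis HK : K = real_scalars R \/ K = complex_scalars R.
Variables (H1 H2 : completeNormedModType K).
Variables (ip1 : {dot H1 for @sconj R K}) (ip2 : {dot H2 for @sconj R K}).
Hypotheses (Hip1 : hilbert_norm ip1) (Hip2 : hilbert_norm ip2).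
Variables (A : {linear H1 -> H2}) (Astar : {linear H2 -> H1}).
Hypotheses (Acont : continuous A) (Ainj : injective A).
Hypothesis Aadj : is_adjoint ip1 ip2 A Astar.
Variables (e : nat -> H1) (g : nat -> H2) (rho : nat -> R).
Hypothesis He : orthonormal_basis ip1 e.
Hypothesis Heig : forall k, Astar (A (e k)) = sofR K (rho k ^+ 2) *: e k.
Hypothesis Hg : orthonormal_system ip2 g.
Hypothesis HAe : forall k, A (e k) = sofR K (rho k) *: g k.

Notation dK := (size (sbasis K)).
Notation rip1 := (rip ip1).
Notation rip2 := (rip ip2).

Lemma rho_neq0 k : rho k != 0.
Proof.
apply/eqP => r0; have := HAe k; rewrite r0 sofR0 // scale0r -(linear0 A) => /Ainj ek0.
have := He.1 k k; rewrite ek0 eqxx -(scale0r (e k)) ipZl mul0r => /eqP.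
by rewrite eq_sym oner_eq0.
Qed.

(** Apply the adjoint relation to A (e k) = rho_k g_k and cancel rho_k, which
    injectivity makes nonzero. *)
Lemma ip_image f k : ip2 (A f) (g k) = sofR K (rho k) * ip1 f (e k).
Proof.
have := Aadj f (A (e k)); rewrite Heig HAe !ipZr !sconj_sofR // expr2 sofRM // -mulrA.
by apply: mulfI; rewrite sofR_eq0 // rho_neq0.
Qed.

(** K^m as a real space: the index (k, j) is the j-th real coordinate of the k-th
    coefficient. *)
Definition rdir (H : normedModType K) (b : nat -> H) (m : nat)
  (i : 'I_m * 'I_dK) : H := sb i.2 *: b i.1.

Definition rcoord (f : H1) (m : nat) (i : 'I_m * 'I_dK) : R := rip1 f (rdir e i).

Lemma rdir_orthonormal (H : normedModType K) (ip : {dot H for @sconj R K})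
    (b : nat -> H) m (i j : 'I_m * 'I_dK) :
  orthonormal_system ip b -> rip ip (rdir b i) (rdir b j) = (i == j)%:R.
Proof.
move=> hb; case: i j => [i1 i2] [j1 j2]; rewrite /rip /rdir ipZl ipZr hb /=.
rewrite xpair_eqE -val_eqE /=.
case: (_ == _ :> nat) => /=; last by rewrite !mulr0 sre0.
by rewrite mulr1 sb_orthonormal.
Qed.

Lemma rcoord_sum f m (F : 'I_m -> R) :
  \sum_(i : 'I_m * 'I_dK) F i.1 * rcoord f i ^+ 2 =
  \sum_(k < m) F k * sabs (ip1 f (e k)) ^+ 2.
Proof.
rewrite -(pair_bigA _ (fun k j => F k * rcoord f (k, j) ^+ 2)) /=.
apply: eq_bigr => k _; rewrite sabs_sqr // mulr_sumr; apply: eq_bigr => j _.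
by rewrite /rcoord /rip /rdir /= ipZr mulrC [sconj _ * _]mulrC mulrC.
Qed.

(** The span of e_0, ..., e_(m-1), given by the vanishing of the other
    coefficients: in this form it is visibly a measurable set. *)
Definition finite_span m : set H1 := [set f | forall k, (m <= k)%N -> ip1 f (e k) = 0].

Definition proj m (f : H1) : H1 := \sum_(0 <= k < m) ip1 f (e k) *: e k.

Lemma ip_basis_sum m (c : nat -> K) k :
  ip1 (\sum_(i < m) c i *: e i) (e k) = if (k < m)%N then c k else 0.
Proof.
have -> : ip1 (\sum_(i < m) c i *: e i) (e k) = \sum_(i < m) c i * ip1 (e i) (e k).
  elim/big_ind2 : _ => [|x x' y y' <- <-|i _]; last by rewrite ipZl.
    by rewrite -(scale0r (e k)) ipZl mul0r.
  by rewrite ipDl.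
case: ifP => km.
  rewrite (bigD1 (Ordinal km)) //= He.1 eqxx mulr1 big1 ?addr0 // => i ik.
  rewrite He.1; case: eqP => [ik'|]; last by rewrite mulr0.
  by case/eqP: ik; exact: val_inj.
rewrite big1 // => i _; rewrite He.1; case: eqP => [ik|]; last by rewrite mulr0.
by move: km; rewrite -ik ltn_ord.
Qed.

Lemma ip_proj m f k : ip1 (proj m f) (e k) = if (k < m)%N then ip1 f (e k) else 0.
Proof. by rewrite /proj big_mkord (ip_basis_sum m (fun k => ip1 f (e k))). Qed.

Lemma finite_span_proj m f : finite_span m (proj m f).
Proof. by move=> k mk; rewrite ip_proj ltnNge mk. Qed.

Lemma finite_spanS m n f : (m <= n)%N -> finite_span m f -> finite_span n f.
Proof. by move=> mn fm k nk; apply: fm; exact: leq_trans nk. Qed.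

Lemma ip1B f f' y : ip1 (f - f') y = ip1 f y - ip1 f' y.
Proof. by rewrite ipDl -scaleN1r ipZl mulN1r. Qed.

Lemma finite_spanB m f f' : finite_span m f -> finite_span m f' ->
  finite_span m (f - f').
Proof. by move=> fm fm' k mk; rewrite ip1B fm // fm' // subr0. Qed.

Lemma proj_cvg f : (fun m => proj m f) @ \oo --> f.
Proof. exact: He.2. Qed.

(** The expansion of f in the basis is constant from the m-th partial sum on. *)
Lemma finite_span_expand m f : finite_span m f -> f = proj m f.
Proof.
move=> fm; rewrite -[LHS](cvg_lim (@norm_hausdorff _ H1) (@proj_cvg f)).
apply: (cvg_lim (@norm_hausdorff _ H1)); apply: cvg_near_cst; near=> n; rewrite /proj.
have mn : (m <= n)%N by near: n; exact: nbhs_infty_ge.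
rewrite (big_cat_nat (n := m)) //= [X in _ + X]big_nat_cond [X in _ + X]big1 ?addr0 // => k.
by rewrite andbT => /andP[mk _]; rewrite fm // scale0r.
Unshelve. all: by end_near. Qed.

Lemma finite_span_coord m f : finite_span m f ->
  f = \sum_(i : 'I_m * 'I_dK) sofR K (rcoord f i) *: rdir e i.
Proof.
move=> fm; rewrite {1}(finite_span_expand fm) /proj big_mkord.
rewrite -(pair_bigA _ (fun k j => sofR K (rcoord f (k, j)) *: rdir e (k, j))) /=.
apply: eq_bigr => k _; rewrite {1}[ip1 f (e k)](sb_expand HK) scaler_suml.
apply: eq_bigr => j _; rewrite -scalerA; congr (sofR K _ *: _).
by rewrite /rcoord /rip /rdir /= ipZr mulrC.
Qed.

Lemma image_coord m f : finite_span m f ->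
  A f = \sum_(i : 'I_m * 'I_dK) sofR K (rho i.1 * rcoord f i) *: rdir g i.
Proof.
move=> fm; rewrite {1}(finite_span_coord fm) linear_sum; apply: eq_bigr => i _.
rewrite linearZ /= /rdir linearZ /= HAe !scalerA; congr (_ *: _).
by rewrite mulrC sofRM // -!mulrA; congr (_ * _); rewrite mulrC.
Qed.

Lemma rnorm_finite_span m f : finite_span m f ->
  rnorm f ^+ 2 = \sum_(k < m) sabs (ip1 f (e k)) ^+ 2.
Proof.
move=> fm; rewrite {1}(finite_span_coord fm) (rnorm_orthonormal_sum HK Hip1); last first.
  by move=> i j; exact: rdir_orthonormal He.1.
transitivity (\sum_(i : 'I_m * 'I_dK) (fun=> 1) i.1 * rcoord f i ^+ 2).
  by apply: eq_bigr => i _; rewrite mul1r.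
by rewrite (rcoord_sum f (fun=> 1)); apply: eq_bigr => i _; rewrite mul1r.
Qed.

Lemma rnorm_image_coord m f : finite_span m f ->
  rnorm (A f) ^+ 2 = \sum_(i : 'I_m * 'I_dK) (rho i.1 * rcoord f i) ^+ 2.
Proof.
move=> fm; rewrite {1}(image_coord fm) (rnorm_orthonormal_sum HK Hip2) //.
by move=> i j; exact: rdir_orthonormal Hg.
Qed.

Lemma rnorm_image m f : finite_span m f ->
  rnorm (A f) ^+ 2 = \sum_(k < m) rho k ^+ 2 * sabs (ip1 f (e k)) ^+ 2.
Proof.
move=> fm; rewrite (rnorm_image_coord fm) -(rcoord_sum f (fun k => rho k ^+ 2)).
by apply: eq_bigr => i _; rewrite exprMn.
Qed.

Lemma rip_image m f y : finite_span m f ->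
  rip2 (A f) y = \sum_(i : 'I_m * 'I_dK) rho i.1 * rcoord f i * rip2 (rdir g i) y.
Proof.
move=> fm; rewrite {1}(image_coord fm) rip_suml //; apply: eq_bigr => i _.
by rewrite ripZl.
Qed.

(** As A* A is diagonal, applying A keeps the residual orthogonal to the sieve.
    Hence on a sieve the likelihood separates into estimation error and bias. *)
Lemma image_residual_orthogonal m f f0 : finite_span m f ->
  rip2 (A f) (A (f0 - proj m f0)) = 0.
Proof.
move=> fm; rewrite (rip_image _ fm) big1 // => i _.
rewrite ripC // /rip /rdir ipZr ip_image ip1B ip_proj ltn_ord subrr.
by rewrite !mulr0 sre0 // mulr0.
Qed.

(** On a sieve the series in the likelihood is a finite sum, hence a linear
    combination of finitely many observations. *)
Lemma log_likelihood_finite (n : nat) (Y : H2 -> R) m f : finite_span m f ->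
  log_likelihood ip1 A e g rho n Y f =
  n%:R * \sum_(i : 'I_m * 'I_dK) rho i.1 * rcoord f i * Y (rdir g i)
    - n%:R / 2 * rnorm (A f) ^+ 2.
Proof.
move=> fm; rewrite /log_likelihood; congr (_ * _ - _).
set u := fun k => _.
have uE k : u k = rho k * \sum_j rcoord f (m:=k.+1) (ord_max, j) * Y (sb j *: g k).
  rewrite /u /data_coord sum_sbasis; congr (_ * _).
  have -> : sconj (\sum_(j < dK) sofR K (Y (sb j *: g k)) * sb j) =
     \sum_(j < dK) sofR K (Y (sb j *: g k)) * sconj (sb j).
    elim/big_ind2 : _ => [|x x' y y' <- <-|j _]; first exact: sconj0.
      exact: sconjD.
    by rewrite sconjM // sconj_sofR.
  rewrite mulr_sumr; elim/big_ind2 : _ => [|x x' y y' <- <-|j _]; first exact: sre0.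
    exact: sreD.
  by rewrite mulrCA sreZ // mulrC /rcoord /rip /rdir /= ipZr [sconj _ * _]mulrC.
transitivity (series u m).
  apply: cvg_lim => //; apply: cvg_near_cst; near=> N.
  have mN : (m <= N)%N by near: N; exact: nbhs_infty_ge.
  rewrite /series /= (big_cat_nat (n := m)) //= [X in _ + X]big_nat_cond [X in _ + X]big1 ?addr0 // => k.
  by rewrite andbT => /andP[mk _]; rewrite /u fm // mul0r sre0 // mulr0.
rewrite /series /= big_mkord.
rewrite -(pair_bigA _ (fun (k : 'I_m) (j : 'I_dK) => rho k * rcoord f (k, j) * Y (rdir g (k, j)))) /=.
apply: eq_bigr => k _; rewrite uE mulr_sumr; apply: eq_bigr => j _.
by rewrite mulrA.
Unshelve. all: by end_near. Qed.

End diagonal_operator.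

(** * Singular values and Sobolev tails *)

Section weights.
Variable R : realType.

Lemma weight_gt0 k : 0 < weight R k.
Proof. by rewrite /weight ltr_wpDr // sqr_ge0. Qed.

Lemma weight_ge1 k : 1 <= weight R k.
Proof. by rewrite /weight lerDl sqr_ge0. Qed.

Lemma weight_powRD k (a b : R) :
  weight R k `^ (a + b) = weight R k `^ a * weight R k `^ b.
Proof. by rewrite powRD // (gt_eqF (weight_gt0 k)) implybT. Qed.

Lemma weight_powR_le m k (s : R) : 0 <= s -> (m <= k)%N ->
  weight R k `^ (- s) <= m.+1%:R `^ (- (2 * s)).
Proof.
move=> s0 mk; rewrite !powRN lef_pV2 ?posrE ?powR_gt0 ?weight_gt0 //.
rewrite powRrM powR_mulrn //; apply: ge0_ler_powR => //; rewrite ?nnegrE.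
- exact: sqr_ge0.
- exact: ltW (weight_gt0 k).
- rewrite /weight ler_wpDl // ler_pXn2r ?nnegrE ?ler0n //.
  by rewrite ler_nat ltnS.
Qed.

(** Enlarging the constants absorbs the finitely many exceptional indices, since
    no singular value vanishes. *)
Lemma mildly_ill_posed_all (alpha : R) (rho : nat -> R) :
  (forall k, rho k != 0) -> mildly_ill_posed alpha rho ->
  exists c1 c2 : R, [/\ 0 < c1, 0 < c2 &
    forall k, c1 * weight R k `^ (- alpha / 2) <= `|rho k|
        <= c2 * weight R k `^ (- alpha / 2)].
Proof.
move=> rho0 [C1 [C2 [C10 C20 [N _ HN]]]].
have w0 k : 0 < weight R k `^ (- alpha / 2) by rewrite powR_gt0 ?weight_gt0.
have fin M : exists c1 c2 : R, [/\ 0 < c1, 0 < c2 &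
    forall k, (k < M)%N -> c1 * weight R k `^ (- alpha / 2) <= `|rho k|
        <= c2 * weight R k `^ (- alpha / 2)].
  elim: M => [|M [c1 [c2 [c10 c20 IH]]]]; first by exists 1, 1; split.
  pose r := `|rho M| / weight R M `^ (- alpha / 2).
  have r0 : 0 < r by rewrite divr_gt0 ?normr_gt0.
  exists (Num.min c1 r), (Num.max c2 r); split.
  - by rewrite lt_min c10.
  - by rewrite lt_max c20.
  move=> k; rewrite ltnS leq_eqVlt => /orP[/eqP->|/IH/andP[h1 h2]].
    apply/andP; split.
      by rewrite -ler_pdivlMr // ge_min lexx orbT.
    by rewrite -ler_pdivrMr // le_max lexx orbT.
  rewrite (le_trans _ h1) ?(le_trans h2) //.
    by apply: ler_wpM2r; [exact: ltW|rewrite le_max lexx].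
  by apply: ler_wpM2r; [exact: ltW|rewrite ge_min lexx].
have [c1 [c2 [c10 c20 h]]] := fin N.
exists (Num.min c1 C1), (Num.max c2 C2); split.
- by rewrite lt_min c10.
- by rewrite lt_max c20.
move=> k; have [kN|Nk] := ltnP k N.
  have /andP[h1 h2] := h k kN.
  rewrite (le_trans _ h1) ?(le_trans h2) //.
    by apply: ler_wpM2r; [exact: ltW|rewrite le_max lexx].
  by apply: ler_wpM2r; [exact: ltW|rewrite ge_min lexx].
have /andP[h1 h2] := HN k Nk.
rewrite (le_trans _ h1) ?(le_trans h2) //.
  by apply: ler_wpM2r; [exact: ltW|rewrite le_max lexx orbT].
by apply: ler_wpM2r; [exact: ltW|rewrite ge_min lexx orbT].
Qed.

End weights.

Section sobolev_tails.
Variables (R : realType) (K : scalars R).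
Hypothesis HK : K = real_scalars R \/ K = complex_scalars R.
Variables (H1 H2 : completeNormedModType K).
Variables (ip1 : {dot H1 for @sconj R K}) (ip2 : {dot H2 for @sconj R K}).
Hypotheses (Hip1 : hilbert_norm ip1) (Hip2 : hilbert_norm ip2).
Variables (A : {linear H1 -> H2}).
Hypotheses (Acont : continuous A).
Variables (e : nat -> H1) (g : nat -> H2) (rho : nat -> R).
Hypothesis He : orthonormal_basis ip1 e.
Hypothesis Hg : orthonormal_system ip2 g.
Hypothesis HAe : forall k, A (e k) = sofR K (rho k) *: g k.
Variables (alpha gamma : R) (f0 : H1).
Hypotheses (Hgamma : 0 < gamma) (Hf0 : sobolev ip1 e gamma f0).
Hypothesis (Halpha : 0 <= alpha).
Variables (c1 c2 : R).
Hypotheses (c10 : 0 < c1) (c20 : 0 < c2).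
Hypothesis Hrho : forall k, c1 * weight R k `^ (- alpha / 2) <= `|rho k|
        <= c2 * weight R k `^ (- alpha / 2).

Notation c k := (sabs (ip1 f0 (e k))).
Notation proj m := (proj ip1 e m f0).

Lemma rho_sqr_le k : rho k ^+ 2 <= c2 ^+ 2 * weight R k `^ (- alpha).
Proof.
have /andP[_ h] := Hrho k; rewrite -(real_normK (num_real (rho k))).
have w0 : 0 <= weight R k `^ (- alpha / 2) by exact: powR_ge0.
have -> : weight R k `^ (- alpha) = (weight R k `^ (- alpha / 2)) ^+ 2.
  by rewrite expr2 -weight_powRD; congr (_ `^ _); field.
by rewrite -exprMn ler_pXn2r // nnegrE // mulr_ge0 // ltW.
Qed.

Lemma rho_sqr_ge k : c1 ^+ 2 * weight R k `^ (- alpha) <= rho k ^+ 2.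
Proof.
have /andP[h _] := Hrho k; rewrite -(real_normK (num_real (rho k))).
have w0 : 0 <= weight R k `^ (- alpha / 2) by exact: powR_ge0.
have -> : weight R k `^ (- alpha) = (weight R k `^ (- alpha / 2)) ^+ 2.
  by rewrite expr2 -weight_powRD; congr (_ `^ _); field.
by rewrite -exprMn ler_pXn2r // nnegrE // mulr_ge0 // ltW.
Qed.

Lemma sobolev_bounded : exists2 S : R, 0 < S &
  forall n, \sum_(0 <= k < n) c k ^+ 2 * weight R k `^ gamma <= S.
Proof.
move: Hf0; rewrite /sobolev /=; set s := (\sum_(0 <= k <oo) _)%E => sfin.
have p k : (0%:E <= (c k ^+ 2 * weight R k `^ gamma)%:E)%E.
  by rewrite lee_fin mulr_ge0 ?sqr_ge0 ?powR_ge0.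
have s0 : (0 <= s)%E by apply: nneseries_ge0.
have sf : s \is a fin_num by rewrite ge0_fin_numE.
exists (fine s + 1); first by rewrite ltr_wpDl // fine_ge0.
move=> n; apply: (@le_trans _ _ (fine s)); last by rewrite lerDl.
rewrite -lee_fin fineK // -sumEFin.
by apply: (@nneseries_lim_ge R _ xpredT 0%N n) => k _ _; exact: p.
Qed.

(** Common form of the two tail estimates: b is the decay gained beyond index m
    over the weights of the Sobolev norm. *)
Lemma sum_tail_le (S : R) (m N : nat) (u : nat -> R) (b : R) : 0 < S ->
  (forall n, \sum_(0 <= k < n) c k ^+ 2 * weight R k `^ gamma <= S) ->
  (forall k, (m <= k)%N -> 0 <= u k <= b * (c k ^+ 2 * weight R k `^ gamma)) ->
  0 <= b -> \sum_(k < N | (m <= k)%N) u k <= b * S.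
Proof.
move=> S0 HS hu b0.
apply: (@le_trans _ _ (b * \sum_(0 <= k < N) c k ^+ 2 * weight R k `^ gamma)); last first.
  by apply: ler_wpM2l.
rewrite big_mkord mulr_sumr [leRHS](bigID (fun k : 'I_N => (m <= k)%N)) /=.
rewrite -[leLHS]addr0; apply: lerD.
  by apply: ler_sum => k mk; have /andP[] := hu k mk.
apply: sumr_ge0 => k _; apply: mulr_ge0 => //.
by apply: mulr_ge0; [exact: sqr_ge0|exact: powR_ge0].
Qed.

Let pdiff m N : H1 := proj N - proj m.

Let pdiff_fin m N : (m <= N)%N -> finite_span ip1 e N (pdiff m N).
Proof.
move=> mN; apply: finite_spanB; first exact: finite_span_proj.
by apply: (finite_spanS mN); exact: finite_span_proj.
Qed.

Let pdiff_coord m N (k : 'I_N) : sabs (ip1 (pdiff m N) (e k)) ^+ 2 =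
  if (m <= k)%N then c k ^+ 2 else 0.
Proof.
rewrite /pdiff ip1B !(ip_proj He) ltn_ord ltnNge.
case: (m <= k)%N => /=; first by rewrite subr0.
by rewrite subrr /sabs normr0 sre0 // expr0n.
Qed.

Let pdiff_norm m N : (m <= N)%N ->
  rnorm (pdiff m N) ^+ 2 = \sum_(k < N | (m <= k)%N) c k ^+ 2.
Proof.
move=> mN; rewrite (rnorm_finite_span HK Hip1 He (pdiff_fin mN)).
by rewrite [RHS]big_mkcond; apply: eq_bigr => k _; rewrite pdiff_coord.
Qed.

Let pdiff_image m N : (m <= N)%N ->
  rnorm (A (pdiff m N)) ^+ 2 = \sum_(k < N | (m <= k)%N) rho k ^+ 2 * c k ^+ 2.
Proof.
move=> mN; rewrite (rnorm_image HK Hip2 He Hg HAe (pdiff_fin mN)).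
rewrite [RHS]big_mkcond; apply: eq_bigr => k _; rewrite pdiff_coord.
by case: ifP => _ //; rewrite mulr0.
Qed.

Let rnorm_lim (H : normedModType K) (u : nat -> H) (l : H) m (b : R) :
  u @ \oo --> l -> (forall N, (m <= N)%N -> rnorm (u N) ^+ 2 <= b) ->
  rnorm l ^+ 2 <= b.
Proof.
move=> ul ub.
have cv : (fun N => rnorm (u N) ^+ 2) @ \oo --> rnorm l ^+ 2.
  have h : (fun N => rnorm (u N)) @ \oo --> rnorm l.
    by apply: continuous_cvg => //; exact: rnorm_continuous.
  by rewrite expr2; under eq_fun do rewrite expr2; exact: cvgM.
rewrite -(cvg_lim (@Rhausdorff R) cv).
apply: limr_le; first exact: (cvgP _ cv).
by near=> N; apply: ub; near: N; exact: nbhs_infty_ge.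
Unshelve. all: by end_near. Qed.

Let pdiff_cvg m : pdiff m @ \oo --> f0 - proj m.
Proof.
by apply: cvgB; [exact: (proj_cvg He)|exact: cvg_cst].
Qed.

(** Beyond index m the weights are at least m^2, which gives the decay of the
    bias in H1; in H2 the squared singular values contribute a further m^(-2 alpha). *)
Lemma sobolev_tails : exists2 S : R, 0 < S & forall m,
  [/\ rnorm (f0 - proj m) ^+ 2 <= S * m.+1%:R `^ (- (2 * gamma)),
      rnorm (A (f0 - proj m)) ^+ 2 <= S * m.+1%:R `^ (- (2 * (alpha + gamma))) &
      c m ^+ 2 <= S * weight R m `^ (- gamma)].
Proof.
have [S S0 HS] := sobolev_bounded.
exists (S * (1 + c2 ^+ 2)); first by rewrite mulr_gt0 // ltr_wpDr // sqr_ge0.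
have c2p : 1 <= 1 + c2 ^+ 2 by rewrite lerDl sqr_ge0.
have wK k s : weight R k `^ (- s) * weight R k `^ s = 1.
  by rewrite -weight_powRD addNr powRr0.
have SS b : 0 <= b -> b * S <= S * (1 + c2 ^+ 2) * b.
  by move=> b0; rewrite mulrC; apply: ler_wpM2r => //; rewrite ler_peMr // ltW.
move=> m; split.
- apply: (@rnorm_lim _ (pdiff m) _ m _ (@pdiff_cvg m)) => N mN; rewrite pdiff_norm //.
  apply: le_trans (SS _ (powR_ge0 _ _)).
  apply: (@sum_tail_le S m N (fun k => c k ^+ 2)) => // k mk.
  rewrite sqr_ge0 /= mulrCA.
  apply: (@le_trans _ _ (c k ^+ 2 * (weight R k `^ (- gamma) * weight R k `^ gamma))).
    by rewrite wK mulr1.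
  apply: ler_wpM2l; first exact: sqr_ge0.
  apply: ler_wpM2r; first exact: powR_ge0.
  by apply: weight_powR_le => //; exact: ltW.
- apply: (@rnorm_lim _ (fun N => A (pdiff m N)) _ m).
    by apply: continuous_cvg; [exact: Acont|exact: pdiff_cvg].
  move=> N mN; rewrite pdiff_image //.
  apply: (@le_trans _ _ (c2 ^+ 2 * m.+1%:R `^ (- (2 * (alpha + gamma))) * S)); last first.
    rewrite mulrAC [c2 ^+ 2 * S]mulrC; apply: ler_wpM2r; first exact: powR_ge0.
    by apply: ler_wpM2l; [exact: ltW|rewrite lerDr].
  apply: (@sum_tail_le S m N (fun k => rho k ^+ 2 * c k ^+ 2)) => // [k mk|]; last by rewrite mulr_ge0 ?sqr_ge0 ?powR_ge0.
  rewrite mulr_ge0 ?sqr_ge0 //=.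
  have h : weight R k `^ (- alpha) <= m.+1%:R `^ (- (2 * (alpha + gamma))) * weight R k `^ gamma.
    have -> : - alpha = - (alpha + gamma) + gamma by ring.
    rewrite weight_powRD; apply: ler_wpM2r; first exact: powR_ge0.
    by apply: weight_powR_le => //; rewrite addr_ge0 // ltW.
  apply: (le_trans (ler_wpM2r (sqr_ge0 _) (rho_sqr_le k))).
  set M := m.+1%:R `^ _ in h *.
  have -> : c2 ^+ 2 * M * (c k ^+ 2 * weight R k `^ gamma) =
    c2 ^+ 2 * (M * weight R k `^ gamma) * c k ^+ 2 by ring.
  apply: ler_wpM2r; first exact: sqr_ge0.
  by apply: ler_wpM2l; first exact: sqr_ge0.
- have := HS m.+1; rewrite big_nat_recr //= => h.
  have {}h : c m ^+ 2 * weight R m `^ gamma <= S.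
    apply: le_trans h; rewrite lerDr; apply: sumr_ge0 => k _.
    by rewrite mulr_ge0 ?sqr_ge0 ?powR_ge0.
  apply: (@le_trans _ _ (c m ^+ 2 * weight R m `^ gamma * weight R m `^ (- gamma))).
    by rewrite -mulrA [_ `^ gamma * _]mulrC wK mulr1.
  apply: ler_wpM2r; first exact: powR_ge0.
  by apply: (le_trans h); rewrite ler_peMr // ltW.
Qed.

End sobolev_tails.

(** * Linear combinations of white noise *)

Section integral_lincomb.
Context (R : realType) d (T : measurableType d) (P : probability T R).

Lemma integral_lincomb (I : Type) (s : seq I) (c v : I -> R) (F : I -> T -> R) :
  (forall i, P.-integrable setT (EFin \o F i)) ->
  (forall i, (\int[P]_w (F i w)%:E = (v i)%:E)%E) ->
  P.-integrable setT (fun w => (\sum_(i <- s) c i * F i w)%:E) /\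
  (\int[P]_w (\sum_(i <- s) c i * F i w)%:E = (\sum_(i <- s) c i * v i)%:E)%E.
Proof.
move=> iF EF; elim: s => [|i s [IH1 IH2]].
  split; last by rewrite big_nil; under eq_integral do rewrite big_nil; rewrite integral0.
  by under eq_fun do rewrite big_nil; exact: integrable0.
have iZ : P.-integrable setT (fun w => (c i)%:E * (F i w)%:E)%E.
  by apply: integrableZl => //; exact: iF.
split.
  under eq_fun do rewrite big_cons EFinD EFinM.
  exact: integrableD.
under eq_integral do rewrite big_cons EFinD EFinM.
rewrite integralD // integralZl //; last exact: iF.
by rewrite EF IH2 big_cons EFinD EFinM.
Qed.

End integral_lincomb.

Section noise.
Variables (R : realType) (K : scalars R).
Hypothesis HK : K = real_scalars R \/ K = complex_scalars R.
Variables (H : normedModType K) (ip : {dot H for @sconj R K}).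
Hypothesis Hip : hilbert_norm ip.
Context d (T : measurableType d) (P : probability T R).
Variable Z : H -> T -> R.
Hypothesis HZ : white_noise ip P Z.
Implicit Types s : seq (R * H).

(** A list of pairs (c, h) encodes at once a linear combination of noise variables
    and the same combination of vectors; the noise is an isometry between them. *)
Definition lincomb s (w : T) : R := \sum_(p <- s) p.1 * Z p.2 w.
Definition vcomb s : H := \sum_(p <- s) sofR K p.1 *: p.2.

Lemma measurable_noise h : measurable_fun setT (Z h).
Proof. by case: HZ => -[]. Qed.

Lemma measurable_lincomb s : measurable_fun setT (lincomb s).
Proof.
apply: measurable_sum => p; apply: measurable_funM => //.
exact: measurable_noise.
Qed.

Lemma gaussian_lincomb s : gaussian_law P (lincomb s).
Proof.
case: HZ => -[_ HG] _ _.
have := HG (size s) (fun j : 'I_(size s) => (nth (0, 0) s j).2)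
  (fun j : 'I_(size s) => (nth (0, 0) s j).1).
congr (gaussian_law P _); apply/funext => w.
by rewrite /lincomb (big_nth (0, 0)) big_mkord.
Qed.

Let iZ h : P.-integrable setT (EFin \o Z h).
Proof.
have [m [s gX]] : gaussian_law P (Z h).
  have := gaussian_lincomb [:: (1, h)].
  congr (gaussian_law P _); apply/funext => w.
  by rewrite /lincomb big_seq1 mul1r.
exact: (gaussian_integrable (measurable_noise h) gX).
Qed.

Let EZ h : (\int[P]_w (Z h w)%:E = 0%:E)%E.
Proof. by case: HZ => _ + _ => /(_ h); rewrite unlock. Qed.

Let EZZ h h' : (\int[P]_w (Z h w * Z h' w)%:E = (rip ip h h')%:E)%E.
Proof. by case: HZ => _ _ /(_ h h'); rewrite unlock. Qed.

Let iZZ h h' : P.-integrable setT (EFin \o (fun w => Z h w * Z h' w)).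
Proof.
have mZZ k k' : measurable_fun setT (fun w => Z k w * Z k' w).
  by apply: measurable_funM; exact: measurable_noise.
have i2 k : P.-integrable setT (fun w => (Z k w * Z k w)%:E).
  apply/integrableP; split; first exact/measurable_EFinP.
  under eq_integral do rewrite gee0_abs ?lee_fin -?expr2 ?sqr_ge0 // expr2.
  by rewrite EZZ ltry.
apply: (@le_integrable _ _ _ P setT measurableT _
  (fun w => (Z h w * Z h w)%:E + (Z h' w * Z h' w)%:E)%E).
- exact/measurable_EFinP.
- move=> w _ /=; rewrite lee_fin (@ger0_norm _ (_ + _)) ?addr_ge0 -?expr2 ?sqr_ge0 //.
  rewrite ler_norml; set a := Z h w; set b := Z h' w.
  have h1 : 0 <= (a - b) ^+ 2 by exact: sqr_ge0.
  have h2 : 0 <= (a + b) ^+ 2 by exact: sqr_ge0.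
  have h3 : 0 <= a ^+ 2 by exact: sqr_ge0.
  have h4 : 0 <= b ^+ 2 by exact: sqr_ge0.
  by apply/andP; split; nra.
- exact: integrableD.
Qed.

Lemma lincomb_mean s : ('E_P[lincomb s] = 0)%E.
Proof.
rewrite unlock /lincomb.
have [_ ->] := @integral_lincomb _ _ _ P _ s fst (fun=> 0) (fun p => Z p.2)
  (fun p => iZ p.2) (fun p => EZ p.2).
by rewrite big1 // => i _; rewrite mulr0.
Qed.

Lemma lincomb_var s :
  ('E_P[(fun w => lincomb s w * lincomb s w)%R] = (rnorm (vcomb s) ^+ 2)%:E)%E.
Proof.
have inner (h : H) : P.-integrable setT (EFin \o (fun w => Z h w * lincomb s w)) /\
    (\int[P]_w (Z h w * lincomb s w)%:E = (\sum_(p <- s) p.1 * rip ip h p.2)%:E)%E.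
  have [h1 h2] := @integral_lincomb _ _ _ P _ s fst (fun p => rip ip h p.2)
    (fun p w => Z h w * Z p.2 w) (fun p => iZZ h p.2) (fun p => EZZ h p.2).
  have E w : Z h w * lincomb s w = \sum_(p <- s) p.1 * (Z h w * Z p.2 w).
    by rewrite /lincomb mulr_sumr; apply: eq_bigr => p _; rewrite mulrCA.
  split; first by rewrite (_ : _ \o _ =
    (fun w => (\sum_(p <- s) p.1 * (Z h w * Z p.2 w))%:E)) //; apply/funext => w /=; rewrite E.
  by under eq_integral do rewrite E.
rewrite unlock.
have [_ h2] := @integral_lincomb _ _ _ P _ s fst
    (fun p => \sum_(p' <- s) p'.1 * rip ip p.2 p'.2)
    (fun p w => Z p.2 w * lincomb s w) (fun p => (inner p.2).1) (fun p => (inner p.2).2).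
have E w : lincomb s w * lincomb s w = \sum_(p <- s) p.1 * (Z p.2 w * lincomb s w).
  by rewrite {1}/lincomb mulr_suml; apply: eq_bigr => p _; rewrite mulrA.
under eq_integral do rewrite E.
rewrite h2 (rnorm_sumsq HK Hip s fst snd); congr EFin; apply: eq_bigr => p _.
by rewrite mulr_sumr; apply: eq_bigr => p' _; rewrite mulrA.
Qed.

Lemma lincomb_mgf s t :
  (\int[P]_w (expR (t * lincomb s w))%:E =
   (expR (t ^+ 2 * rnorm (vcomb s) ^+ 2 / 2))%:E)%E.
Proof.
apply: centered_gaussian_mgf.
- exact: measurable_lincomb.
- exact: gaussian_lincomb.
- exact: lincomb_mean.
- exact: lincomb_var.
Qed.

Lemma lincomb_chebyshev s (a : R) : 0 < a ->
  (P [set w | (a <= `|lincomb s w|)%R] <= (rnorm (vcomb s) ^+ 2 / a ^+ 2)%:E)%E.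
Proof.
move=> a0.
have -> : [set w | a <= `|lincomb s w|] = [set w | a ^+ 2 <= lincomb s w ^+ 2].
  apply/seteqP; split => w /=; rewrite -[lincomb s w ^+ 2]real_normK ?num_real //;
    by rewrite ler_pXn2r // nnegrE // ltW.
have m2 : measurable_fun setT (fun w => lincomb s w ^+ 2).
  by apply: measurable_funX; exact: measurable_lincomb.
have a20 : 0 < a ^+ 2 by rewrite exprn_gt0.
apply: (le_trans (@markov_real _ _ _ P _ (a ^+ 2) m2 (fun w => sqr_ge0 _) a20)).
have := lincomb_var s; rewrite unlock; under eq_integral do rewrite -expr2.
by move=> ->; rewrite -EFinM lee_fin mulrC.
Qed.

(** Orthonormality makes sums and differences of two noise coordinates Gaussian
    with variance 2, so their fourth moments are 4 times the standard one. *)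
Lemma noise_chi_square (I : finType) (h : I -> H) :
  (forall i j, rip ip (h i) (h j) = (i == j)%:R) -> (0 < #|I|)%N ->
  (P [set w | (2 * #|I|%:R <= \sum_i Z (h i) w ^+ 2)%R] <= (2 / #|I|%:R)%:E)%E.
Proof.
move=> hh I0.
pose L (c c' : R) i j := [:: (c, h i); (c', h j)].
have LE c c' i j w : lincomb (L c c' i j) w = c * Z (h i) w + c' * Z (h j) w.
  by rewrite /lincomb big_cons big_seq1.
have nL c c' i j : i != j -> rnorm (vcomb (L c c' i j)) ^+ 2 = c ^+ 2 + c' ^+ 2.
  move=> ij; rewrite (rnorm_sqr HK Hip) /vcomb big_cons big_seq1 /=.
  rewrite !(ripDl, ripDr, ripZl, ripZr) // !hh !eqxx (negbTE ij) eq_sym (negbTE ij) /=.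
  by ring.
have n1 i : rnorm (vcomb [:: (1, h i)]) ^+ 2 = 1.
  by rewrite (rnorm_sqr HK Hip) /vcomb big_seq1 /= ripZl // ripZr // hh eqxx !mul1r.
have L1 i w : lincomb [:: (1, h i)] w = Z (h i) w.
  by rewrite /lincomb big_seq1 mul1r.
have fourth s : rnorm (vcomb s) ^+ 2 = 1 ->
    (\int[P]_w (lincomb s w ^+ 4)%:E = normal_kurtosis R)%E /\
    (\int[P]_w (lincomb s w ^+ 4)%:E <= 3%:E)%E.
  move=> s1; have v := lincomb_var s; rewrite s1 in v.
  split.
    exact: (standard_gaussian_fourth (measurable_lincomb s) (gaussian_lincomb s) (lincomb_mean s) v).
  exact: (standard_gaussian_fourth_le (measurable_lincomb s) (gaussian_lincomb s) (lincomb_mean s) v).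
have [i0 _] : exists i0, i0 \in I by apply/card_gt0P.
have kle : (normal_kurtosis R <= 3%:E)%E.
  by have [<-] := fourth _ (n1 i0).
have kge : (0 <= normal_kurtosis R)%E.
  have [<- _] := fourth _ (n1 i0); apply: integral_ge0 => w _.
  by rewrite lee_fin exprn_even_ge0.
have kfin : normal_kurtosis R \is a fin_num.
  by rewrite ge0_fin_numE // (le_lt_trans kle) ?ltry.
have pair (c : R) i j : c ^+ 2 = 1 -> i != j ->
    (\int[P]_w ((Z (h i) w + c * Z (h j) w) ^+ 4)%:E = (4 * fine (normal_kurtosis R))%:E)%E.
  (* The normalized sum or difference is again standard Gaussian. *)
  move=> c1 ij; pose b : R := Num.sqrt 2^-1.
  have b2 : b ^+ 2 = 2^-1 by rewrite sqr_sqrtr.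
  have [|E _] := fourth (L b (b * c) i j).
    by rewrite nL // exprMn c1 b2; field.
  rewrite EFinM fineK // -E -integral_realZ //.
  - apply: eq_integral => w _; congr EFin; rewrite LE.
    have b4 : b ^+ 4 = 4^-1 by rewrite -[4%N]/(2 * 2)%N exprM b2; field.
    have -> : b * Z (h i) w + b * c * Z (h j) w = b * (Z (h i) w + c * Z (h j) w) by ring.
    by rewrite exprMn b4 mulrA mulfV ?mul1r.
  - by apply: measurable_funX; exact: measurable_lincomb.
  - by move=> w; rewrite exprn_even_ge0.
apply: (@chi_square_tail _ _ _ P I (fun i => Z (h i)) (fine (normal_kurtosis R))) => //.
- by move=> i; exact: measurable_noise.
- move=> i; rewrite -[RHS]/(1%:E) -(n1 i) -lincomb_var unlock.
  by apply: eq_integral => w _; rewrite L1 expr2.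
- move=> i; rewrite fineK //; have [<- _] := fourth _ (n1 i).
  by apply: eq_integral => w _; rewrite L1.
- move=> i j ij; rewrite -(pair 1 i j) ?expr1n //.
  by apply: eq_integral => w _; rewrite mul1r.
- move=> i j ij; rewrite -(pair (-1) i j) ?sqrrN ?expr1n //.
  by apply: eq_integral => w _; rewrite mulN1r.
- by rewrite -lee_fin fineK.
Qed.

End noise.

(** * Small boxes of scalars *)

Section borel_sets.
Variables (R : realType) (H : ptopologicalType).

Lemma open_borel (U : set H) : open U -> measurable (U : set (borel H)).
Proof. by move=> oU; apply: sub_sigma_algebra. Qed.

Lemma continuous_borel (f : H -> R) : continuous f ->
  measurable_fun setT (f : borel H -> R).
Proof.
move=> /continuousP cf; apply: (measurability _ (RGenOpens.measurableE R)).
move=> _ [_ [a [b ->] <-]]; rewrite setTI; apply: open_borel; apply: cf.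
exact: interval_open.
Qed.

End borel_sets.

Section scalar_measure.
Variables (R : realType) (K : scalars R).
Hypothesis HK : K = real_scalars R \/ K = complex_scalars R.
Notation dK := (size (sbasis K)).
Implicit Types (q : K -> R) (t : R) (c : K) (x : scoord K).

Definition scalar_coord c (j : 'I_dK) : R := sre (c * sconj (sb j)).

Lemma scalar_coordB c c' j : scalar_coord (c - c') j = scalar_coord c j - scalar_coord c' j.
Proof.
rewrite /scalar_coord mulrBl sreD //; congr (_ + _).
by rewrite -mulN1r -(sofR1 HK) -sofRN // sreZ // mulN1r.
Qed.

Lemma measurable_scalar_coord j :
  measurable_fun setT (fun x : scoord K => scalar_coord (sofcoord x) j).
Proof.
rewrite /scalar_coord /sb; move: j; case: HK => -> /= j.
  rewrite ord1 /=; under eq_fun do rewrite mulr1; exact: measurable_id.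
case: j => -[|[|//]] ? /=.
- under eq_fun do rewrite oppr0 mulr1 mulr0 subr0; exact: measurable_fst.
- under eq_fun do rewrite mulr0 add0r mulrN1 opprK; exact: measurable_snd.
Qed.

(** The factor 2 bounds the square root of the real dimension of K. *)
Lemma sabs_le_coord c (b : R) : 0 <= b -> (forall j, `|scalar_coord c j| <= b) ->
  sabs c <= 2 * b.
Proof.
move=> b0 hb; rewrite -(ler_pXn2r (n := 2)) // ?nnegrE ?sabs_ge0 ?mulr_ge0 //.
rewrite sabs_sqr //; apply: (@le_trans _ _ (\sum_(j < dK) b ^+ 2)).
  apply: ler_sum => j _; rewrite -[X in X <= _]real_normK ?num_real //.
  by rewrite ler_pXn2r ?nnegrE //; exact: hb.
rewrite sumr_const card_ord -[_ *+ dK]mulr_natl exprMn; apply: ler_wpM2r; first exact: sqr_ge0.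
by case: HK => -> /=; rewrite -natrX ler_nat.
Qed.

(** A cube in real coordinates, so that its Lebesgue measure is explicit for both
    scalar fields. *)
Definition box c (b : R) : set (scoord K) :=
  [set x | forall j, `|scalar_coord (sofcoord x) j - scalar_coord c j| <= b].

Lemma measurable_box c b : measurable (box c b).
Proof.
have -> : box c b = \bigcap_(j in [set: 'I_dK])
   [set x | `|scalar_coord (sofcoord x) j - scalar_coord c j| <= b].
  by apply/seteqP; split => x /= h j => [_|]; exact: h.
apply: fin_bigcap_measurable => [|j _]; first exact: finite_finset.
rewrite -[X in measurable X]setTI; apply: measurable_fun_le => //.
apply: measurableT_comp => //; apply: measurable_funB => //.
exact: measurable_scalar_coord.
Qed.

Lemma sleb_box c b : 0 < b -> sleb K (box c b) = ((2 * b) ^+ dK)%:E.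
Proof.
move=> b0.
have itvE (a : R) : `[a - b, a + b]%classic = [set x : R | `|x - a| <= b].
  by apply/seteqP; split => x /=; rewrite in_itv /= ler_distl.
have leb (a : R) : lebesgue_measure `[a - b, a + b]%classic = (2 * b)%:E.
  rewrite lebesgue_measure_itv /= lte_fin ifT; last lra.
  by rewrite -EFinB; congr EFin; ring.
rewrite /box /scalar_coord /sb; move: c; case: HK => -> /= c.
  rewrite expr1 -(leb c) itvE; congr (lebesgue_measure _); apply/seteqP; split => x /=.
    by move=> /(_ ord0); rewrite /= !mulr1.
  by move=> h j; rewrite ord1 /= !mulr1.
case: c => u v.
pose I (a : R) : set R := `[a - b, a + b]%classic.
transitivity (lebesgue_measure (I u) * lebesgue_measure (I v))%E; last by rewrite /I !leb -EFinM expr2.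
rewrite -product_measure1E; [|exact: measurable_itv..].
congr ((_ \x _)%E _); rewrite /I !itvE; apply/seteqP; split => -[x y] /=.
  move=> h; have := h ord0; have := h ord_max => /=.
  by rewrite !(oppr0, mulr1, mulr0, subr0, add0r, mulrN1, opprK).
move=> [h1 h2] [[|[|//]] ?] /=.
  by rewrite !(oppr0, mulr1, mulr0, subr0).
by rewrite !(mulr0, add0r, mulrN1, opprK).
Qed.

Variables (q : K -> R) (D dq w : R).
Hypotheses (Hq : is_density q) (HD : 0 < D) (Hdq : 0 < dq) (Hw : 1 <= w).
Hypothesis Hqlow : forall x : K, D * expR (- dq * sabs x `^ w) <= q x.

Lemma measurable_scaled_density t :
  measurable_fun setT (fun x : scoord K => scaled_density q t (sofcoord x)).
Proof.
apply: measurable_funM => //.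
case: Hq => mq _ _; move: q mq; case: HK => -> /= q0 mq.
  have m1 : measurable_fun setT (fun x : measurableTypeR R => t^-1 * x : measurableTypeR R).
    exact: measurable_funM.
  by have := measurableT_comp mq m1.
have ms : measurable_fun setT (fun p : measurableTypeR R * measurableTypeR R =>
   ((t^-1 * p.1)%R, (t^-1 * p.2)%R) : measurableTypeR R * measurableTypeR R).
  apply/measurable_fun_pairP; split.
    by apply: measurable_funM => //; exact: measurable_fst.
  by apply: measurable_funM => //; exact: measurable_snd.
have := measurableT_comp mq ms.
congr (measurable_fun _ _); apply/funext => -[x y] /=; congr q0.
by apply/eqP; rewrite eq_complex /=; apply/andP; split; apply/eqP; ring.
Qed.

Lemma scaled_density_ge0 t x : 0 < t -> 0 <= scaled_density q t (sofcoord x).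
Proof.
case: Hq => _ q0 _ t0; apply: mulr_ge0; last exact: q0.
by rewrite exprn_ge0 // invr_ge0 ltW.
Qed.

(** On the box the density is at least its lower envelope at distance |c| + 2b.
    Finiteness of the total mass is assumed because the real-valued integral
    of a non-integrable function is 0 by convention. *)
Lemma box_mass_ge t c b : 0 < t -> 0 < b ->
  (\int[sleb K]_x (scaled_density q t (sofcoord x))%:E < +oo)%E ->
  (2 * b / t) ^+ dK * (D * expR (- dq * ((sabs c + 2 * b) / t) `^ w))
  <= Rintegral (sleb K) (box c b) (fun x => scaled_density q t (sofcoord x)).
Proof.
move=> t0 b0 fin.
have mb := measurable_box c b.
have msd := measurable_scaled_density t.
rewrite /Rintegral; set r := (X in X <= _).
have low : (r%:E <= \int[sleb K]_(x in box c b) (scaled_density q t (sofcoord x))%:E)%E.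
  (* The minimum over the box of the lower envelope of the density. *)
  pose v := t^-1 ^+ dK * (D * expR (- dq * ((sabs c + 2 * b) / t) `^ w)).
  have -> : r%:E = (\int[sleb K]_(x in box c b) v%:E)%E.
    rewrite integral_cst // sleb_box // -EFinM; congr EFin.
    by rewrite /r /v exprMn -mulrA [RHS]mulrC.
  apply: ge0_le_integral => //.
  - move=> x _; rewrite lee_fin !mulr_ge0 // ?exprn_ge0 ?invr_ge0 ?ltW //.
  - by apply/measurable_EFinP; exact: measurable_funTS.
  - move=> x xb; rewrite lee_fin /scaled_density; apply: ler_wpM2l.
      by rewrite exprn_ge0 // invr_ge0 ltW.
    apply: le_trans (Hqlow _); apply: ler_wpM2l; first exact: ltW.
    rewrite ler_expR !mulNr lerN2; apply: ler_wpM2l; first exact: ltW.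
    apply: ge0_ler_powR; rewrite ?nnegrE ?sabs_ge0 //.
    + exact: le_trans Hw.
    + by rewrite divr_ge0 ?addr_ge0 ?sabs_ge0 ?mulr_ge0 // ltW.
    have sM (a : R) (y : K) : 0 < a -> sabs (sofR K a * y) = a * sabs y.
      move=> a0; rewrite /sabs normrM [`|sofR K a|]gtr0_norm ?sofR_gt0 //.
      by rewrite sreZ.
    rewrite sM ?invr_gt0 // [leRHS]mulrC; apply: ler_wpM2l; first by rewrite invr_ge0 ltW.
    have : sabs (sofcoord x) <= sabs c + sabs (sofcoord x - c).
      rewrite /sabs -sreD //; apply: sre_le => //.
      by rewrite -{1}(subrK c (sofcoord x)) addrC; exact: ler_normD.
    move=> /le_trans; apply; rewrite lerD2l; apply: sabs_le_coord; first exact: ltW.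
    by move=> j; rewrite scalar_coordB; exact: xb.
rewrite -lee_fin fineK // ge0_fin_numE; last first.
  by apply: integral_ge0 => x _; rewrite lee_fin scaled_density_ge0.
apply: le_lt_trans fin; apply: ge0_subset_integral => //.
- exact/measurable_EFinP.
- by move=> x _; rewrite lee_fin scaled_density_ge0.
Qed.

End scalar_measure.

(** * Prior mass of sieves and of boxes *)

Section sieve.
Variables (R : realType) (K : scalars R).
Hypothesis HK : K = real_scalars R \/ K = complex_scalars R.
Variables (H1 : completeNormedModType K) (ip1 : {dot H1 for @sconj R K}).
Hypothesis Hip1 : hilbert_norm ip1.
Variable e : nat -> H1.
Hypothesis He : orthonormal_basis ip1 e.
Variables (h : nat -> R) (q : K -> R) (tau : nat -> R).
Variable Pi : probability (borel H1) R.
Hypotheses (Hq : is_density q) (Htau : forall k, 0 < tau k).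
Hypothesis HPi : sieve_prior e h q tau Pi.
Variables (B1 B2 b1 b2 : R).
Hypotheses (HB1 : 0 < B1) (HB2 : 0 < B2) (Hb1 : 0 < b1) (Hb2 : 0 < b2).
Hypothesis Hhm : forall m, (1 <= m)%N ->
     B1 * expR (- b1 * m%:R) <= h m <= B2 * expR (- b2 * m%:R).
Variables (D dq wq : R).
Hypotheses (HD : 0 < D) (Hdq : 0 < dq) (Hw : 1 <= wq).
Hypothesis Hqlow : forall x : K, D * expR (- dq * sabs x `^ wq) <= q x.
Notation dK := (size (sbasis K)).
Notation span := (finite_span ip1 e).

(** Polarization. *)
Lemma rip_continuous (y : H1) : continuous (fun f : H1 => rip ip1 f y).
Proof.
have -> : (fun f : H1 => rip ip1 f y) =
   (fun f => 4^-1 * (rnorm (f + y) ^+ 2 - rnorm (f - y) ^+ 2)).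
  apply/funext => f; rewrite !(rnorm_sqr HK Hip1) ripBl // !ripBr // ripDl // !ripDr //.
  by rewrite (ripC HK ip1 y f); field.
move=> f; apply: cvgM; first exact: cvg_cst.
have c2 (z : H1) : (fun f => rnorm (f + z) ^+ 2) f @[f --> f] --> rnorm (f + z) ^+ 2.
  have c1 : (fun f => rnorm (f + z)) f @[f --> f] --> rnorm (f + z).
    apply: (@continuous_comp _ _ _ (fun f : H1 => f + z) (@rnorm R K H1)).
      by apply: cvgD; [exact: cvg_id|exact: cvg_cst].
    exact: rnorm_continuous.
  by rewrite expr2; under eq_fun do rewrite expr2; exact: cvgM.
by apply: cvgB; exact: c2.
Qed.

Lemma measurable_rip (y : H1) : measurable_fun setT (fun f : borel H1 => rip ip1 f y).
Proof. exact: continuous_borel (@rip_continuous y). Qed.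

Lemma finite_span_coordP m f : span m f <->
  forall k (j : 'I_dK), (m <= k)%N -> rip ip1 f (sb j *: e k) = 0.
Proof.
split=> [fm k j mk|fm k mk].
  by rewrite /rip ipZr fm // mulr0 sre0.
rewrite (sb_expand HK (ip1 f (e k))) big1 // => j _.
have := fm k j mk; rewrite /rip ipZr mulrC => ->.
by rewrite sofR0 // mul0r.
Qed.

Definition sieve_box m (c : nat -> K) (b : R) : set H1 :=
  [set f | span m f /\ forall k (j : 'I_dK), (k < m)%N ->
     `|scalar_coord (ip1 f (e k)) j - scalar_coord (c k) j| <= b].

Lemma scalar_coord_ip f k j : scalar_coord (ip1 f (e k)) j = rip ip1 f (sb j *: e k).
Proof. by rewrite /scalar_coord /rip ipZr mulrC. Qed.

(** Stated along a map phi: it serves both for the identity of H1 and for the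
    random series, of which only the coefficients are known to be measurable. *)
Let measurable_span_gen d (T : measurableType d) (phi : T -> H1) m :
  (forall k j, measurable_fun setT (fun t => rip ip1 (phi t) (sb j *: e k))) ->
  measurable [set t | span m (phi t)].
Proof.
move=> mphi.
have -> : [set t | span m (phi t)] = \bigcap_(k in [set k | (m <= k)%N])
   \bigcap_(j in [set: 'I_dK]) [set t | rip ip1 (phi t) (sb j *: e k) = 0].
  apply/seteqP; split => t /=.
    by move=> /finite_span_coordP ht k mk j _; exact: ht.
  by move=> ht; apply/finite_span_coordP => k j mk; exact: ht.
apply: bigcap_measurable => [|k _]; first by exists m => /=.
apply: fin_bigcap_measurable => [|j _]; first exact: finite_finset.
rewrite -[X in measurable X]setTI.
exact: (mphi k j measurableT [set 0] (measurable_set1 _)).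
Qed.

Let measurable_sieve_box_gen d (T : measurableType d) (phi : T -> H1) m c b :
  (forall k j, measurable_fun setT (fun t => rip ip1 (phi t) (sb j *: e k))) ->
  measurable [set t | sieve_box m c b (phi t)].
Proof.
move=> mphi.
have -> : [set t | sieve_box m c b (phi t)] = [set t | span m (phi t)] `&`
   \bigcap_(k in [set k | (k < m)%N]) \bigcap_(j in [set: 'I_dK])
    [set t | `|rip ip1 (phi t) (sb j *: e k) - scalar_coord (c k) j| <= b].
  apply/seteqP; split => t /= [h1 h2]; split => //.
    by move=> k mk j _; rewrite /= -scalar_coord_ip; exact: h2.
  by move=> k j mk; rewrite scalar_coord_ip; exact: h2.
apply: measurableI; first exact: measurable_span_gen.
apply: bigcap_measurableType => k _.
apply: fin_bigcap_measurable => [|j _]; first exact: finite_finset.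
rewrite -[X in measurable X]setTI; apply: measurable_fun_le => //.
apply: measurableT_comp => //; apply: measurable_funB => //; exact: mphi.
Qed.

Lemma measurable_span m : measurable (span m : set (borel H1)).
Proof. exact: (@measurable_span_gen _ (borel H1) (fun f => f) m (fun k j => measurable_rip _)). Qed.

Lemma measurable_sieve_box m c b : measurable (sieve_box m c b : set (borel H1)).
Proof. exact: (@measurable_sieve_box_gen _ (borel H1) (fun f => f) m c b (fun k j => measurable_rip _)). Qed.

Definition spans : set H1 := \bigcup_m span m.

Lemma measurable_spans : measurable (spans : set (borel H1)).
Proof. by apply: bigcup_measurable => m _; exact: measurable_span. Qed.

Section representation.
Context (d : measure_display) (T : measurableType d) (P : probability T R).
Variables (M : T -> nat) (X : nat -> T -> scoord K).
Hypothesis mM : measurable_fun setT M.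
Hypothesis mX : forall k, measurable_fun setT (X k).
Hypothesis HM : forall m, (1 <= m)%N -> P (M @^-1` [set m]) = (h m)%:E.
Hypothesis HX : forall m (B : nat -> set (scoord K)), (1 <= m)%N ->
  (forall k, measurable (B k)) ->
  P [set w | M w = m /\ forall k, (k < m)%N -> B k (X k w)] =
  (h m * \prod_(k < m) Rintegral (sleb K) (B k)
     (fun x => scaled_density q (tau k) (sofcoord x)))%:E.
Let phi w := \sum_(k < M w) sofcoord (X k w) *: e k.
Hypothesis HS : forall S : set (borel H1), measurable S -> Pi S = P (phi @^-1` S).

Let ip_phi w k : ip1 (phi w) (e k) = if (k < M w)%N then sofcoord (X k w) else 0.
Proof. exact: (ip_basis_sum He (M w) (fun k => sofcoord (X k w))). Qed.

Let measurable_M (A : set nat) : measurable (M @^-1` A).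
Proof. by rewrite -[X in measurable X]setTI; exact: mM. Qed.

Let mphi k j : measurable_fun setT (fun t => rip ip1 (phi t) (sb j *: e k)).
Proof.
have -> : (fun t => rip ip1 (phi t) (sb j *: e k)) =
  (fun t => if (k < M t)%N then scalar_coord (sofcoord (X k t)) j else 0).
  apply/funext => t; rewrite -scalar_coord_ip ip_phi; case: ifP => // _.
  by rewrite /scalar_coord mul0r sre0.
apply: measurable_fun_if => //.
- move=> _ Y _; rewrite setTI -[X in measurable X]/(M @^-1` ((fun m => (k < m)%N) @^-1` Y)).
  exact: measurable_M.
- apply: measurable_funTS; apply: (measurableT_comp (measurable_scalar_coord HK j)).
  exact: mX.
Qed.

Let spans_phi w : spans (phi w).
Proof. by exists (M w) => // k mk; rewrite ip_phi ltnNge mk. Qed.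

Lemma rep_spans : Pi (~` spans) = 0.
Proof.
rewrite HS; last by apply: measurableC; exact: measurable_spans.
rewrite (_ : phi @^-1` _ = set0) ?measure0 // -subset0 => w /=.
by apply; exact: spans_phi.
Qed.

(** The random series leaves the span only if M > m; sum the geometric bounds
    on h. *)
Lemma rep_span_tail m :
  (Pi (~` span m) <= (B2 / (expR b2 - 1) * expR (- b2 * m%:R))%:E)%E.
Proof.
rewrite HS; last by apply: measurableC; exact: measurable_span.
pose F j := M @^-1` [set (m + j).+1].
apply: (@le_trans _ _ (\sum_(j <oo) P (F j))%E).
  apply: measure_sigma_subadditive.
  - by move=> j; exact: measurable_M.
  - rewrite -[X in measurable X]/(~` [set t | span m (phi t)]); apply: measurableC.
    exact: measurable_span_gen.
  - move=> w /= nw; have [Mm|mM'] := leqP (M w) m.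
      exfalso; apply: nw => k mk; rewrite ip_phi ltnNge.
      by rewrite (leq_trans Mm mk).
    exists (M w - m.+1)%N => //; by rewrite /F /= -addSn subnKC.
have e1 : 1 < expR b2 by rewrite expR_gt1.
have z1 : `|expR (- b2)| < 1 by rewrite gtr0_norm ?expR_gt0 // expR_lt1 oppr_lt0.
apply: lime_le; first exact: is_cvg_nneseries.
near=> n; rewrite -[leLHS]/(\sum_(0 <= j < n) P (F j))%E.
pose a := B2 * expR (- b2 * m.+1%:R).
apply: (@le_trans _ _ (\sum_(0 <= j < n) (a * expR (- b2) ^+ j)%:E)%E).
  apply: lee_sum => j _; rewrite HM // lee_fin.
  have /andP[_ /le_trans] := Hhm (ltn0Sn (m + j)); apply.
  rewrite /a -mulrA -expRM_natr -expRD le_eqVlt; apply/orP; left; apply/eqP.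
  by congr (_ * expR _); rewrite -addSn natrD; ring.
rewrite sumEFin lee_fin.
have a0 : 0 <= a by rewrite mulr_ge0 ?expR_ge0 // ltW.
have := geometric_le_lim n a0 (expR_gt0 (- b2)) z1; rewrite /series /= => /le_trans; apply.
rewrite le_eqVlt; apply/orP; left; apply/eqP.
rewrite /a -natr1 mulrDr mulr1 expRD expRN; field.
by rewrite subr_eq0 gt_eqF // gt_eqF // expR_gt0.
Unshelve. all: by end_near. Qed.

(** If the integral were infinite, its real value would be 0, and the first k + 1
    coefficients would have total mass 0 given M = k + 1, although h is positive. *)
Lemma rep_finite_density k :
  (\int[sleb K]_x (scaled_density q (tau k) (sofcoord x))%:E < +oo)%E.
Proof.
rewrite ltNge leye_eq; apply/negP => /eqP inf.
have := HX (B := fun=> setT) (ltn0Sn k) (fun=> measurableT).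
have -> : [set w | M w = k.+1 /\ (forall i, (i < k.+1)%N -> setT (X i w))] = M @^-1` [set k.+1].
  by apply/seteqP; split => w /= => [[]|].
rewrite HM // => -[] /esym/eqP; rewrite (bigD1 ord_max) //=.
rewrite {1}/Rintegral inf /= mul0r mulr0 => /eqP h0.
have /andP[+ _] := Hhm (ltn0Sn k); rewrite -h0 leNgt => /negP; apply.
by rewrite mulr_gt0 ?expR_gt0.
Qed.

Lemma rep_box_mass m (c : nat -> K) b : (1 <= m)%N -> 0 < b ->
  ((h m * \prod_(k < m) ((2 * b / tau k) ^+ dK *
      (D * expR (- dq * ((sabs (c k) + 2 * b) / tau k) `^ wq))))%:E
   <= Pi (sieve_box m c b))%E.
Proof.
move=> m1 b0; rewrite HS; last exact: measurable_sieve_box.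
have mB k : measurable (box (c k) b) by exact: measurable_box.
apply: (@le_trans _ _ (P [set w | M w = m /\ forall k, (k < m)%N -> box (c k) b (X k w)])).
  rewrite (HX (B := fun k => box (c k) b) m1 mB) lee_fin; apply: ler_wpM2l.
    have /andP[+ _] := Hhm m1; apply: le_trans.
    by rewrite mulr_ge0 ?expR_ge0 // ltW.
  apply: ler_prod => k _; apply/andP; split.
    rewrite mulr_ge0 ?mulr_ge0 ?expR_ge0 ?(ltW HD) // exprn_ge0 // divr_ge0 ?mulr_ge0 // ltW //.
  by apply: box_mass_ge => //; exact: rep_finite_density.
apply: le_measure; rewrite ?inE.
- have -> : [set w | M w = m /\ forall k, (k < m)%N -> box (c k) b (X k w)] =
    M @^-1` [set m] `&` \bigcap_(k in [set k | (k < m)%N]) (X k @^-1` box (c k) b).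
    by apply/seteqP; split => w /= [? ?]; split.
  apply: measurableI; first exact: measurable_M.
  apply: bigcap_measurableType => k _.
  by rewrite -[X in measurable X]setTI; apply: mX.
- exact: measurable_sieve_box_gen.
- move=> t /= [Mm hb]; split.
    by move=> k mk; rewrite ip_phi Mm ltnNge mk.
  by move=> k j km; rewrite ip_phi Mm km; exact: hb.
Qed.

End representation.

Lemma prior_spans : Pi (~` spans) = 0.
Proof.
have [d [T [P [M [X [mM mX HM HX HS]]]]]] := HPi.
exact: (rep_spans HS).
Qed.

Lemma prior_span_tail m :
  (Pi (~` span m) <= (B2 / (expR b2 - 1) * expR (- b2 * m%:R))%:E)%E.
Proof.
by have [d [T [P [M [X [mM mX HM HX HS]]]]]] := HPi; exact: (rep_span_tail mM mX HM HS).
Qed.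

Lemma prior_box_mass m (c : nat -> K) b : (1 <= m)%N -> 0 < b ->
  ((h m * \prod_(k < m) ((2 * b / tau k) ^+ dK *
      (D * expR (- dq * ((sabs (c k) + 2 * b) / tau k) `^ wq))))%:E
   <= Pi (sieve_box m c b))%E.
Proof.
by have [d [T [P [M [X [mM mX HM HX HS]]]]]] := HPi; exact: (rep_box_mass mM mX HM HX HS).
Qed.

(** The truncated expansions are dense, and each of them is the centre of boxes
    of positive prior mass.  So the denominator of the posterior is an integral
    over the whole space. *)
Lemma prior_support : support Pi = setT.
Proof.
apply/seteqP; split => // x _ U oU Ux.
have /nbhs_ballP [r /= r0 rU] : nbhs x U by exact: open_nbhs_nbhs.
have [m m1 mU] : exists2 m, (1 <= m)%N & U (proj ip1 e m x).
  have : \forall m \near \oo, U (proj ip1 e m x) by apply: (proj_cvg He); exact: open_nbhs_nbhs.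
  move=> [N _ HN]; exists N.+1 => //; apply: HN => /=; exact: leqnSn.
have /nbhs_ballP [s /= s0 sU] : nbhs (proj ip1 e m x) U by exact: open_nbhs_nbhs.
have [eps eps0 epss] : exists2 eps : R, 0 < eps & sofR K eps <= s.
  case: HK (s) s0 => -> /= s'; first by exists s'.
  case: s' => u v; rewrite ltcE /= => /andP[/eqP -> u0]; exists u => //.
pose N : R := (m * dK)%:R + 1.
have N0 : 0 < N by rewrite ltr_wpDl.
pose b := eps / (2 * N).
have b0 : 0 < b by rewrite divr_gt0 // mulr_gt0.
apply: (lt_le_trans _ (le_trans (prior_box_mass (fun k => ip1 x (e k)) m1 b0) _)).
  rewrite lte_fin; apply: mulr_gt0.
    have /andP[+ _] := Hhm m1; apply: lt_le_trans.
    by rewrite mulr_gt0 ?expR_gt0.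
  apply: prodr_gt0 => k _; apply: mulr_gt0; last by rewrite mulr_gt0 ?expR_gt0.
  by rewrite exprn_gt0 // divr_gt0 // mulr_gt0.
apply: le_measure; rewrite ?inE; [exact: measurable_sieve_box|exact: open_borel|].
move=> f [fm fb]; apply: sU; rewrite -ball_normE /=.
have gm : finite_span ip1 e m (proj ip1 e m x - f).
  by apply: finite_spanB => //; exact: finite_span_proj.
have lt : rnorm (proj ip1 e m x - f) < eps.
  rewrite -(ltr_pXn2r (n := 2)) // ?nnegrE ?(ltW eps0) ?rnorm_ge0 //.
  rewrite (rnorm_finite_span HK Hip1 He gm).
  apply: (@le_lt_trans _ _ (\sum_(k < m) \sum_(j < dK) b ^+ 2)).
    apply: ler_sum => k _; rewrite sabs_sqr //; apply: ler_sum => j _.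
    rewrite -[X in X <= _]real_normK ?num_real //.
    rewrite ler_pXn2r ?nnegrE ?(ltW b0) //.
    rewrite -/(scalar_coord _ _) ip1B scalar_coordB // distrC (ip_proj He) ltn_ord.
    exact: fb.
  rewrite !sumr_const !card_ord -mulrnA -[_ *+ (_ * _)]mulr_natl [(dK * m)%N]mulnC.
  have -> : eps ^+ 2 = (4 * N ^+ 2) * b ^+ 2 by rewrite /b; field; rewrite gt_eqF.
  rewrite ltr_pM2r ?exprn_gt0 //.
  have NN : (m * dK)%:R = N - 1 by rewrite /N addrK.
  have N1 : 1 <= N by rewrite /N lerDr.
  by rewrite NN; nra.
apply: lt_le_trans epss.
by rewrite -[`|_|]normr_id normE // -/(rnorm _) /sabs normr_id -subr_gt0 -sofRN // -sofRD // sofR_gt0 // subr_gt0.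
Qed.

End sieve.

(** * The posterior mass of a set in an abstract model *)

Section integral_null.
Context d (T : measurableType d) (R : realType) (mu : {measure set T -> \bar R}).
Local Open Scope ereal_scope.
Import HBNNSimple.

(** Works for arbitrary nonnegative functions, through the simple functions below
    them: the likelihood is measurable only on a set of full prior mass. *)
Lemma integral_le_off_null (N : set T) (f g : T -> \bar R) :
  measurable N -> mu N = 0 ->
  (forall x, 0 <= f x) -> (forall x, 0 <= g x) ->
  (forall x, ~ N x -> f x <= g x) -> \int[mu]_x f x <= \int[mu]_x g x.
Proof.
move=> mN N0 f0 g0 fg; rewrite !ge0_integralTE //.
apply: ge_ereal_sup => /= _ [h hf <-]; apply: ereal_sup_ubound => /=.
have mC : measurable (~` N) by exact: measurableC.
exists (proj_nnsfun h mC).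
  move=> x; rewrite -mrestrict patchE; case: ifPn => // xN.
  by apply: (le_trans (hf x)); apply: fg; move: xN; rewrite inE.
rewrite -!integralT_nnsfun -mrestrict.
transitivity (\int[mu]_(x in ~` N) (h x)%:E).
  by rewrite [RHS]integral_mkcond; apply: eq_integral => x _; rewrite !patchE; case: ifP.
have mh D : measurable_fun D (fun x => (h x)%:E).
  by apply/measurable_EFinP; exact: measurable_funTS.
rewrite -[in RHS](setUv N) ge0_integral_setU //=.
- by rewrite (null_set_integral mN (mh _) N0) add0e.
- by move=> x _; rewrite lee_fin.
- by apply/disj_set2P; exact: setICr.
Qed.

Lemma integral_eq_off_null (N : set T) (f g : T -> \bar R) :
  measurable N -> mu N = 0 ->
  (forall x, 0 <= f x) -> (forall x, 0 <= g x) ->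
  (forall x, ~ N x -> f x = g x) -> \int[mu]_x f x = \int[mu]_x g x.
Proof.
move=> mN N0 f0 g0 fg; apply/eqP; rewrite eq_le; apply/andP; split;
  by apply: (integral_le_off_null mN N0) => // x Nx; rewrite fg.
Qed.

End integral_null.

(** Here L x is the log-likelihood at the parameter x, L0 that of the truth, F a set
    of full prior mass on which L is jointly measurable, and V the sieve. *)
Section abstract_posterior.
Context d1 d2 (T1 : measurableType d1) (T2 : measurableType d2) (R : realType).
Variables (Pi : probability T1 R) (P : probability T2 R).
Variables (L : T1 -> T2 -> R) (L0 : T2 -> R) (F U S V : set T1).
Hypotheses (mF : measurable F) (mU : measurable U) (mS : measurable S) (mV : measurable V).
Hypothesis F1 : Pi (~` F) = 0%E.
Hypothesis mL : measurable_fun (F `*` [set: T2]) (fun p : T1 * T2 => L p.1 p.2).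
Hypothesis mL0 : measurable_fun setT L0.
Hypothesis LmL0 : forall x, F x -> (\int[P]_y (expR (L x y - L0 y))%:E = 1)%E.
Hypothesis SF : S `<=` F.

Let lik x y := (expR (L x y))%:E.
Let G : T1 * T2 -> R := (fun p => expR (L p.1 p.2)) \_ (F `*` [set: T2]).

Let G0 p : 0 <= G p.
Proof. by rewrite /G patchE; case: ifP => _ //; exact: expR_ge0. Qed.

Let GE x y : F x -> G (x, y) = expR (L x y).
Proof. by move=> Fx; rewrite /G patchE ifT // inE. Qed.

Let GN x y : ~ F x -> G (x, y) = 0.
Proof. by move=> Fx; rewrite /G patchE ifF //; apply/negP; rewrite inE => -[]. Qed.

Let mG : measurable_fun setT G.
Proof.
apply/(measurable_restrictT _ _).1; first exact: measurableX.
exact: measurableT_comp.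
Qed.

Let GA (A : set T1) (p : T1 * T2) : R := G p * \1_A p.1.

Let mGA A : measurable A -> measurable_fun setT (GA A).
Proof.
move=> mA; apply: measurable_funM => //.
have m1 : measurable_fun setT (\1_A : T1 -> R) by exact: measurable_indic.
exact: (measurableT_comp m1 measurable_fst).
Qed.

Let GA0 A p : 0 <= GA A p.
Proof. by rewrite mulr_ge0. Qed.

Let N A y := (\int[Pi]_x (GA A (x, y))%:E)%E.

Let mN A : measurable A -> measurable_fun setT (N A).
Proof.
move=> mA; apply: (@measurable_fun_fubini_tonelli_G _ _ _ _ _ Pi (fun p => (GA A p)%:E)).
  by apply/measurable_EFinP; exact: mGA.
by move=> p; rewrite lee_fin.
Qed.

Let N0 A y : (0 <= N A y)%E.
Proof. by apply: integral_ge0 => x _; rewrite lee_fin. Qed.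

Let mGy A y : measurable A -> measurable_fun setT (fun x => GA A (x, y)).
Proof. by move=> mA; apply: (measurableT_comp (mGA mA)); exact: measurable_pair2. Qed.

Let le_N A B y : measurable A -> measurable B -> A `<=` B -> (N A y <= N B y)%E.
Proof.
move=> mA mB AB; apply: integral_real_le => //; try exact: mGy.
move=> x; rewrite /GA ler_wpM2l // !indicE ler_nat /=.
by case: (boolP (x \in A)) => //; rewrite inE => /AB Bx; rewrite mem_set.
Qed.

Let int_lik A y : (\int[Pi]_(x in A) lik x y = N A y)%E.
Proof.
rewrite integral_mkcond; apply: (@integral_eq_off_null _ _ _ Pi (~` F)).
- exact: measurableC.
- exact: F1.
- by move=> x; apply: erestrict_ge0 => x' _; rewrite lee_fin expR_ge0.
- by move=> x; rewrite lee_fin.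
- move=> x /contrapT Fx; rewrite patchE /GA GE // indicE.
  by case: (x \in A); rewrite ?mulr1 ?mulr0.
Qed.

Let ratio y := fine (\int[Pi]_(x in U) lik x y)%E / fine (\int[Pi]_(x in setT) lik x y)%E.

(** The quotient is 0 when its denominator vanishes, so that denominator may be
    cleared. *)
Lemma ratio_setE (eps : R) : 0 < eps -> [set y | eps <= `|ratio y|] =
  [set y | 0 < fine (N setT y)] `&` [set y | eps * fine (N setT y) <= fine (N U y)].
Proof.
move=> eps0; apply/seteqP; split => y /=; rewrite /ratio !int_lik.
  have a0 : 0 <= fine (N U y) by exact: fine_ge0.
  have b0 : 0 <= fine (N setT y) by exact: fine_ge0.
  rewrite ger0_norm ?divr_ge0 //.
  have [b0'|b0'] := ltP 0 (fine (N setT y)).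
    by rewrite ler_pdivlMr.
  have -> : fine (N setT y) = 0 by apply/le_anti; rewrite b0 b0'.
  by rewrite invr0 mulr0 leNgt eps0.
move=> [b0 h]; rewrite ger0_norm; last by rewrite divr_ge0 ?fine_ge0.
by rewrite ler_pdivlMr.
Qed.

Lemma measurable_ratio (eps : R) : 0 < eps -> measurable [set y | eps <= `|ratio y|].
Proof.
move=> eps0; rewrite ratio_setE //.
have mf A : measurable A -> measurable_fun setT (fun y => fine (N A y)).
  by move=> mA; apply: measurableT_comp => //; exact: mN.
apply: measurableI.
- rewrite -[X in measurable X]setTI; apply: measurable_fun_ltr => //; exact: mf.
- rewrite -[X in measurable X]setTI; apply: measurable_fun_le => //; last exact: mf.
  by apply: measurable_funM => //; exact: mf.
Qed.

Let X y := (N (~` V) y * (expR (- L0 y))%:E)%E.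

Let mX : measurable_fun setT X.
Proof.
apply: emeasurable_funM; first by apply: mN; exact: measurableC.
by apply/measurable_EFinP; apply: measurableT_comp => //; exact: measurableT_comp.
Qed.

(** Each likelihood ratio has expectation 1, so by Tonelli the expected mass of
    the complement of V under the unnormalized posterior is its prior mass. *)
Let EX : (\int[P]_y X y <= Pi (~` V))%E.
Proof.
have mVc : measurable (~` V) by exact: measurableC.
pose Psi (p : T1 * T2) := (GA (~` V) p * expR (- L0 p.2))%:E.
have mPsi : measurable_fun setT Psi.
  apply/measurable_EFinP; apply: measurable_funM; first exact: mGA.
  apply: measurableT_comp => //; apply: measurableT_comp => //.
  by apply: (measurableT_comp mL0); exact: measurable_snd.
have Psi0 p : (0 <= Psi p)%E by rewrite lee_fin mulr_ge0 // expR_ge0.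
have -> : (\int[P]_y X y = \int[P]_y \int[Pi]_x Psi (x, y))%E.
  apply: eq_integral => y _; rewrite /X /N muleC -integral_realZ.
  - by apply: eq_integral => x _; rewrite /Psi mulrC.
  - exact: mGy.
  - by move=> x; exact: GA0.
  - exact: expR_ge0.
rewrite -(@fubini_tonelli _ _ _ _ _ Pi P Psi mPsi Psi0).
apply: (@le_trans _ _ (\int[Pi]_x (\1_(~` V) x)%:E)%E); last first.
  by rewrite integral_indic // setIT.
apply: (@integral_le_off_null _ _ _ Pi (~` F)).
- exact: measurableC.
- exact: F1.
- by move=> x; apply: integral_ge0.
- by move=> x; rewrite lee_fin.
move=> x /contrapT Fx.
rewrite (eq_integral (fun y => (\1_(~` V) x * expR (L x y - L0 y))%:E)); last first.
  by move=> y _; rewrite /Psi /GA GE //= expRD; congr EFin; ring.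
rewrite integral_realZ //; first by rewrite LmL0 // mule1.
- apply: measurableT_comp => //; apply: measurable_funB => //.
  have := measurable_funTS mG.
  have : measurable_fun setT (fun y => L x y).
    have -> : (fun y => L x y) = (fun y => ((fun p : T1 * T2 => L p.1 p.2) \_ (F `*` [set: T2])) (x, y)).
      by apply/funext => y; rewrite patchE ifT // inE.
    apply: measurableT_comp; last exact: measurable_pair1.
    by apply/(measurable_restrictT _ _).1 => //; exact: measurableX.
  by [].
Qed.

(** All masses are relative to exp L0.  Off the bad event the denominator is at least
    the contribution of S, which is exp(-lo - s) or more, and the part of the
    numerator in V is at most exp(-up).  The part
    outside V is controlled in expectation, hence by Markov's inequality. *)
Lemma posterior_small (bad : set T2) (p1 lo up s t eps : R) :
  measurable bad -> (P bad <= p1%:E)%E ->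
  (forall y x, ~ bad y -> S x -> - lo <= L x y - L0 y) ->
  (forall y x, ~ bad y -> F x -> U x -> V x -> L x y - L0 y <= - up) ->
  ((expR (- s))%:E <= Pi S)%E -> (Pi (~` V) <= t%:E)%E -> 0 < eps ->
  expR (- up) <= eps / 2 * expR (- (lo + s)) ->
  (P [set y | (eps <= `|ratio y|)%R] <= (p1 + 2 / eps * expR (lo + s) * t)%:E)%E.
Proof.
move=> mbad Pbad hS hU PS PV eps0 up_lo.
have mVc : measurable (~` V) by exact: measurableC.
pose a := eps / 2 * expR (- (lo + s)).
have a0 : 0 < a by rewrite mulr_gt0 ?expR_gt0 ?divr_gt0.
have X0 y : (0 <= X y)%E by rewrite mule_ge0 // lee_fin expR_ge0.
have mXa : measurable [set y | (a%:E <= X y)%E].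
  by rewrite -[Y in measurable Y]setTI; exact: emeasurable_fun_c_infty.
apply: (@le_trans _ _ (P (bad `|` [set y | (a%:E <= X y)%E]))).
  apply: le_measure; rewrite ?inE; [exact: measurable_ratio|exact: measurableU|].
  rewrite ratio_setE // => y [/= den0 hnum].
  have [?|nbad] := pselect (bad y); [by left|right].
  have denfin : N setT y \is a fin_num.
    by move: den0; case: (N setT y) (N0 setT y) => //=; rewrite ltxx.
  have fin A : measurable A -> N A y \is a fin_num.
    move=> mA; rewrite ge0_fin_numE //; apply: (@le_lt_trans _ _ (N setT y)).
      exact: le_N.
    by rewrite -ge0_fin_numE.
  pose q0 := expR (L0 y) * expR (- (lo + s)).
  have denq : q0 <= fine (N setT y).
    rewrite -lee_fin fineK //; apply: (@le_trans _ _ (N S y)); last exact: le_N.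
    apply: (@le_trans _ _ ((expR (L0 y - lo))%:E * Pi S)%E).
      apply: (@le_trans _ _ ((expR (L0 y - lo))%:E * (expR (- s))%:E)%E).
        by rewrite -EFinM lee_fin /q0 -!expRD ler_expR; lra.
      by apply: lee_wpmul2l => //; rewrite lee_fin expR_ge0.
    have -> : Pi S = (\int[Pi]_x (\1_S x)%:E)%E by rewrite integral_indic // setIT.
    rewrite -integral_realZ ?expR_ge0 //.
    apply: integral_real_le.
    - by apply: measurable_funM.
    - exact: mGy.
    - by move=> x; rewrite mulr_ge0 // expR_ge0.
    - move=> x; rewrite /GA indicE; case: (boolP (x \in S)) => xS; last by rewrite !mulr0.
      rewrite /= !mulr1 GE; last by apply: SF; rewrite inE in xS.
      by rewrite ler_expR; have := hS y x nbad (set_mem xS); lra.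
  have numle : fine (N U y) <= expR (L0 y - up) + fine (N (~` V) y).
    rewrite -lee_fin fineK ?fin // EFinD fineK ?fin //.
    rewrite -[X in (_ <= X + _)%E](prob_integral_cst Pi) -integral_realD;
      [|exact: measurable_cst|exact: mGy|by move=> *; exact: expR_ge0|by move=> *; exact: GA0].
    apply: integral_real_le.
    - exact: mGy.
    - by apply: measurable_funD => //; exact: mGy.
    - by move=> x; exact: GA0.
    - move=> x; rewrite {1}/GA indicE; case: (boolP (x \in U)) => xU; last first.
        by rewrite mulr0 addr_ge0 // expR_ge0.
      rewrite mulr1 /GA indicE in_setC; case: (boolP (x \in V)) => xV /=.
        rewrite mulr0 addr0; have [Fx|nFx] := pselect (F x).
          rewrite GE // ler_expR.
          by have := hU y x nbad Fx (set_mem xU) (set_mem xV); lra.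
        by rewrite GN // expR_ge0.
      by rewrite mulr1 lerDr expR_ge0.
  rewrite /= /X -(fineK (fin _ mVc)) -EFinM lee_fin.
  have E1 : expR (L0 y) * expR (- L0 y) = 1 by exact: expRxMexpNx_1.
  have E0 := expR_gt0 (- L0 y).
  have h1 : eps * q0 <= expR (L0 y - up) + fine (N (~` V) y).
    by apply: le_trans numle; apply: le_trans hnum; rewrite ler_pM2l.
  have h2 : expR (L0 y - up) <= expR (L0 y) * a.
    by rewrite expRD; apply: ler_wpM2l => //; exact: expR_ge0.
  have h3 : expR (L0 y) * a = eps * q0 / 2 by rewrite /a /q0; field.
  have h4 : expR (L0 y) * a <= fine (N (~` V) y) by lra.
  have := ler_wpM2r (ltW E0) h4; apply: le_trans.
  by rewrite mulrAC E1 mul1r.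
apply: (le_trans (measureU2 _ _ _)) => //.
rewrite EFinD; apply: leeD => //.
apply: (le_trans (markov_ereal P mX X0 a0)).
apply: (@le_trans _ _ ((a^-1)%:E * t%:E)%E).
  apply: lee_wpmul2l; first by rewrite lee_fin invr_ge0 ltW.
  exact: le_trans EX PV.
rewrite -EFinM lee_fin /a le_eqVlt; apply/orP; left; apply/eqP.
by rewrite invfM expRN invrK invf_div.
Qed.

End abstract_posterior.

(** * The likelihood ratio and its exceptional event *)

Section posterior_bound.
Variables (R : realType) (K : scalars R).
Hypothesis HK : K = real_scalars R \/ K = complex_scalars R.
Variables (H1 H2 : completeNormedModType K).
Variables (ip1 : {dot H1 for @sconj R K}) (ip2 : {dot H2 for @sconj R K}).
Hypotheses (Hip1 : hilbert_norm ip1) (Hip2 : hilbert_norm ip2).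
Variables (A : {linear H1 -> H2}) (Astar : {linear H2 -> H1}).
Hypotheses (Acont : continuous A) (Ainj : injective A).
Hypothesis Aadj : is_adjoint ip1 ip2 A Astar.
Variables (e : nat -> H1) (g : nat -> H2) (rho : nat -> R).
Hypothesis He : orthonormal_basis ip1 e.
Hypothesis Heig : forall k, Astar (A (e k)) = sofR K (rho k ^+ 2) *: e k.
Hypothesis Hg : orthonormal_system ip2 g.
Hypothesis HAe : forall k, A (e k) = sofR K (rho k) *: g k.
Variables (d : measure_display) (T : measurableType d) (P : probability T R).
Variable Z : H2 -> T -> R.
Hypothesis HZ : white_noise ip2 P Z.
Variables (n : nat) (f0 : H1).
Hypothesis n1 : (1 <= n)%N.

Notation dK := (size (sbasis K)).
Notation span := (finite_span ip1 e).
Notation proj m := (proj ip1 e m f0).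

Let rt : R := n%:R * n%:R `^ (- 2^-1).

Let n0 : 0 < n%:R :> R. Proof. by rewrite ltr0n. Qed.

Let rt2 : rt ^+ 2 = n%:R.
Proof.
rewrite /rt expr2 mulrACA -powRD; last by rewrite (gt_eqF n0) implybT.
have -> : - 2^-1 - 2^-1 = -1 :> R by field.
by rewrite powR_inv1 ?ltW // mulfK // gt_eqF.
Qed.

Let rt0 : 0 < rt. Proof. by rewrite mulr_gt0 // powR_gt0. Qed.

Definition loglik (f : H1) (w : T) : R :=
  log_likelihood ip1 A e g rho n (observation ip2 A f0 n Z w) f.

(** The log-likelihood of the truth, written with the noise at A f0 itself, because
    f0 need not belong to any sieve. *)
Definition loglik_truth (w : T) : R :=
  rt * Z (A f0) w + n%:R / 2 * rnorm (A f0) ^+ 2.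

(** An encoding of A f - A f0 by noise coordinates. *)
Definition noise_image (m : nat) (f : H1) : seq (R * H2) :=
  (-1, A f0) :: map (fun i : 'I_m * 'I_dK => (rho i.1 * rcoord ip1 e f i, rdir g i))
    (index_enum _).

Lemma vcomb_noise_image m f : span m f -> vcomb (noise_image m f) = A f - A f0.
Proof.
move=> fm; rewrite /vcomb big_cons big_map /= sofRN // sofR1 // scaleN1r addrC.
by rewrite [X in _ = X - _](image_coord HK He HAe fm).
Qed.

Lemma lincomb_noise_image m f w : lincomb Z (noise_image m f) w =
  \sum_(i : 'I_m * 'I_dK) rho i.1 * rcoord ip1 e f i * Z (rdir g i) w - Z (A f0) w.
Proof. by rewrite /lincomb big_cons big_map /= mulN1r addrC. Qed.

Lemma log_ratio m f w : span m f ->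
  loglik f w - loglik_truth w = rt * lincomb Z (noise_image m f) w
    - n%:R / 2 * rnorm (A f - A f0) ^+ 2.
Proof.
move=> fm; rewrite /loglik (log_likelihood_finite HK A g rho n _ fm) lincomb_noise_image.
have -> : \sum_(i : 'I_m * 'I_dK) rho i.1 * rcoord ip1 e f i *
    observation ip2 A f0 n Z w (rdir g i) = rip ip2 (A f) (A f0) +
    n%:R `^ (- 2^-1) * \sum_(i : 'I_m * 'I_dK) rho i.1 * rcoord ip1 e f i * Z (rdir g i) w.
  rewrite (rip_image HK ip2 He HAe _ fm) mulr_sumr -big_split /=; apply: eq_bigr => i _.
  by rewrite /observation mulrDr -/(rip ip2 _ _) [rip _ (A f0) _]ripC // mulrCA.
set W := \sum_i _; rewrite /loglik_truth.
rewrite (rnorm_sqr HK Hip2 (A f - A f0)) ripBl // !ripBr // -!(rnorm_sqr HK Hip2).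
rewrite (ripC HK ip2 (A f0) (A f)) mulrDr mulrA -/rt.
by field.
Qed.

(** The likelihood ratio is a probability density. *)
Lemma log_ratio_mgf f : spans ip1 e f ->
  (\int[P]_w (expR (loglik f w - loglik_truth w))%:E = 1)%E.
Proof.
move=> [m _ fm]; under eq_integral do rewrite (log_ratio _ fm) addrC expRD.
have ml := measurable_lincomb HZ (noise_image m f).
rewrite integral_realZ ?expR_ge0 //; last 1 first.
  by apply: measurableT_comp => //; exact: measurable_funM.
rewrite (lincomb_mgf HK Hip2 HZ) (vcomb_noise_image fm) rt2 -EFinM -expRD.
by rewrite [X in expR X](_ : _ = 0) ?expR0 //; ring.
Qed.

Lemma measurable_rcoord m (i : 'I_m * 'I_dK) :
  measurable_fun setT (fun f : borel H1 => rcoord ip1 e f i).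
Proof. exact: measurable_rip. Qed.

Lemma measurable_rnorm_image :
  measurable_fun setT (fun f : borel H1 => rnorm (A f)).
Proof.
apply: continuous_borel => f.
apply: (@continuous_comp _ _ _ A (@rnorm R K H2)); first exact: Acont.
exact: rnorm_continuous.
Qed.

Lemma measurable_observation h :
  measurable_fun setT (fun w => observation ip2 A f0 n Z w h).
Proof.
apply: measurable_funD => //; apply: measurable_funM => //.
exact: measurable_noise HZ h.
Qed.

(** On the union of the sieves the likelihood is the eventually constant limit of
    jointly measurable finite sums. *)
Lemma measurable_loglik : measurable_fun ((spans ip1 e : set (borel H1)) `*` [set: T])
  (fun p : borel H1 * T => loglik p.1 p.2).
Proof.
pose h m (p : borel H1 * T) := n%:R * \sum_(i : 'I_m * 'I_dK)
   rho i.1 * rcoord ip1 e p.1 i * observation ip2 A f0 n Z p.2 (rdir g i)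
   - n%:R / 2 * rnorm (A p.1) ^+ 2.
apply: (@measurable_fun_cvg _ _ _ _ h).
- move=> m; apply: measurable_funTS; apply: measurable_funB.
    apply: measurable_funM => //; apply: measurable_sum => i.
    apply: measurable_funM; last exact: (measurableT_comp (measurable_observation _) measurable_snd).
    apply: measurable_funM => //.
    exact: (measurableT_comp (measurable_rcoord i) measurable_fst).
  apply: measurable_funM => //; apply: measurable_funX.
  exact: (measurableT_comp measurable_rnorm_image measurable_fst).
- move=> [f w] [[m _ fm] _]; apply: cvg_near_cst; near=> N.
  rewrite /h /loglik /= (log_likelihood_finite HK A g rho n _ (m := N)) //.
  by apply: (finite_spanS _ fm); near: N; exact: nbhs_infty_ge.
Unshelve. all: by end_near. Qed.

Section events.
Variables (m : nat) (v : R).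
Hypotheses (m0 : (0 < m)%N) (v0 : 0 < v).

Let N : R := #|{: 'I_m * 'I_dK}|%:R.

Let Q w := \sum_(i : 'I_m * 'I_dK) Z (rdir g i) w ^+ 2.

(** Either the noise coordinates of the sieve are together too large, or the noise
    in the direction of the bias A (proj m - f0) is. *)
Definition bad_event : set T :=
  [set w | 2 * N <= Q w] `|` [set w | v / rt <= `|lincomb Z (noise_image m (proj m)) w|].

Let mQ : measurable_fun setT Q.
Proof.
by apply: measurable_sum => i; apply: measurable_funX; exact: measurable_noise HZ _.
Qed.

Let mbad1 : measurable [set w | 2 * N <= Q w].
Proof. by rewrite -[X in measurable X]setTI; exact: measurable_fun_le. Qed.

Let mbad2 : measurable [set w | v / rt <= `|lincomb Z (noise_image m (proj m)) w|].
Proof.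
rewrite -[X in measurable X]setTI; apply: measurable_fun_le => //.
by apply: measurableT_comp => //; exact: measurable_lincomb HZ _.
Qed.

Lemma measurable_bad_event : measurable bad_event.
Proof. exact: measurableU. Qed.

Let span_proj : span m (proj m). Proof. exact: finite_span_proj. Qed.

Lemma bad_event_le : (P bad_event <=
  (2 / N + n%:R * rnorm (A (f0 - proj m)) ^+ 2 / v ^+ 2)%:E)%E.
Proof.
apply: (le_trans (measureU2 _ mbad1 mbad2)); rewrite EFinD; apply: leeD.
  apply: (noise_chi_square HK Hip2 HZ).
    by move=> i j; exact: rdir_orthonormal.
  by rewrite card_prod !card_ord muln_gt0 m0 sdim_gt0.
apply: (le_trans (lincomb_chebyshev HK Hip2 HZ _ _)); first by rewrite divr_gt0.
rewrite (vcomb_noise_image span_proj) lee_fin expr_div_n rt2.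
rewrite -(rnormN (A _ - _)) opprB -linearB invf_div mulrCA mulrA.
by [].
Qed.

(** The cross term between f - proj m and the bias vanishes by
    [image_residual_orthogonal]. *)
Let split_ratio f w : span m f -> loglik f w - loglik_truth w =
  \sum_(i : 'I_m * 'I_dK) rt * (rho i.1 * rcoord ip1 e (f - proj m) i) * Z (rdir g i) w
  + rt * lincomb Z (noise_image m (proj m)) w
  - n%:R / 2 * (rnorm (A (f - proj m)) ^+ 2 + rnorm (A (f0 - proj m)) ^+ 2).
Proof.
move=> fm; rewrite (log_ratio _ fm) !lincomb_noise_image; congr (_ - _ * _).
  rewrite mulrBr mulrBr addrA !mulr_sumr -big_split /=; congr (_ - _).
  apply: eq_bigr => i _.
  by rewrite /rcoord ripBl //; ring.
have fp : span m (f - proj m) by exact: finite_spanB.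
have -> : A f - A f0 = A (f - proj m) - A (f0 - proj m).
  by rewrite -!linearB /= opprB addrA subrK.
rewrite (rnorm_sqr HK Hip2) ripBl // !ripBr // -!(rnorm_sqr HK Hip2).
rewrite (ripC HK ip2 (A (f0 - proj m))).
rewrite (image_residual_orthogonal HK Ainj Aadj He Heig HAe f0 fp).
by ring.
Qed.

(** The noise term is linear in f - proj m, so half of the quadratic term of the
    likelihood absorbs it by a z <= a^2 / 4 + z^2, coordinate by coordinate. *)
Lemma bad_event_upper f w (l : R) : ~ bad_event w -> span m f -> 2 * N <= l * v ->
  loglik f w - loglik_truth w <=
  (l + 1) * v - n%:R * rnorm (A (f - proj m)) ^+ 2 / 4.
Proof.
move=> /not_orP[/negP q1 /negP q2] fm Nl; rewrite -ltNge in q1; rewrite -ltNge in q2.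
have fp : span m (f - proj m) by exact: finite_spanB.
rewrite split_ratio //; set V := lincomb _ _ _ in q2 *.
have V1 : rt * V <= v.
  rewrite -(ler_pdivlMl _ _ rt0) mulrC; apply: ltW; exact: le_lt_trans (ler_norm _) q2.
have h1 : \sum_(i : 'I_m * 'I_dK) rt * (rho i.1 * rcoord ip1 e (f - proj m) i) * Z (rdir g i) w
   <= n%:R * rnorm (A (f - proj m)) ^+ 2 / 4 + Q w.
  rewrite (rnorm_image_coord HK Hip2 He Hg HAe fp) -rt2 mulr_sumr mulr_suml -big_split /=.
  apply: ler_sum => i _; set a := rho _ * _; set z := Z _ w.
  have := sqr_ge0 (rt * a / 2 - z); nra.
have h2 : 0 <= n%:R * rnorm (A (f0 - proj m)) ^+ 2 by rewrite mulr_ge0 // sqr_ge0.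
by lra.
Qed.

(** Here the same inequality is used with a weight lam: the noise energy l v enters
    divided by lam, which can be made small compared with the exponent of the
    prior mass outside the sieve. *)
Lemma bad_event_lower f w (l lam : R) : ~ bad_event w -> span m f -> 2 * N <= l * v ->
  0 < lam ->
  - ((lam * (n%:R * rnorm (A (f - proj m)) ^+ 2) + l * v / lam) / 2 + v +
     n%:R / 2 * (rnorm (A (f - proj m)) ^+ 2 + rnorm (A (f0 - proj m)) ^+ 2))
  <= loglik f w - loglik_truth w.
Proof.
move=> /not_orP[/negP q1 /negP q2] fm Nl lam0; rewrite -ltNge in q1; rewrite -ltNge in q2.
have fp : span m (f - proj m) by exact: finite_spanB.
rewrite split_ratio //; set V := lincomb _ _ _ in q2 *.
have V1 : - v <= rt * V.
  have := ltW q2; rewrite -(ler_pM2l rt0) mulrCA divff ?gt_eqF // mulr1 => V1.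
  rewrite lerNl -mulrN; apply: le_trans V1; rewrite ler_pM2l // -normrN; exact: ler_norm.
have h1 : - ((lam * (n%:R * rnorm (A (f - proj m)) ^+ 2) + Q w / lam) / 2) <=
   \sum_(i : 'I_m * 'I_dK) rt * (rho i.1 * rcoord ip1 e (f - proj m) i) * Z (rdir g i) w.
  rewrite (rnorm_image_coord HK Hip2 He Hg HAe fp) -rt2 !mulr_sumr !mulr_suml.
  rewrite -big_split /= mulr_suml -sumrN; apply: ler_sum => i _.
  set a := rho _ * _; set z := Z _ w.
  have h : 0 <= (lam * (rt * a) + z) ^+ 2 / lam.
    by rewrite divr_ge0 ?sqr_ge0 // ltW.
  have : (lam * (rt * a) + z) ^+ 2 / lam =
     lam * (rt ^+ 2 * a ^+ 2) + 2 * (rt * a * z) + z ^+ 2 / lam.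
    by field; rewrite gt_eqF.
  lra.
have h2 : Q w / lam <= l * v / lam.
  by rewrite ler_pM2r ?invr_gt0 //; apply: le_trans Nl; exact: ltW.
by lra.
Qed.

End events.

Variable Pi : probability (borel H1) R.
Hypotheses (Pi_spans : Pi (~` spans ip1 e) = 0%E) (Pi_support : support Pi = setT).

(** The deterministic part is collected in constants relative to v, the order of
    n times the squared rate in H2: l for the noise energy of the sieve, cS for the
    bias, c6 for the radius of the set S around the truth, and bb for the
    separation of the alternatives.  Then lo is the resulting loss in the
    denominator. *)
Lemma posterior_mass_le (m : nat) (v r l lam c6 cS bb s t eps : R) (S : set H1) :
  (0 < m)%N -> 0 < v -> 0 < lam -> 0 < eps ->
  2 * (m * dK)%:R <= l * v ->
  n%:R * rnorm (A (f0 - proj m)) ^+ 2 <= cS * v ->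
  measurable (S : set (borel H1)) -> S `<=` span m ->
  (forall f, S f -> n%:R * rnorm (A (f - proj m)) ^+ 2 <= c6 * v) ->
  (forall f, span m f -> r < rnorm (f - f0) ->
     bb * v <= n%:R * rnorm (A (f - proj m)) ^+ 2) ->
  ((expR (- s))%:E <= Pi S)%E -> (Pi (~` span m) <= t%:E)%E ->
  let lo := ((lam * c6 + l / lam) / 2 + 1 + (c6 + cS) / 2) * v in
  expR (- ((bb / 4 - l - 1) * v)) <= eps / 2 * expR (- (lo + s)) ->
  (P [set w | (eps <= `|posterior ip1 A e g rho Pi n (observation ip2 A f0 n Z w)
       [set f | (r < rnorm (f - f0))%R]|)%R] <=
   (2 / (m * dK)%:R + cS / v + 2 / eps * expR (lo + s) * t)%:E)%E.
Proof.
move=> m0 v0 lam0 eps0 Nl hS mS Sm hSc hU PS Pt lo hup.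
have cardE : #|{: 'I_m * 'I_dK}| = (m * dK)%N by rewrite card_prod !card_ord.
rewrite -cardE in Nl *.
have oU : open [set f | r < rnorm (f - f0)].
  rewrite (_ : [set f | _] = (fun f => rnorm (f - f0)) @^-1` [set x | r < x]) //.
  apply: open_comp; last exact: open_gt.
  move=> f _; apply: (@continuous_comp _ _ _ (fun f : H1 => f - f0) (@rnorm R K H1)).
    by apply: cvgB; [exact: cvg_id|exact: cvg_cst].
  exact: rnorm_continuous.
have -> : [set w | eps <= `|posterior ip1 A e g rho Pi n (observation ip2 A f0 n Z w)
       [set f | r < rnorm (f - f0)]|] = [set w | eps <=
    `|fine (\int[Pi]_(f in [set f | (r < rnorm (f - f0))%R]) (expR (loglik f w))%:E)%E /
      fine (\int[Pi]_(f in setT) (expR (loglik f w))%:E)%E|].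
  by apply/seteqP; split => w /=; rewrite /posterior Pi_support.
apply: (@posterior_small _ _ (borel H1) T R Pi P loglik loglik_truth (spans ip1 e)
   [set f | r < rnorm (f - f0)] S (span m) _ _ _ _ _ _ _ _ _ (bad_event m v) _ lo
   ((bb / 4 - l - 1) * v) s t eps) => //.
- exact: measurable_spans.
- exact: open_borel.
- exact: measurable_span.
- exact: measurable_loglik.
- apply: measurable_funD => //; apply: measurable_funM => //.
  exact: measurable_noise HZ _.
- exact: log_ratio_mgf.
- by move=> f Sf; exists m => //; exact: Sm.
- exact: measurable_bad_event.
- apply: (le_trans (bad_event_le m0 v0)); rewrite lee_fin lerD2l.
  rewrite ler_pdivrMr ?exprn_gt0 //; apply: (le_trans hS).
  by rewrite expr2 mulrA divfK // gt_eqF.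
- move=> w f nb Sf; have blow := bad_event_lower nb (Sm _ Sf) Nl lam0.
  apply: le_trans blow.
  rewrite lerN2 /lo.
  have h1 := hSc _ Sf; set a := n%:R * _ in h1 *.
  have h2 : lam * a <= lam * (c6 * v) by rewrite ler_pM2l.
  have -> : n%:R / 2 * (rnorm (A (f - proj m)) ^+ 2 + rnorm (A (f0 - proj m)) ^+ 2) =
    (a + n%:R * rnorm (A (f0 - proj m)) ^+ 2) / 2 by rewrite /a; field.
  have -> : l * v / lam = l / lam * v by rewrite mulrAC.
  by lra.
- move=> w f nb _ Uf mf; apply: (le_trans (bad_event_upper nb mf Nl)).
  by have := hU f mf Uf; lra.
Qed.

End posterior_bound.

(** * Dimension and rate *)

Section scale.
Variables (R : realType) (alpha gamma : R).
Hypotheses (Halpha : 0 <= alpha) (Hgamma : 0 < gamma).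
Variable n : nat.

Let L : R := ln n%:R.
Hypothesis L1 : 1 <= L.

Let N : R := 2 * alpha + 2 * gamma + 1.

(** The solution of the bias-variance balance x ln n = n x^(-2 (alpha + gamma)) in
    the image space. *)
Definition dim_scale : R := (n%:R / ln n%:R) `^ N^-1.

Definition dim_truth : nat := (Num.trunc dim_scale).+1.

(** n times the squared contraction rate in the image space. *)
Definition log_dim : R := dim_truth%:R * ln n%:R.

Let x := dim_scale.

Let N1 : 1 <= N. Proof. by move: Halpha Hgamma; rewrite /N; lra. Qed.

Let N0 : N != 0. Proof. by rewrite gt_eqF //; exact: lt_le_trans N1. Qed.

Lemma sample_gt0 : 0 < n%:R :> R.
Proof. by rewrite ltNge; apply/negP => /ln0 L0; move: L1; rewrite /L L0; lra. Qed.

Let n0 := sample_gt0.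

Let L0 : 0 < L. Proof. exact: lt_le_trans L1. Qed.

Lemma sampleE : n%:R = expR L. Proof. by rewrite lnK. Qed.

Let lL := ln L.

Let LE : L = expR lL. Proof. by rewrite lnK. Qed.

Let lL0 : 0 <= lL. Proof. exact: ln_ge0. Qed.

Let lLL : lL < L. Proof. exact: ln_sublinear. Qed.

Let lx := (L - lL) / N.

(** All scales are written as exponentials of lx = ln x and lL = ln ln n; identities
    between them become linear in these two numbers. *)
Let xE : x = expR lx.
Proof. by rewrite /x /dim_scale [X in X / _]sampleE -/L {2}LE -expRN -expRD -expRM. Qed.

Let lx0 : 0 <= lx. Proof. by rewrite divr_ge0 ?subr_ge0 ?(ltW lLL) // (le_trans _ N1). Qed.

Let LlxE : L = N * lx + lL.
Proof. by rewrite /lx mulrC divfK // [RHS]subrK. Qed.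

Lemma dim_scale_ge1 : 1 <= x.
Proof. by rewrite xE -expR0 ler_expR. Qed.

Lemma dim_truth_gt : x < dim_truth%:R.
Proof. by have /andP[] := @truncn_itv R x (ltW (lt_le_trans ltr01 dim_scale_ge1)). Qed.

Lemma dim_truth_le : dim_truth%:R <= 2 * x.
Proof.
have /andP[h _] := @truncn_itv R x (ltW (lt_le_trans ltr01 dim_scale_ge1)).
by have := dim_scale_ge1; rewrite /dim_truth -addn1 natrD -/x; lra.
Qed.

Lemma dim_scale_pow_le : x `^ gamma <= n%:R.
Proof.
rewrite xE -expRM sampleE ler_expR LlxE mulrC; apply: (@le_trans _ _ (N * lx)); last by rewrite lerDl.
by apply: ler_wpM2r => //; move: Halpha Hgamma; rewrite /N; lra.
Qed.

Lemma dim_truth_le_expR : dim_truth%:R <= expR (2 * L).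
Proof.
apply: (le_trans dim_truth_le); have e2 : 2 <= expR 1 :> R by have := expR_ge1Dx (1 : R); lra.
have xL : x <= expR L.
  rewrite xE ler_expR LlxE; have : lx <= N * lx by rewrite ler_peMl.
  by move/le_trans; apply; rewrite lerDl.
have -> : 2 * L = L + L by ring.
rewrite expRD; apply: ler_pM => //; first by rewrite xE expR_ge0.
by apply: (le_trans e2); rewrite ler_expR.
Qed.

Lemma log_dim_ge : L <= log_dim.
Proof. by rewrite ler_peMl ?(ltW L0) // ler1n. Qed.

Lemma dim_truth_le_log_dim : dim_truth%:R <= log_dim.
Proof. by rewrite ler_peMr. Qed.

Lemma log_dim_le : log_dim <= 2 * (x * L).
Proof. by rewrite mulrA ler_wpM2r ?(ltW L0) // dim_truth_le. Qed.

Lemma scale_log_dim : x * L <= log_dim.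
Proof. by rewrite ler_wpM2r ?(ltW L0) // ltW // dim_truth_gt. Qed.

(** At m = x this is the balance defining [dim_scale]. *)
Lemma residual_scale m : x <= m%:R ->
  n%:R * m%:R `^ (- (2 * (alpha + gamma))) <= log_dim.
Proof.
move=> xm; apply: le_trans scale_log_dim.
have s0 : 0 <= 2 * (alpha + gamma) by rewrite mulr_ge0 // addr_ge0 // ltW.
have x0 : 0 < x by rewrite xE expR_gt0.
apply: (@le_trans _ _ (n%:R * x `^ (- (2 * (alpha + gamma))))).
  apply: ler_wpM2l; first exact: ltW.
  rewrite !powRN lef_pV2; [|exact: powR_gt0 (lt_le_trans x0 xm)|exact: powR_gt0 x0].
  by apply: ge0_ler_powR; rewrite // nnegrE ltW // (lt_le_trans x0).
rewrite sampleE {2}LE xE -expRM -!expRD ler_expR [L]LlxE /N.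
by rewrite le_eqVlt; apply/orP; left; apply/eqP; ring.
Qed.

Definition contraction_rate : R := ln n%:R `^ ((2 * alpha + 1) * (alpha + gamma) /
    (2 * alpha + 2 * gamma + 1)) / n%:R `^ (gamma / (2 * alpha + 2 * gamma + 1)).

(** The rate in H1 is x^(-gamma) (ln n)^alpha: the bias at dimension x, enlarged by
    the logarithm that the inverse of A turns into (ln n)^alpha on a sieve of
    dimension of order x ln n. *)
Lemma rateE : contraction_rate = expR (alpha * lL - gamma * lx).
Proof.
rewrite /contraction_rate -/L -/N [in n%:R `^ _]sampleE LE -!expRM -LE -expRN -expRD; congr expR.
rewrite [L]LlxE; apply: (mulfI N0); rewrite /N; field.
by move: N0; rewrite /N.
Qed.

Lemma rate_gt0 : 0 < contraction_rate. Proof. by rewrite rateE expR_gt0. Qed.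

Lemma bias_rate m : x <= m%:R -> m%:R `^ (- (2 * gamma)) <= contraction_rate ^+ 2.
Proof.
move=> xm; have x0 : 0 < x by rewrite xE expR_gt0.
apply: (@le_trans _ _ (x `^ (- (2 * gamma)))).
  rewrite !powRN lef_pV2; [|exact: powR_gt0 (lt_le_trans x0 xm)|exact: powR_gt0 x0].
  apply: ge0_ler_powR => //; rewrite ?nnegrE; first by rewrite mulr_ge0 // ltW.
    exact: ltW.
  by rewrite ltW // (lt_le_trans x0).
rewrite rateE xE -expRM expr2 -expRD ler_expR.
have : 0 <= alpha * lL by rewrite mulr_ge0.
  by lra.
Qed.

(** Inverting A on a sieve of dimension kappa log_dim costs its power 2 alpha.  The
    rate is such that n rate^2 = (x ln n)^(2 alpha + 1) pays for it. *)
Lemma image_rate (kappa : R) m : 0 < kappa -> (0 < m)%N -> m%:R <= kappa * log_dim ->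
  (8 * kappa ^+ 2) `^ (- alpha) / 2 * log_dim <=
  n%:R * (2 * m%:R ^+ 2) `^ (- alpha) * contraction_rate ^+ 2.
Proof.
move=> k0 m0 mk; have x0 : 0 < x by rewrite xE expR_gt0.
have h1 : (8 * kappa ^+ 2) `^ (- alpha) * (x * L) `^ (- (2 * alpha))
   <= (2 * m%:R ^+ 2) `^ (- alpha).
  have -> : (x * L) `^ (- (2 * alpha)) = ((x * L) ^+ 2) `^ (- alpha).
    by rewrite -(powR_mulrn 2) ?mulr_ge0 ?ltW // -powRrM; congr (_ `^ _); ring.
  have p1 : 0 < (x * L) ^+ 2 by rewrite exprn_gt0 // mulr_gt0.
  have p2 : 0 < 8 * kappa ^+ 2 by rewrite mulr_gt0 // exprn_gt0.
  have p3 : 0 < 2 * m%:R ^+ 2 :> R by rewrite mulr_gt0 // exprn_gt0 // ltr0n.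
  have p4 := mulr_gt0 p2 p1.
  rewrite -(powRM _ (ltW p2) (ltW p1)) !powRN lef_pV2 ?posrE ?powR_gt0 //.
  apply: ge0_ler_powR; rewrite ?nnegrE ?(ltW p3) ?(ltW p4) //.
  have h : m%:R <= kappa * (2 * (x * L)) by apply: (le_trans mk); rewrite ler_pM2l // log_dim_le.
  have : m%:R ^+ 2 <= (kappa * (2 * (x * L))) ^+ 2 :> R.
    by rewrite ler_pXn2r // nnegrE // !mulr_ge0 // ltW.
  by rewrite !exprMn; lra.
apply: (@le_trans _ _ (n%:R * ((8 * kappa ^+ 2) `^ (- alpha) * (x * L) `^ (- (2 * alpha))) * contraction_rate ^+ 2)); last first.
  by apply: ler_wpM2r; [exact: sqr_ge0|apply: ler_wpM2l => //; exact: ltW].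
have -> : n%:R * ((8 * kappa ^+ 2) `^ (- alpha) * (x * L) `^ (- (2 * alpha))) * contraction_rate ^+ 2 =
   (8 * kappa ^+ 2) `^ (- alpha) * (x * L).
  set W := (8 * _) `^ _; set p := (x * L) `^ _.
  have -> : n%:R * (W * p) * contraction_rate ^+ 2 = W * (n%:R * p * contraction_rate ^+ 2) by ring.
  congr (_ * _); rewrite /p.
  rewrite rateE sampleE {2 3}LE xE -expRD -expRM expr2 -!expRD; congr expR.
  by rewrite [L]LlxE /N; ring.
rewrite -mulrA; apply: ler_wpM2l; first exact: powR_ge0.
by have := log_dim_le; lra.
Qed.

Lemma weight_le_expR k : (k < dim_truth)%N -> weight R k <= expR (5 * L).
Proof.
move=> kJ; have h : k.+1%:R <= expR (2 * L).
  by apply: le_trans dim_truth_le_expR; rewrite ler_nat.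
have h2 : k.+1%:R ^+ 2 <= expR (4 * L).
  have -> : 4 * L = 2 * L + 2 * L by ring.
  by rewrite expRD -expr2 ler_pXn2r // nnegrE ?expR_ge0.
have e2 : 2 <= expR L by have := expR_ge1Dx L; move: L1; lra.
have e4 : 1 <= expR (4 * L) by rewrite -[leLHS]expR0 ler_expR; move: L1; lra.
have -> : 5 * L = L + 4 * L by ring.
rewrite expRD /weight; apply: (@le_trans _ _ (2 * expR (4 * L))); first by lra.
by apply: ler_wpM2r => //; exact: expR_ge0.
Qed.

Lemma weight_le_sample k : (k < dim_truth)%N ->
  n%:R^-1 <= 8 `^ (gamma / 2) * weight R k `^ (- (gamma / 2)).
Proof.
move=> kJ; have w0 := weight_gt0 R k.
rewrite powRN -[leLHS]mul1r ler_pdivlMr ?powR_gt0 // mulrAC ler_pdivrMr // mul1r.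
apply: (@le_trans _ _ ((8 * x ^+ 2) `^ (gamma / 2))).
  have x20 : 0 <= 8 * x ^+ 2 by apply: mulr_ge0 => //; exact: sqr_ge0.
  apply: ge0_ler_powR; rewrite ?nnegrE ?x20 ?(ltW w0) //; first by rewrite divr_ge0 // ltW.
  have x0 : 0 <= x by rewrite xE expR_ge0.
  have h : k.+1%:R <= 2 * x by apply: le_trans dim_truth_le; rewrite ler_nat.
  have h2 : k.+1%:R ^+ 2 <= (2 * x) ^+ 2 by rewrite ler_pXn2r ?nnegrE ?mulr_ge0.
  have h1 : 1 <= x ^+ 2 by rewrite exprn_ege1 // dim_scale_ge1.
  by rewrite /weight; move: h2; rewrite exprMn; lra.
rewrite powRM ?sqr_ge0 //; apply: ler_wpM2l; first exact: powR_ge0.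
apply: le_trans dim_scale_pow_le.
rewrite -powR_mulrn; last by rewrite xE expR_ge0.
by rewrite -powRrM (_ : 2 * (gamma / 2) = gamma) //; field.
Qed.

End scale.

Section prior_factor.
Variables (R : realType) (alpha gamma gamma0 : R).
Hypotheses (Halpha : 0 <= alpha) (Hgamma : 0 < gamma) (Hgamma0 : gamma0 <= gamma).
Variables (tau c : nat -> R) (B3 B4 D dq wq S : R).
Hypotheses (HB3 : 0 < B3) (HB4 : 0 < B4) (HD : 0 < D) (Hdq : 0 < dq) (Hw : 1 <= wq).
Hypotheses (Htau : forall k, 0 < tau k) (HS : 0 < S) (c0 : forall k, 0 <= c k).
Hypothesis Hc : forall k, c k ^+ 2 <= S * weight R k `^ (- gamma).
Hypothesis Htaubd : forall k, (1 <= k)%N ->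
     B3 * weight R k `^ (- gamma0 / 2) * ln k.+1%:R `^ (- wq^-1)
       <= tau k <= B4 * weight R k `^ ((alpha + 1) / 2).

Notation J n := (dim_truth alpha gamma n).

Lemma le_expR_ln (a : R) : a <= expR `|ln a|.
Proof.
have [a0|a0] := ltP 0 a; last by apply: (le_trans a0); exact: expR_ge0.
by rewrite -{1}(@lnK _ a) // ler_expR ler_norm.
Qed.

Lemma ge_expR_ln (a : R) : 0 < a -> expR (- `|ln a|) <= a.
Proof.
by move=> a0; rewrite -{2}(@lnK _ a) // ler_expR lerNl -normrN ler_norm.
Qed.

Lemma scale_upper : exists2 C : R, 0 <= C & forall n k, 1 <= ln n%:R :> R ->
  (k < J n)%N -> tau k <= expR (C * ln n%:R).
Proof.
exists (`|ln (tau 0%N)| + (`|ln B4| + 5 * ((alpha + 1) / 2))).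
  by rewrite !addr_ge0 // mulr_ge0 // divr_ge0 // addr_ge0.
move=> n k L1 kJ; have a0 : 0 <= (alpha + 1) / 2 by rewrite divr_ge0 // addr_ge0.
set L := ln _ in L1 *.
have t1 := normr_ge0 (ln (tau 0%N)); have t2 := normr_ge0 (ln B4).
case: k kJ => [|k] kJ.
  apply: (le_trans (le_expR_ln _)); rewrite ler_expR; nra.
have /andP[_ h] := Htaubd (ltn0Sn k); apply: (le_trans h).
apply: (@le_trans _ _ (expR `|ln B4| * expR (5 * L * ((alpha + 1) / 2)))).
  apply: ler_pM; [exact: ltW|exact: powR_ge0|exact: le_expR_ln|].
  rewrite expRM; apply: ge0_ler_powR => //; rewrite ?nnegrE ?expR_ge0 ?(ltW (weight_gt0 _ _)) //.
  exact: weight_le_expR kJ.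
rewrite -expRD ler_expR; nra.
Qed.

(** The scales tau_k decay no faster than the coefficients of f0, up to a factor
    (ln k)^(-1/w).  Raised to the power w this factor costs ln k <= 2 ln n. *)
Lemma coefficient_upper : exists2 C : R, 0 <= C & forall n k, 1 <= ln n%:R :> R ->
  (k < J n)%N -> ((c k + 2 * n%:R^-1) / tau k) `^ wq <= C * ln n%:R.
Proof.
pose G := Num.sqrt S + 2 * 8 `^ (gamma / 2).
have G0 : 0 <= G by rewrite addr_ge0 ?sqrtr_ge0 // mulr_ge0 // powR_ge0.
have w0 : 0 <= wq by exact: le_trans Hw.
exists (((c 0%N + 2) / tau 0%N) `^ wq + 2 * (G / B3) `^ wq).
  by rewrite addr_ge0 ?mulr_ge0 ?powR_ge0.
move=> n k L1 kJ; have n0 := sample_gt0 L1; set L := ln _ in L1 *.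
have p1 : 0 <= ((c 0%N + 2) / tau 0%N) `^ wq by exact: powR_ge0.
have p2 : 0 <= (G / B3) `^ wq by exact: powR_ge0.
have n1 : n%:R^-1 <= 1 :> R by rewrite invf_le1 // sampleE // -[leLHS]expR0 ler_expR (le_trans _ L1).
case: k kJ => [|k] kJ.
  apply: (@le_trans _ _ (((c 0%N + 2) / tau 0%N) `^ wq)); last by nra.
  have ni : 0 <= n%:R^-1 :> R by rewrite invr_ge0 ltW.
  have t0 : 0 <= (tau 0%N)^-1 by rewrite invr_ge0 ltW.
  apply: ge0_ler_powR => //; rewrite ?nnegrE ?mulr_ge0 ?addr_ge0 ?mulr_ge0 //.
  by apply: ler_wpM2r => //; lra.
have lk : 0 < ln k.+2%:R :> R by rewrite ln_gt0 // ltr1n.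
have lkL : ln k.+2%:R <= 2 * L.
  rewrite -ler_expR lnK ?posrE ?ltr0n //.
  by apply: le_trans (dim_truth_le_expR Halpha Hgamma L1); rewrite ler_nat.
have W0 := weight_gt0 R k.+1.
have h1 : c k.+1 + 2 * n%:R^-1 <= G * weight R k.+1 `^ (- (gamma / 2)).
  have hc : c k.+1 <= Num.sqrt S * weight R k.+1 `^ (- (gamma / 2)).
    rewrite -(ler_pXn2r (n := 2)) ?nnegrE ?mulr_ge0 ?sqrtr_ge0 ?powR_ge0 //.
    rewrite exprMn sqr_sqrtr ?(ltW HS) // [X in _ <= _ * X]expr2 -weight_powRD.
    by have -> : - (gamma / 2) + - (gamma / 2) = - gamma by field.
  have := weight_le_sample Halpha Hgamma L1 kJ.
  by rewrite /G mulrDl; lra.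
have /andP[h2 _] := Htaubd (ltn0Sn k).
have h3 : B3 * weight R k.+1 `^ (- (gamma / 2)) * ln k.+2%:R `^ (- wq^-1) <= tau k.+1.
  apply: le_trans h2; apply: ler_wpM2r; first exact: powR_ge0.
  apply: ler_wpM2l; first exact: ltW.
  by apply: ler_powR; [exact: weight_ge1|move: Hgamma0; lra].
apply: (@le_trans _ _ ((G / B3 * ln k.+2%:R `^ wq^-1) `^ wq)).
  apply: ge0_ler_powR => //; rewrite ?nnegrE.
  - apply: mulr_ge0; last by rewrite invr_ge0 ltW.
    by rewrite addr_ge0 // mulr_ge0 // invr_ge0 ltW.
  - by rewrite mulr_ge0 ?powR_ge0 // divr_ge0 // ltW.
  rewrite ler_pdivrMr //; apply: (le_trans h1).
  have p0 : 0 <= G / B3 * ln k.+2%:R `^ wq^-1 by rewrite mulr_ge0 ?powR_ge0 // divr_ge0 // ltW.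
  apply: le_trans (ler_wpM2l p0 h3).
  rewrite le_eqVlt; apply/orP; left; apply/eqP.
  have q1 : ln k.+2%:R `^ wq^-1 != 0 by rewrite gt_eqF ?powR_gt0.
  rewrite [ln _ `^ (- _)]powRN; set W := weight _ _ `^ _; set l := ln _ `^ _ in q1 *.
  by field; rewrite q1 gt_eqF.
have g0 : 0 <= G / B3 by rewrite divr_ge0 // ltW.
rewrite (powRM _ g0 (powR_ge0 _ _)) -powRrM mulVf; last by rewrite gt_eqF // (lt_le_trans _ Hw).
by rewrite powRr1 ?(ltW lk) //; nra.
Qed.

(** Each coordinate of the box of radius 1/n has prior mass at least a power
    of 1/n: the volume, the scale tau_k and the density each cost such a power. *)
Lemma prior_factor_lower d : exists2 C : R, 0 <= C & forall n k, 1 <= ln n%:R :> R ->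
  (k < J n)%N -> expR (- (C * ln n%:R)) <= (2 * n%:R^-1 / tau k) ^+ d *
      (D * expR (- dq * ((c k + 2 * n%:R^-1) / tau k) `^ wq)).
Proof.
have [C1 C10 h1] := scale_upper; have [C2 C20 h2] := coefficient_upper.
exists ((1 + C1) * d%:R + `|ln D| + dq * C2).
  by rewrite !addr_ge0 ?mulr_ge0 // ?addr_ge0 // ltW.
move=> n k L1 kJ; have n0 := sample_gt0 L1.
have := h1 n k L1 kJ; have := h2 n k L1 kJ; have nE := sampleE L1.
set L := ln _ in L1 nE *; set y := _ `^ wq => hy ht.
have f1 : expR (- ((1 + C1) * d%:R * L)) <= (2 * n%:R^-1 / tau k) ^+ d.
  have -> : - ((1 + C1) * d%:R * L) = d%:R * (- ((1 + C1) * L)) by ring.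
  rewrite expRM_natl; apply: lerXn2r; rewrite ?nnegrE ?expR_ge0 //.
    by rewrite divr_ge0 ?mulr_ge0 ?invr_ge0 // ltW.
  have -> : - ((1 + C1) * L) = - L + - (C1 * L) by ring.
  rewrite expRD !expRN -nE; apply: ler_pM; rewrite ?invr_ge0 ?expR_ge0 ?(ltW n0) //.
    by rewrite ler_peMl ?invr_ge0 ?(ltW n0) // ler1n.
  by rewrite lef_pV2 ?posrE ?expR_gt0.
have f2 : expR (- (`|ln D| * L)) <= D.
  apply: le_trans (ge_expR_ln HD); rewrite ler_expR lerN2.
  by rewrite ler_peMr.
have f3 : expR (- (dq * C2 * L)) <= expR (- dq * y).
  by rewrite ler_expR mulNr lerN2 -mulrA ler_pM2l.
have -> : - (((1 + C1) * d%:R + `|ln D| + dq * C2) * L) =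
  - ((1 + C1) * d%:R * L) + (- (`|ln D| * L) + - (dq * C2 * L)) by ring.
by rewrite !expRD; apply: ler_pM; rewrite ?mulr_ge0 ?expR_ge0 //; apply: ler_pM; rewrite ?expR_ge0.
Qed.

End prior_factor.

(** * Bias, separation and the prior ball *)

Section rates.
Variables (R : realType) (K : scalars R).
Hypothesis HK : K = real_scalars R \/ K = complex_scalars R.
Variables (H1 H2 : completeNormedModType K).
Variables (ip1 : {dot H1 for @sconj R K}) (ip2 : {dot H2 for @sconj R K}).
Hypotheses (Hip1 : hilbert_norm ip1) (Hip2 : hilbert_norm ip2).
Variable A : {linear H1 -> H2}.
Variables (e : nat -> H1) (g : nat -> H2) (rho : nat -> R).
Hypothesis He : orthonormal_basis ip1 e.
Hypothesis Hg : orthonormal_system ip2 g.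
Hypothesis HAe : forall k, A (e k) = sofR K (rho k) *: g k.
Variables (alpha gamma : R) (f0 : H1).
Hypotheses (Hgamma : 0 < gamma) (Halpha : 0 <= alpha).
Variables (c1 c2 S : R).
Hypotheses (c10 : 0 < c1) (c20 : 0 < c2) (S0 : 0 < S).
Hypothesis Hrho : forall k, c1 * weight R k `^ (- alpha / 2) <= `|rho k|
        <= c2 * weight R k `^ (- alpha / 2).

Notation span := (finite_span ip1 e).
Notation proj m := (proj ip1 e m f0).
Notation coef k := (ip1 f0 (e k)).

Hypothesis tails : forall m,
  [/\ rnorm (f0 - proj m) ^+ 2 <= S * m.+1%:R `^ (- (2 * gamma)),
      rnorm (A (f0 - proj m)) ^+ 2 <= S * m.+1%:R `^ (- (2 * (alpha + gamma))) &
      sabs (coef m) ^+ 2 <= S * weight R m `^ (- gamma)].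

Variable n : nat.
Hypothesis L1 : 1 <= ln n%:R :> R.

Notation x := (dim_scale alpha gamma n).
Notation J := (dim_truth alpha gamma n).
Notation v := (log_dim alpha gamma n).
Notation rate := (contraction_rate alpha gamma n).

Let n0 : 0 < n%:R :> R. Proof. exact: sample_gt0. Qed.

Lemma image_residual_le m : x <= m%:R -> n%:R * rnorm (A (f0 - proj m)) ^+ 2 <= S * v.
Proof.
move=> xm; have [_ h _] := tails m.
have xm1 : x <= m.+1%:R by apply: (le_trans xm); rewrite ler_nat.
apply: (le_trans (ler_wpM2l (ltW n0) h)); rewrite mulrCA.
by apply: ler_wpM2l; [exact: ltW|exact: residual_scale].
Qed.

(** Inverse inequality: on the m-th sieve the singular values are at least of
    order m^(-alpha). *)
Lemma image_span_ge m f : span m f ->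
  c1 ^+ 2 * (2 * m%:R ^+ 2) `^ (- alpha) * rnorm f ^+ 2 <= rnorm (A f) ^+ 2.
Proof.
move=> fm; rewrite (rnorm_finite_span HK Hip1 He fm) (rnorm_image HK Hip2 He Hg HAe fm).
rewrite mulr_sumr; apply: ler_sum => k _; apply: ler_wpM2r; first exact: sqr_ge0.
apply: le_trans (rho_sqr_ge c10 Hrho k); apply: ler_wpM2l; first exact: sqr_ge0.
have h : weight R k <= 2 * m%:R ^+ 2.
  have h1 : k.+1%:R <= m%:R :> R by rewrite ler_nat.
  have h2 : k.+1%:R ^+ 2 <= m%:R ^+ 2 :> R by rewrite ler_pXn2r ?nnegrE.
  have h3 : 1 <= m%:R ^+ 2 :> R by rewrite exprn_ege1 // (le_trans _ h1) // ler1n.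
  by rewrite /weight; lra.
have W0 := weight_gt0 R k; have p0 := lt_le_trans W0 h.
rewrite !powRN lef_pV2 ?posrE ?powR_gt0 //; apply: ge0_ler_powR => //; rewrite nnegrE ltW //.
Qed.

(** Outside a ball around f0 of radius C rate, f is also far from the projection of
    f0, as the bias is of the order of the rate; the inverse inequality transfers
    this distance to H2. *)
Lemma separation m f (kappa C : R) : (0 < m)%N -> 0 < kappa -> x <= m%:R ->
  m%:R <= kappa * v -> Num.sqrt S <= C -> span m f -> C * rate < rnorm (f - f0) ->
  c1 ^+ 2 * ((8 * kappa ^+ 2) `^ (- alpha) / 2) * (C - Num.sqrt S) ^+ 2 * v <=
  n%:R * rnorm (A (f - proj m)) ^+ 2.
Proof.
move=> m0 k0 xm mk SC fm far.
have fp : span m (f - proj m) by apply: finite_spanB => //; exact: finite_span_proj.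
have r0 : 0 < rate by exact: rate_gt0.
have [hb _ _] := tails m.
have xm1 : x <= m.+1%:R by apply: (le_trans xm); rewrite ler_nat.
have bias : rnorm (f0 - proj m) <= Num.sqrt S * rate.
  rewrite -(ler_pXn2r (n := 2)) ?nnegrE ?rnorm_ge0 //; last exact: mulr_ge0 (sqrtr_ge0 _) (ltW r0).
  rewrite exprMn sqr_sqrtr ?(ltW S0) //; apply: (le_trans hb).
  by apply: ler_wpM2l; [exact: ltW|exact: bias_rate].
have dist : (C - Num.sqrt S) * rate <= rnorm (f - proj m).
  have : rnorm (f - f0) <= rnorm (f - proj m) + rnorm (f0 - proj m).
    have -> : f - f0 = (f - proj m) - (f0 - proj m) by rewrite opprB addrA subrK.
    exact: rnormB.
  by rewrite mulrBl; lra.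
have dist2 : (C - Num.sqrt S) ^+ 2 * rate ^+ 2 <= rnorm (f - proj m) ^+ 2.
  have d0 : 0 <= (C - Num.sqrt S) * rate by apply: mulr_ge0 (ltW r0); rewrite subr_ge0.
  by rewrite -exprMn ler_pXn2r ?nnegrE ?rnorm_ge0.
apply: (le_trans _ (ler_wpM2l (ltW n0) (image_span_ge fp))).
have p0 : 0 <= c1 ^+ 2 * (2 * m%:R ^+ 2) `^ (- alpha).
  by rewrite mulr_ge0 ?sqr_ge0 ?powR_ge0.
apply: (le_trans _ (ler_wpM2l (ltW n0) (ler_wpM2l p0 dist2))).
have h := image_rate Halpha Hgamma L1 k0 m0 mk.
have q0 : 0 <= c1 ^+ 2 * (C - Num.sqrt S) ^+ 2 by rewrite mulr_ge0 ?sqr_ge0.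
by have := ler_wpM2l q0 h; lra.
Qed.

(** Only the first J coefficients of f are near those of f0, while the projection has
    m of them.  The coefficients in between amount to a difference of two
    residuals, both within the balance. *)
Lemma box_image_le m f : (J <= m)%N -> sieve_box ip1 e J (fun k => coef k) n%:R^-1 f ->
  n%:R * rnorm (A (f - proj m)) ^+ 2 <= (12 * c2 ^+ 2 + 6 * S) * v.
Proof.
move=> Jm [fJ fbox]; have xJ : x <= J%:R by rewrite ltW // dim_truth_gt.
have xm : x <= m%:R by apply: (le_trans xJ); rewrite ler_nat.
have resJ := image_residual_le xJ; have resm := image_residual_le xm.
have ni : 0 <= n%:R^-1 :> R by rewrite invr_ge0 ltW.
have n1 : n%:R^-1 <= 1 :> R.
  by rewrite invf_le1 // (le_trans L1) // ltW // ln_sublinear.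
have fp : span J (f - proj J) by apply: finite_spanB => //; exact: finite_span_proj.
have near_image : n%:R * rnorm (A (f - proj J)) ^+ 2 <= 4 * c2 ^+ 2 * v.
  have h : rnorm (A (f - proj J)) ^+ 2 <= J%:R * (c2 ^+ 2 * (2 * n%:R^-1) ^+ 2).
    rewrite (rnorm_image HK Hip2 He Hg HAe fp).
    apply: (@le_trans _ _ (\sum_(k < J) c2 ^+ 2 * (2 * n%:R^-1) ^+ 2)); last first.
      by rewrite sumr_const card_ord -[leLHS]mulr_natl.
    apply: ler_sum => k _; apply: ler_pM; rewrite ?sqr_ge0 //.
      apply: (le_trans (rho_sqr_le c20 Hrho k)); rewrite ler_piMr ?sqr_ge0 //.
      rewrite powRN invf_le1 ?powR_gt0 ?weight_gt0 //.
      by rewrite -(powRr0 (weight R k)); apply: ler_powR => //; exact: weight_ge1.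
    rewrite ler_pXn2r ?nnegrE ?sabs_ge0 ?mulr_ge0 //.
    apply: sabs_le_coord => // j; rewrite ip1B (ip_proj He) ltn_ord scalar_coordB //.
    exact: fbox.
  apply: (le_trans (ler_wpM2l (ltW n0) h)).
  have -> : n%:R * (J%:R * (c2 ^+ 2 * (2 * n%:R^-1) ^+ 2)) =
     4 * c2 ^+ 2 * (J%:R * n%:R^-1) by field; rewrite gt_eqF.
  have p0 : 0 <= 4 * c2 ^+ 2 by apply: mulr_ge0 => //; exact: sqr_ge0.
  apply: ler_wpM2l => //.
  apply: le_trans (dim_truth_le_log_dim alpha gamma L1).
  by rewrite ler_piMr.
have split3 : A (f - proj m) = A (f - proj J) - A (f0 - proj J) + A (f0 - proj m).
  by rewrite -!linearB -linearD /= opprB [f - proj J + _]addrA subrK addrA subrK.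
have tri : rnorm (A (f - proj m)) <=
   rnorm (A (f - proj J)) + rnorm (A (f0 - proj J)) + rnorm (A (f0 - proj m)).
  rewrite split3; apply: (le_trans (rnormD HK _ _)); rewrite lerD2r; exact: rnormB.
move: tri resJ resm near_image.
set a := rnorm (A (f - proj m)); set b1 := rnorm (A (f - proj J)).
set b2 := rnorm (A (f0 - proj J)); set b3 := rnorm (A (f0 - proj m)) => tri h2 h3 h1.
have sq : a ^+ 2 <= 3 * (b1 ^+ 2 + b2 ^+ 2 + b3 ^+ 2).
  apply: (@le_trans _ _ ((b1 + b2 + b3) ^+ 2)).
    by rewrite ler_pXn2r ?nnegrE ?addr_ge0 ?rnorm_ge0.
  have := sqr_ge0 (b1 - b2); have := sqr_ge0 (b1 - b3); have := sqr_ge0 (b2 - b3); nra.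
by have := ler_wpM2l (ltW n0) sq; lra.
Qed.

End rates.

Section prior_ball.
Variables (R : realType) (K : scalars R).
Hypothesis HK : K = real_scalars R \/ K = complex_scalars R.
Variables (H1 : completeNormedModType K) (ip1 : {dot H1 for @sconj R K}).
Hypothesis Hip1 : hilbert_norm ip1.
Variable e : nat -> H1.
Hypothesis He : orthonormal_basis ip1 e.
Variables (alpha gamma gamma0 : R) (f0 : H1).
Hypotheses (Hgamma : 0 < gamma) (Halpha : 0 <= alpha) (Hgamma0 : gamma0 <= gamma).
Variables (h : nat -> R) (q : K -> R) (tau : nat -> R) (Pi : probability (borel H1) R).
Hypotheses (Hq : is_density q) (Htau : forall k, 0 < tau k).
Hypothesis HPi : sieve_prior e h q tau Pi.
Variables (B1 B2 b1 b2 D dq w B3 B4 S : R).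
Hypotheses (HB1 : 0 < B1) (Hb1 : 0 < b1).
Hypothesis Hhm : forall m, (1 <= m)%N ->
     B1 * expR (- b1 * m%:R) <= h m <= B2 * expR (- b2 * m%:R).
Hypotheses (HD : 0 < D) (Hdq : 0 < dq) (Hw : 1 <= w).
Hypothesis Hqlow : forall x : K, D * expR (- dq * sabs x `^ w) <= q x.
Hypotheses (HB3 : 0 < B3) (HB4 : 0 < B4).
Hypothesis Htaubd : forall k, (1 <= k)%N ->
     B3 * weight R k `^ (- gamma0 / 2) * ln k.+1%:R `^ (- w^-1)
       <= tau k <= B4 * weight R k `^ ((alpha + 1) / 2).
Hypotheses (S0 : 0 < S).
Hypothesis coef_le : forall k, sabs (ip1 f0 (e k)) ^+ 2 <= S * weight R k `^ (- gamma).

Notation J n := (dim_truth alpha gamma n).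
Notation v n := (log_dim alpha gamma n).

(** Each of the J coordinates costs exp(-C ln n) and the mass h(J) costs exp(-C J),
    so the exponent is altogether of order J ln n. *)
Lemma prior_ball : exists2 C : R, 0 <= C & forall n, 1 <= ln n%:R :> R ->
  ((expR (- (C * v n)))%:E <=
   Pi (sieve_box ip1 e (J n) (fun k => ip1 f0 (e k)) n%:R^-1))%E.
Proof.
have [C C0 hC] := prior_factor_lower Halpha Hgamma Hgamma0 HB3 HB4 HD Hdq Hw Htau S0
   (fun k => sabs_ge0 HK (ip1 f0 (e k))) coef_le Htaubd (size (sbasis K)).
exists (`|ln B1| + b1 + C); first by rewrite !addr_ge0 // ltW.
move=> n L1; have n0 := sample_gt0 L1.
have := prior_box_mass HK Hip1 He Hq Htau HPi HB1 Hhm HD Hdq Hw Hqlow (m := J n)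
   (fun k => ip1 f0 (e k)) (b := n%:R^-1) isT; rewrite invr_gt0 => /(_ n0).
apply: le_trans; rewrite lee_fin.
have Jv := dim_truth_le_log_dim alpha gamma L1.
have v1 : 1 <= v n := le_trans L1 (log_dim_ge alpha gamma L1).
apply: (@le_trans _ _ (expR (- `|ln B1| - b1 * (J n)%:R) * \prod_(k < J n) expR (- (C * ln n%:R)))).
  rewrite prodr_const card_ord -expRM_natl -expRD ler_expR.
  have -> : (J n)%:R * - (C * ln n%:R) = - (C * v n) by rewrite /log_dim; ring.
  have : b1 * (J n)%:R <= b1 * v n by rewrite ler_pM2l.
  have : `|ln B1| <= `|ln B1| * v n by rewrite ler_peMr.
  lra.
apply: ler_pM; rewrite ?expR_ge0 //.
- by apply: prodr_ge0 => k _; exact: expR_ge0.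
- have J1 : (1 <= J n)%N by exact: ltn0Sn.
  have /andP[hJ _] := Hhm J1; apply: le_trans hJ; rewrite expRD -mulNr.
  by apply: ler_wpM2r; [exact: expR_ge0|exact: ge_expR_ln].
- apply: ler_prod => k _; rewrite expR_ge0 /=; exact: hC.
Qed.

End prior_ball.

Lemma cvg_probability0 (R : realType) (d : nat -> measure_display)
    (T : forall n, measurableType (d n)) (P : forall n, probability (T n) R)
    (E : forall n, set (T n)) (G l : R) :
  0 <= G -> (forall n, l <= ln n%:R -> 1 <= ln n%:R :> R -> (P n (E n) <= (G / ln n%:R)%:E)%E) ->
  (fun n => P n (E n)) @ \oo --> 0%E.
Proof.
move=> G0 PE.
have lnoo (M : R) : \forall n \near \oo, M <= ln n%:R.
  near=> n; rewrite -ler_expR lnK; last first.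
    by rewrite posrE; apply: (@lt_le_trans _ _ (expR M)); [exact: expR_gt0|near: n; exact: nbhs_infty_ger].
  by near: n; exact: nbhs_infty_ger.
apply: (@squeeze_cvge _ _ _ _ (fun=> 0%E) _ (fun n => (G / ln n%:R)%:E)).
- near=> n; rewrite measure_ge0 /=; apply: PE; near: n; exact: lnoo.
- exact: cvg_cst.
- apply: cvg_EFin; first by near=> n.
  apply/cvgr0Pnorm_le => eps eps0; near=> n.
  have L1 : 1 <= ln n%:R :> R by near: n; exact: lnoo.
  rewrite ger0_norm /= ?divr_ge0 ?(le_trans _ L1) // ler_pdivrMr ?(lt_le_trans _ L1) //.
  by rewrite mulrC -ler_pdivrMr //; near: n; exact: lnoo.
Unshelve. all: by end_near. Qed.

(** * Contraction of the posterior *)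

Theorem proposition3p2 (R : realType)
  (K : scalars R) (HK : K = real_scalars R \/ K = complex_scalars R)
  (* the Hilbert spaces *)
  (H1 H2 : completeNormedModType K)
  (ip1 : {dot H1 for @sconj R K}) (ip2 : {dot H2 for @sconj R K})
  (Hip1 : hilbert_norm ip1) (Hip2 : hilbert_norm ip2)
  (Hsep1 : separable H1) (Hsep2 : separable H2)
  (* the operator and its diagonalization *)
  (A : {linear H1 -> H2}) (Astar : {linear H2 -> H1})
  (Acont : continuous A) (Ainj : injective A)
  (Aadj : is_adjoint ip1 ip2 A Astar)
  (e : nat -> H1) (g : nat -> H2) (rho : nat -> R)
  (He : orthonormal_basis ip1 e)
  (Heig : forall k, Astar (A (e k)) = sofR K (rho k ^+ 2) *: e k)
  (Hg : orthonormal_system ip2 g)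
  (HAe : forall k, A (e k) = sofR K (rho k) *: g k)
  (* the data: at each n >= 1, white noise Z n on a probability space T n *)
  (d : nat -> measure_display) (T : forall n, measurableType (d n))
  (P : forall n, probability (T n) R) (Z : forall n, H2 -> T n -> R)
  (HZ : forall n, (1 <= n)%N -> white_noise ip2 (P n) (@Z n))
  (* regularity of the truth and ill-posedness *)
  (alpha gamma : R) (f0 : H1)
  (Hgamma : 0 < gamma) (Hf0 : sobolev ip1 e gamma f0)
  (Halpha : 0 <= alpha) (Hmild : mildly_ill_posed alpha rho)
  (* the sieve prior *)
  (h : nat -> R) (q : K -> R) (tau : nat -> R)
  (Pi : probability (borel H1) R)
  (Hh : is_pmf h) (Hq : is_density q) (Htau : forall k, 0 < tau k)
  (HPi : sieve_prior e h q tau Pi)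
  (B1 B2 b1 b2 : R)
  (HB1 : 0 < B1) (HB2 : 0 < B2) (Hb1 : 0 < b1) (Hb2 : 0 < b2)
  (Hhm : forall m, (1 <= m)%N ->
     B1 * expR (- b1 * m%:R) <= h m <= B2 * expR (- b2 * m%:R))
  (D dq w : R) (HD : 0 < D) (Hdq : 0 < dq) (Hw : 1 <= w)
  (Hqlow : forall x : K, D * expR (- dq * sabs x `^ w) <= q x)
  (B3 B4 gamma0 : R)
  (HB3 : 0 < B3) (HB4 : 0 < B4) (Hgamma0 : gamma0 <= gamma)
  (Htaubd : forall k, (1 <= k)%N ->
     B3 * weight R k `^ (- gamma0 / 2) * ln k.+1%:R `^ (- w^-1)
       <= tau k <= B4 * weight R k `^ ((alpha + 1) / 2)) :
  let eta := (2 * alpha + 1) * (alpha + gamma)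
               / (2 * alpha + 2 * gamma + 1) in
  let rate n := ln n%:R `^ eta
                  / n%:R `^ (gamma / (2 * alpha + 2 * gamma + 1)) in
  exists C0 : R, 0 < C0 /\ forall C : R, C0 <= C ->
    cvg_in_probability0 P (fun n om =>
      posterior ip1 A e g rho Pi n (observation ip2 A f0 n (@Z n) om)
        [set f | C * rate n < rnorm (f - f0)]).
Proof.
move=> eta rate.
have rho0 k : rho k != 0 := rho_neq0 HK Ainj He HAe k.
have [c1 [c2 [c10 c20 Hrho]]] := mildly_ill_posed_all rho0 Hmild.
have [S S0 tails] := sobolev_tails HK Hip1 Hip2 Acont He Hg HAe Hgamma Hf0 Halpha c20 Hrho.
have coef_le k : sabs (ip1 f0 (e k)) ^+ 2 <= S * weight R k `^ (- gamma).
  by have [] := tails k.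
have [C5 C50 ball] := prior_ball HK Hip1 He Hgamma Halpha Hgamma0 Hq Htau HPi HB1 Hb1 Hhm
  HD Hdq Hw Hqlow HB3 HB4 Htaubd S0 coef_le.
pose dk : R := (size (sbasis K))%:R.
have dk1 : 1 <= dk by rewrite ler1n (sdim_gt0 HK).
pose Ct := B2 / (expR b2 - 1).
have Ct0 : 0 < Ct.
  by rewrite divr_gt0 // subr_gt0 -[ltLHS]expR0 ltr_expR.
(* With this lam the noise energy costs l / lam = b2 (Lc + 1), of which half
   enters the denominator. *)
pose c6 := 12 * c2 ^+ 2 + 6 * S; pose lam := 2 * dk / b2.
have lam0 : 0 < lam by rewrite divr_gt0 // mulr_gt0 // (lt_le_trans _ dk1).
have c60 : 0 < c6 by rewrite ltr_wpDl ?mulr_gt0 // mulr_ge0 // sqr_ge0.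
(* Half of b2 Lc pays for the noise energy, the other half for all that does not
   depend on Lc. *)
pose Lc := 1 + 2 / b2 * (b2 / 2 + lam * c6 / 2 + 1 + (c6 + S) / 2 + C5 + 1).
have Lc1 : 1 <= Lc.
  rewrite lerDl mulr_ge0 //; first by rewrite divr_ge0 // ltW.
  have : 0 <= lam * c6 by rewrite mulr_ge0 // ltW.
  by move: Hb2 c60 S0 C50; lra.
pose l := 2 * dk * (Lc + 1).
have l0 : 0 <= l.
  have d0 : 0 <= 2 * dk by move: dk1; clear; lra.
  by apply: (mulr_ge0 d0); move: Lc1; clear; lra.
pose lo := (lam * c6 + l / lam) / 2 + 1 + (c6 + S) / 2.
have loE : lo + C5 + 1 <= b2 * Lc.
  have llam : l / lam = b2 * (Lc + 1).
    by rewrite /l /lam; field; rewrite !gt_eqF // (lt_le_trans _ dk1).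
  rewrite /lo llam.
  have : b2 * (Lc - 1) = 2 * (b2 / 2 + lam * c6 / 2 + 1 + (c6 + S) / 2 + C5 + 1).
    by rewrite /Lc; field; rewrite gt_eqF.
  lra.
(* The separation that makes the numerator on the sieve smaller than the
   denominator by a factor e^-v. *)
pose bb := 4 * (l + 1 + lo + C5 + 1).
pose W := c1 ^+ 2 * ((8 * (Lc + 1) ^+ 2) `^ (- alpha) / 2).
have W0 : 0 < W.
  have k0 : 0 < Lc + 1 by lra.
  by rewrite mulr_gt0 ?exprn_gt0 // divr_gt0 // powR_gt0 // mulr_gt0 // exprn_gt0.
have lo0 : 0 <= lo.
  have : 0 <= lam * c6 by rewrite mulr_ge0 // ltW.
  have := divr_ge0 l0 (ltW lam0).
  by rewrite /lo; move: c60 S0; clear; lra.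
have bb0 : 0 <= bb.
  by rewrite /bb; move: l0 lo0 C50; clear; lra.
(* sqrt S accounts for the bias and W for the inverse inequality; the summand 1
   allows squaring, since y <= (1 + y)^2. *)
exists (Num.sqrt S + 1 + bb / W); split.
  by have := sqrtr_ge0 S; have : 0 <= bb / W by [rewrite divr_ge0 // ltW]; lra.
move=> C CC0 eps eps0.
have epsCt : 0 <= 2 / eps * Ct.
  by apply: mulr_ge0 (ltW Ct0); rewrite divr_ge0 // ltW.
have G0 : 0 <= 2 + S + 2 / eps * Ct by move: S0 epsCt; clear; lra.
apply: (@cvg_probability0 _ _ _ _ _ (2 + S + 2 / eps * Ct) (2 / eps)).
  exact: G0.
move=> n Leps L1.
have n1 : (1 <= n)%N by rewrite -(ltr0n R); exact: sample_gt0.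
pose v := log_dim alpha gamma n; pose J := dim_truth alpha gamma n.
have vL : ln n%:R <= v := log_dim_ge alpha gamma L1.
have v1 : 1 <= v := le_trans L1 vL.
have v0 : 0 < v by lra.
pose m := (Num.trunc (Lc * v)).+1.
have Lv0 : 0 <= Lc * v := mulr_ge0 (le_trans ler01 Lc1) (ltW v0).
have /andP[m_le m_gt] := truncn_itv Lv0.
rewrite -/m in m_gt.
have mk : m%:R <= (Lc + 1) * v by rewrite /m -[leLHS]natr1 [leRHS]mulrDl mul1r lerD.
have vm : v <= m%:R.
  by rewrite ltW // (le_lt_trans _ m_gt) // ler_peMl // ltW.
have Jm : (J <= m)%N.
  by rewrite -(ler_nat R); apply: le_trans vm; exact: dim_truth_le_log_dim.
have xm : dim_scale alpha gamma n <= m%:R.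
  apply: (@le_trans _ _ J%:R); last by rewrite ler_nat.
  by rewrite ltW //; exact: dim_truth_gt.
have decay : expR (- v) <= v^-1.
  by rewrite expRN lef_pV2 ?posrE ?expR_gt0 // ltW // (lt_le_trans _ (expR_ge1Dx v)) // ltrDr.
have small : expR (- v) <= eps / 2.
  apply: (le_trans decay); rewrite -[leRHS]invrK lef_pV2 ?posrE ?invr_gt0 ?divr_gt0 //.
  by rewrite invf_div; exact: le_trans vL.
have bound := posterior_mass_le HK Hip1 Hip2 Acont Ainj Aadj He Heig Hg HAe (HZ n n1) n1
  (prior_spans HK Hip1 He HPi) (prior_support HK Hip1 He Hq Htau HPi HB1 Hhm HD Hdq Hw Hqlow)
  (f0 := f0) (m := m) (v := v) (r := C * rate n) (l := l) (lam := lam) (c6 := c6) (cS := S) (bb := bb)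
  (s := C5 * v) (t := Ct * expR (- b2 * m%:R)) (eps := eps)
  (S := sieve_box ip1 e J (fun k => ip1 f0 (e k)) n%:R^-1).
cbv zeta in bound; rewrite -/lo in bound.
apply: (le_trans (bound _ _ _ _ _ _ _ _ _ _ _ _ _)) => //; clear bound.
- rewrite natrM -/dk /l; have := ler_wpM2r (ltW (lt_le_trans ltr01 dk1)) mk; lra.
- exact: image_residual_le.
- exact: measurable_sieve_box.
- by move=> f [fJ _]; exact: finite_spanS Jm fJ.
- by move=> f; exact: box_image_le.
- move=> f fm far.
  have k0 : 0 < Lc + 1 by lra.
  have SC : Num.sqrt S <= C.
    by have : 0 <= bb / W by [rewrite divr_ge0 // ltW]; lra.
  have := separation HK Hip1 Hip2 He Hg HAe Hgamma Halpha c10 S0 Hrho tails L1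
    (ltn0Sn _ : 0 < m)%N k0 xm mk SC fm far.
  apply: le_trans; rewrite -/W -/v; apply: ler_wpM2r; first exact: ltW.
  have h1 : 1 + bb / W <= C - Num.sqrt S by lra.
  have h2 : 0 <= bb / W by rewrite divr_ge0 // ltW.
  have h3 : bb / W <= (C - Num.sqrt S) ^+ 2.
    by move: h1 h2; clear; set y := bb / W; set z := C - _; nra.
  by rewrite mulrC -ler_pdivrMr.
- exact: ball.
- exact: (prior_span_tail HK Hip1 He HPi HB2 Hb2 Hhm).
- have -> : - ((bb / 4 - l - 1) * v) = - v + - (lo * v + C5 * v) by rewrite /bb; field.
  by rewrite expRD; apply: ler_wpM2r => //; exact: expR_ge0.
rewrite lee_fin -/lo.
have m0 : 0 < m%:R :> R by rewrite ltr0n.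
have t1 : 2 / (m * size (sbasis K))%:R <= 2 / v.
  have mdk0 : 0 < m%:R * dk := mulr_gt0 m0 (lt_le_trans ltr01 dk1).
  rewrite natrM -/dk ler_pM2l // (lef_pV2 mdk0 v0).
  by apply: (le_trans vm); rewrite ler_peMr // ltW.
have t2 : expR (lo * v + C5 * v) * expR (- b2 * m%:R) <= v^-1.
  apply: le_trans decay; rewrite -expRD ler_expR.
  have h1 : b2 * (Lc * v) <= b2 * m%:R by rewrite ler_pM2l // ltW.
  have h2 := ler_wpM2r (ltW v0) loE.
  by lra.
have t3 : 2 / eps * expR (lo * v + C5 * v) * (Ct * expR (- b2 * m%:R)) <= 2 / eps * Ct / v.
  have -> : 2 / eps * expR (lo * v + C5 * v) * (Ct * expR (- b2 * m%:R)) =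
    2 / eps * Ct * (expR (lo * v + C5 * v) * expR (- b2 * m%:R)) by ring.
  by exact: ler_wpM2l.
apply: (@le_trans _ _ ((2 + S + 2 / eps * Ct) / v)).
  rewrite [leRHS]mulrDl [X in _ <= X + _]mulrDl; apply: lerD t3.
  by rewrite lerD2r.
apply: ler_wpM2l; last by rewrite lef_pV2 ?posrE // (lt_le_trans _ L1).
exact: G0.
Qed.
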